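(* Let $\mathcal{H}=(\partial\colon I\to H,\rho)$ be a crossed module of Hopf algebras, $M$ a smooth manifold, and $(\omega,m_1,m_2)$ a fully primitive local Hopf 2-connection on $M$ with values in $\mathcal{H}$. Then the fuzzy holonomy of $(\omega,m_1,m_2)$ is determined by its exact holonomy, in the sense that, as maps from $\mathcal{P}(M)$ to $\mathcal{C}^+(\mathcal{BA}(\mathcal{H}))$ (on 1-paths and on 2-paths), $$\mathcal{T}_{\mathcal{BA}(\mathcal{H})}\circ\mathcal{C}^\times({\rm Inc}_{\mathcal{H}})\circ\mathcal{F}^\times_{(\overline\omega,\overline m)}=\mathcal{Z}^+_{(\overline\omega,\overline m)}.$$
   Context: All algebras are over $\mathbb{C}$; a bare algebra is an associative algebra, with or without identity; Sweedler notation $\Delta(x)=\sum_{(x)}x'\otimes x''$ is used; $h$ is a formal parameter; all algebraic structure is extended termwise ($\mathbb{C}[[h]]$-linearly) to formal power series. Crossed module of Hopf algebras $\mathcal{H}=(\partial\colon I\to H,\rho)$: a Hopf algebra map $\partial\colon I\to H$ and a linear left action $\rho\colon H\otimes I\to I$, $x\otimes v\mapsto x\triangleright v$, making $I$ an $H$-module algebra ($1\triangleright v=v$, $(xy)\triangleright v=x\triangleright(y\triangleright v)$, $x\triangleright(uv)=\sum(x'\triangleright u)(x''\triangleright v)$, $x\triangleright 1_I=\epsilon(x)1_I$) and an $H$-module coalgebra ($\Delta(x\triangleright v)=\sum(x'\triangleright v')\otimes(x''\triangleright v'')$, $\epsilon(x\triangleright v)=\epsilon(x)\epsilon(v)$),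 with $\sum x'\otimes(x''\triangleright v)=\sum x''\otimes(x'\triangleright v)$, $\partial(x\triangleright v)=\sum x'\partial(v)S(x'')$ and $\partial(u)\triangleright v=\sum u'vS(u'')$. Group-likes. $x=\sum h^nx_n\in H[[h]]$ is group-like if $\Delta(x_n)=\sum_{i+j=n}x_i\otimes x_j$ for all $n$. $H^*_{\rm gl}$ is the group of invertible group-like elements of $H[[h]]$ of the form $1_H+\sum_{n\ge1}h^nx_n$; likewise $I^*_{\rm gl}$. $\mathcal{H}^*_{\rm gl}=(\partial\colon I^*_{\rm gl}\to H^*_{\rm gl},\triangleright)$ is a crossed module of groups. Crossed modules of bare algebras. A pre-crossed module of bare algebras $(\partial\colon A\to B,\gtrdot,\lessdot)$: an algebra map $\partial$ and bilinear maps $(b,a)\mapsto b\gtrdot a\in A$, $(a,b)\mapsto a\lessdot b\in A$ with $(bb')\gtrdot a=b\gtrdot(b'\gtrdot a)$, $a\lessdot(bb')=(a\lessdot b)\lessdot b'$, $b\gtrdot(aa')=(b\gtrdot a)a'$, $(aa')\lessdot b=a(a'\lessdot b)$, $b\gtrdot(a\lessdot b')=(b\gtrdot a)\lessdot b'$, $(a\lessdot b)(b'\gtrdot a')=a((bb')\gtrdot a')=(a\lessdot(bb'))a'$, $\partial(b\gtrdot a)=b\partial(a)$, $\partial(a\lessdot b)=\partial(a)b$. It is a crossed module if also $\partial(a')\gtrdot a=a'a$ and $a\lessdot\partial(a')=aa'$ (second Peiffer relations); it is unital if $B$ has an identity acting as the identity on both sides. Dividing $A$ by the two-sided ideal generated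 by the second Peiffer relations (all $\partial(a)\gtrdot a'-aa'$ and $a\lessdot\partial(a')-aa'$), with quotient denoted $\underline A$ and projection $a\mapsto\underline a$, gives a crossed module $(\partial\colon\underline A\to B,\gtrdot,\lessdot)$. $\mathcal{BA}(\mathcal{H})$. Let $I^0=\ker(\epsilon\colon I\to\mathbb{C})$ and let $I^0\otimes_\rho H$ be the vector space $I^0\otimes H$ with product $(u\otimes x)(v\otimes y)=\sum u(x'\triangleright v)\otimes x''y$ (a subalgebra of $I\otimes_\rho H$, defined by the same formula). With $t(v\otimes x)=\partial(v)x$, $x\gtrdot a=(1_I\otimes x)a$, $a\lessdot x=a(1_I\otimes x)$, it gives a unital pre-crossed module of bare algebras $(t\colon I^0\otimes_\rho H\to H,\gtrdot,\lessdot)$; $\mathcal{BA}(\mathcal{H})=(t\colon\underline{I^0\otimes_\rho H}\to H,\gtrdot,\lessdot)$ is its associated crossed module. $\mathcal{A}^*_\bullet$. For a unital crossed module $\mathcal{A}=(\partial\colon A\to B,\gtrdot,\lessdot)$ of bare algebras, $A_\bullet=\mathbb{C}\oplus A$ is $A$ with an identity $1$ adjoined; $A_\bullet^*$ is the group of series $1+\sum_{n\ge1}h^na_n$, $a_n\in A$; $B^*$ is the group of series $1_B+\sum_{n\ge1}h^nb_n$, $b_n\in B$; $\partial(1+\sum h^na_n)=1_B+\sum h^n\partial(a_n)$ and $b\triangleright(1+a)=1+b\gtrdot a\lessdot b^{-1}$. These give a crossed module of groups $\mathcal{A}^*_\bullet=(\partial\colon A_\bullet^*\to B^*,\triangleright)$.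 ${\rm Inc}_{\mathcal{H}}\colon\mathcal{H}^*_{\rm gl}\to\mathcal{BA}(\mathcal{H})^*_\bullet$ is the map of crossed modules of groups given by the inclusion $H^*_{\rm gl}\subset H^*$ and by $1_I+\sum_{n\ge1}h^nv_n\mapsto1+\sum_{n\ge1}h^n\,\underline{v_n\otimes1_H}$. 2-groupoids. For a crossed module of groups $X=(\partial\colon E\to G,\triangleright)$, $\mathcal{C}^\times(X)$ is the 2-groupoid with one object, 1-morphisms $g\in G$ ($g$ followed by $g'$ is $gg'$), and 2-morphisms $(g,e)\in G\times E$ from $g$ (bottom) to $\partial(e)^{-1}g$ (top), with vertical composite $(g,e)$ then $(\partial(e)^{-1}g,f)$ equal to $(g,ef)$, right whiskering by $k$: $(gk,e)$, left whiskering by $k$: $(kg,k\triangleright e)$; a map $(f_E,f_G)$ of crossed modules induces $\mathcal{C}^\times(f)\colon(g,e)\mapsto(f_G(g),f_E(e))$. For a crossed module $\mathcal{A}$ of bare algebras, $\mathcal{C}^+(\mathcal{A})$ has one object, 1-morphisms $b\in B[[h]]$ (composition by product) and 2-morphisms $(b,a)\in B[[h]]\times A[[h]]$ from $b$ (bottom) to $b+\partial(a)$ (top), with vertical composite $(b,a)$ then $(b+\partial(a),a')$ equal to $(b,a+a')$, right whiskering by $b'$: $(bb',a\lessdot b')$, left whiskering of $(b',a)$ by $b$: $(bb',b\gtrdot a)$. For $\mathcal{A}$ unital, $\mathcal{T}_{\mathcal{A}}\colon\mathcal{C}^\times(\mathcal{A}^*_\bullet)\to\mathcal{C}^+(\mathcal{A})$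 is the 2-functor which is $b\mapsto b$ on 1-morphisms and $(g,e)\mapsto(g,(e^{-1}-1)\lessdot g)$ on 2-morphisms. Paths. A 1-path is a continuous piecewise smooth $\gamma\colon[0,1]\to M$. A 2-path is a continuous map $\Gamma\colon[0,1]^2\to M$, $(t,s)\mapsto\Gamma(t,s)$, piecewise smooth for some paving of the square by polygons transverse to its boundary, constant on $\{0\}\times[0,1]$ and on $\{1\}\times[0,1]$; bottom boundary $t\mapsto\Gamma(t,0)$, top boundary $t\mapsto\Gamma(t,1)$, $\gamma_s(t)=\Gamma(t,s)$. $\mathcal{P}(M)$ denotes the collection of points, 1-paths and 2-paths of $M$; points are sent to the unique object by all holonomy maps. Forms with values in an algebra take values in a finite dimensional subspace and are smooth as such; $d\omega(X,Y)=X\omega(Y)-Y\omega(X)-\omega([X,Y])$ and $\tfrac12(\omega\wedge^{[,]}\omega)(X,Y)=[\omega(X),\omega(Y)]$. A local Hopf 2-connection is a triple $\omega\in\Omega^1(M,H)$, $m_1,m_2\in\Omega^2(M,I)$ with $\partial(m_1)=d\omega$, $\partial(m_2)=-\tfrac12\omega\wedge^{[,]}\omega$; $\overline\omega=h\omega$, $\overline m=hm_1+h^2m_2$. It is fully primitive if $\omega,m_1,m_2$ take values in primitive elements of $H$, $I$, $I$ respectively. Holonomies. $P_{\overline\omega}(\gamma,[t,t_0])\in H[[h]]$ solves $\frac{d}{dt}P=\overline\omega(\gamma'(t))P$, with value $1_H$ at $t=t_0$; $P_{\overline\omega}(\gamma)=P_{\overline\omega}(\gamma,[1,0])$, $P_{\overline\omega}(\Gamma,[t,t_0],s)=P_{\overline\omega}(\gamma_s,[t,t_0])$.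 $Q_{(\overline\omega,\overline m)}(\Gamma,[s,s_0])\in I[[h]]$ solves $\frac{d}{ds}Q=-\big(\int_0^1P_{\overline\omega}(\Gamma,[0,u],s)\triangleright\overline m(\frac{\partial}{\partial s}\Gamma(u,s),\frac{\partial}{\partial u}\Gamma(u,s))du\big)Q$, with value $1_I$ at $s=s_0$; $Q_{(\overline\omega,\overline m)}(\Gamma)=Q_{(\overline\omega,\overline m)}(\Gamma,[1,0])$. For a 2-path $\Gamma$ with bottom boundary $\gamma_1$: Exact holonomy: $\mathcal{F}^\times_{(\overline\omega,\overline m)}(\gamma)=P_{\overline\omega}(\gamma)^{-1}$ and $\mathcal{F}^\times_{(\overline\omega,\overline m)}(\Gamma)=(P_{\overline\omega}(\gamma_1)^{-1},Q_{(\overline\omega,\overline m)}(\Gamma)^{-1})$, in $\mathcal{C}^\times(\mathcal{H}^*_{\rm gl})$. Fuzzy holonomy: $\mathcal{Z}^+_{(\overline\omega,\overline m)}(\gamma)=P_{\overline\omega}(\gamma)^{-1}$ and $\mathcal{Z}^+_{(\overline\omega,\overline m)}(\Gamma)=(P_{\overline\omega}(\gamma_1)^{-1},\underline{R}(\Gamma))$, in $\mathcal{C}^+(\mathcal{BA}(\mathcal{H}))$, where $$\underline{R}(\Gamma)=-\int_0^1\int_0^1\underline{\Big(P_{\overline\omega}(\Gamma,[0,u],s)\triangleright\overline m\big(\tfrac{\partial}{\partial s}\Gamma(u,s),\tfrac{\partial}{\partial u}\Gamma(u,s)\big)\Big)\otimes P_{\overline\omega}(\Gamma,[0,1],s)}\,du\,ds.$$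 *)

(* Defs.v *)
From HB Require Import structures.
From mathcomp Require Import all_boot all_order all_algebra generic_quotient.
From mathcomp Require Import all_classical all_reals all_analysis.
From mathcomp Require Import complex.

Set Implicit Arguments.
Unset Strict Implicit.
Unset Printing Implicit Defensive.
Import Order.TTheory GRing.Theory Num.Theory.
Import numFieldNormedType.Exports.
Local Open Scope classical_set_scope.
Local Open Scope ring_scope.

Definition bilin (C : fieldType) (U V W : lmodType C) (f : U -> V -> W) : Prop :=
  (forall v, linear (f^~ v)) /\ (forall u, linear (f u)).

Section LinearProp.
Variables (C : fieldType) (U V : lmodType C) (f : U -> V).
Hypothesis fl : linear f.
Lemma lin0 : f 0 = 0. Proof. by rewrite -(addNr 0) -scaleN1r fl scaleN1r addNr. Qed.
Lemma linD x y : f (x + y) = f x + f y.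
Proof. by have := fl 1 x y; rewrite !scale1r. Qed.
Lemma linZ a x : f (a *: x) = a *: f x.
Proof. by have := fl a x 0; rewrite lin0 !addr0. Qed.
Lemma linB x y : f (x - y) = f x - f y.
Proof. by rewrite -scaleN1r linD linZ scaleN1r. Qed.
Lemma lin_sum (I : Type) (r : seq I) (P : pred I) (F : I -> U) :
  f (\sum_(i <- r | P i) F i) = \sum_(i <- r | P i) f (F i).
Proof. exact: (big_morph f linD lin0). Qed.
End LinearProp.

(* U ⊗ V is the set of formal finite sums of pairs, two of them being
   identified when every bilinear map takes the same value on both. *)
Section Tensor.
Variables (C : fieldType) (U V : lmodType C).

Definition sum2 (W : lmodType C) (f : U -> V -> W) (s : seq (U * V)) : W :=
  \sum_(p <- s) f p.1 p.2.

Definition tens_eq (s t : seq (U * V)) : bool :=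
  `[< forall (W : lmodType C) (f : U -> V -> W), bilin f ->
        sum2 f s = sum2 f t >].

Lemma tens_eq_refl : reflexive tens_eq.
Proof. by move=> s; apply/asboolP. Qed.

Lemma tens_eq_sym : symmetric tens_eq.
Proof.
by move=> s t; apply/asboolP/asboolP => e W f bf; rewrite e.
Qed.

Lemma tens_eq_trans : transitive tens_eq.
Proof.
move=> t s u /asboolP e1 /asboolP e2; apply/asboolP => W f bf.
by rewrite e1 // e2.
Qed.

Canonical tens_equiv := EquivRel tens_eq tens_eq_refl tens_eq_sym tens_eq_trans.

Definition tens : Type := {eq_quot tens_equiv}%qT.
HB.instance Definition _ : EqQuotient _ tens_eq tens := EqQuotient.on tens.
HB.instance Definition _ := Choice.on tens.

(* The value at t of the linear map on U ⊗ V induced by a bilinear map f;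
   with t = Δ(x) this is the Sweedler sum of f(x', x''). *)
Definition tlift (W : lmodType C) (f : U -> V -> W) (t : tens) : W :=
  sum2 f (repr t).

Local Notation "'\cl' s" := (\pi_tens s)%qT (at level 10).

Lemma tlift_pi (W : lmodType C) (f : U -> V -> W) s :
  bilin f -> tlift f (\cl s) = sum2 f s.
Proof.
by move=> bf; have /eqmodP /asboolP := reprK (\cl s); apply.
Qed.

Lemma tens_ext (t1 t2 : tens) :
  (forall (W : lmodType C) (f : U -> V -> W), bilin f ->
     tlift f t1 = tlift f t2) -> t1 = t2.
Proof.
move=> e; rewrite -[t1]reprK -[t2]reprK; apply/eqmodP/asboolP => W f bf.
exact: e.
Qed.

Definition pure (u : U) (v : V) : tens := \cl [:: (u, v)].
Definition tens_zero : tens := \cl [::].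
Definition tens_add (t1 t2 : tens) : tens := \cl (repr t1 ++ repr t2).
Definition tens_scale (a : C) (t : tens) : tens :=
  \cl [seq (a *: p.1, p.2) | p <- repr t].
Definition tens_opp (t : tens) : tens := tens_scale (- 1) t.

Lemma sum2_scale (W : lmodType C) (f : U -> V -> W) a s : bilin f ->
  sum2 f [seq (a *: p.1, p.2) | p <- s] = a *: sum2 f s.
Proof.
move=> [fl _]; rewrite /sum2 big_map scaler_sumr; apply: eq_bigr => p _ /=.
exact: (linZ (fl p.2)).
Qed.

Lemma tliftD' (W : lmodType C) (f : U -> V -> W) t1 t2 : bilin f ->
  tlift f (tens_add t1 t2) = tlift f t1 + tlift f t2.
Proof. by move=> bf; rewrite tlift_pi// /sum2 big_cat. Qed.

Lemma tliftZ' (W : lmodType C) (f : U -> V -> W) a t : bilin f ->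
  tlift f (tens_scale a t) = a *: tlift f t.
Proof. by move=> bf; rewrite tlift_pi// sum2_scale. Qed.

Lemma tlift0' (W : lmodType C) (f : U -> V -> W) : bilin f ->
  tlift f tens_zero = 0.
Proof. by move=> bf; rewrite tlift_pi// /sum2 big_nil. Qed.

Lemma tens_addA : associative tens_add.
Proof. by move=> a b c; apply: tens_ext => W f bf; rewrite !tliftD'// addrA. Qed.
Lemma tens_addC : commutative tens_add.
Proof. by move=> a b; apply: tens_ext => W f bf; rewrite !tliftD'// addrC. Qed.
Lemma tens_add0 : left_id tens_zero tens_add.
Proof. by move=> a; apply: tens_ext => W f bf; rewrite tliftD'// tlift0'// add0r. Qed.
Lemma tens_addN : left_inverse tens_zero tens_opp tens_add.
Proof.
move=> a; apply: tens_ext => W f bf.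
by rewrite tliftD'// tliftZ'// tlift0'// scaleN1r addNr.
Qed.
HB.instance Definition _ :=
  GRing.isZmodule.Build tens tens_addA tens_addC tens_add0 tens_addN.

Lemma tens_scaleA a b t : tens_scale a (tens_scale b t) = tens_scale (a * b) t.
Proof. by apply: tens_ext => W f bf; rewrite !tliftZ'// scalerA. Qed.
Lemma tens_scale1 : left_id 1 tens_scale.
Proof. by move=> t; apply: tens_ext => W f bf; rewrite tliftZ'// scale1r. Qed.
Lemma tens_scaleDr : right_distributive tens_scale +%R.
Proof.
move=> a s t; apply: tens_ext => W f bf.
by rewrite tliftZ'// !tliftD'// !tliftZ'// scalerDr.
Qed.
Lemma tens_scaleDl t : {morph tens_scale^~ t : a b / a + b}.
Proof.
move=> a b; apply: tens_ext => W f bf.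
by rewrite tliftD'// !tliftZ'// scalerDl.
Qed.
HB.instance Definition _ := GRing.Zmodule_isLmodule.Build C tens
  tens_scaleA tens_scale1 tens_scaleDr tens_scaleDl.

Lemma tlift_linear (W : lmodType C) (f : U -> V -> W) : bilin f ->
  linear (tlift f).
Proof. by move=> bf a s t; rewrite tliftD'// tliftZ'. Qed.

Lemma tlift_pure (W : lmodType C) (f : U -> V -> W) u v : bilin f ->
  tlift f (pure u v) = f u v.
Proof. by move=> bf; rewrite tlift_pi// /sum2 big_seq1. Qed.

Lemma pure_bilin : bilin pure.
Proof.
split=> [v a x y|u a x y]; apply: tens_ext => W f bf;
  rewrite (tlift_linear bf) !tlift_pure//; case: bf => fl fr.
  exact: fl.
exact: fr.
Qed.

End Tensor.

Notation "u ⊗ v" := (pure u v) (at level 40, left associativity) : ring_scope.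

Section TensorTheory.
Variables (C : fieldType) (U V : lmodType C).

Lemma pureDl (u u' : U) (v : V) : (u + u') ⊗ v = u ⊗ v + u' ⊗ v.
Proof. exact: (linD ((@pure_bilin _ U V).1 v)). Qed.
Lemma pureDr (u : U) (v v' : V) : u ⊗ (v + v') = u ⊗ v + u ⊗ v'.
Proof. exact: (linD ((@pure_bilin _ U V).2 u)). Qed.
Lemma pureZl a (u : U) (v : V) : (a *: u) ⊗ v = a *: (u ⊗ v).
Proof. exact: (linZ ((@pure_bilin _ U V).1 v)). Qed.
Lemma pureZr a (u : U) (v : V) : u ⊗ (a *: v) = a *: (u ⊗ v).
Proof. exact: (linZ ((@pure_bilin _ U V).2 u)). Qed.

Lemma pure_sum (t : tens U V) : t = \sum_(p <- repr t) p.1 ⊗ p.2.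
Proof.
apply: tens_ext => W f bf; rewrite (lin_sum (tlift_linear bf)).
by apply: eq_bigr => p _; rewrite tlift_pure.
Qed.

Lemma tens_lin_ext (W : lmodType C) (f g : tens U V -> W) :
  linear f -> linear g -> (forall u v, f (u ⊗ v) = g (u ⊗ v)) -> f =1 g.
Proof.
move=> fl gl e t; rewrite (pure_sum t) (lin_sum fl) (lin_sum gl).
by apply: eq_bigr => p _.
Qed.

Lemma tlift_comp (W X : lmodType C) (g : W -> X) (f : U -> V -> W) t :
  linear g -> g (tlift f t) = tlift (fun u v => g (f u v)) t.
Proof. by move=> gl; rewrite /tlift /sum2 (lin_sum gl). Qed.

Lemma eq_tlift (W : lmodType C) (f g : U -> V -> W) t :
  f =2 g -> tlift f t = tlift g t.
Proof. by move=> e; apply: eq_bigr => p _; rewrite e. Qed.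

Lemma tlift_param (W X : lmodType C) (f : X -> U -> V -> W) t :
  (forall u v, linear (fun x => f x u v)) -> linear (fun x => tlift (f x) t).
Proof.
move=> fl a x y; rewrite /tlift /sum2 scaler_sumr -big_split/=.
by apply: eq_bigr => p _; rewrite fl.
Qed.

Lemma lin_comp (W X Y : lmodType C) (g : X -> Y) (f : W -> X) :
  linear g -> linear f -> linear (g \o f).
Proof. by move=> gl fl a x y /=; rewrite fl gl. Qed.

End TensorTheory.

Record hopfAlg (C : fieldType) := HopfAlg {
  hopf_alg :> algType C;
  comul : {linear hopf_alg -> tens hopf_alg hopf_alg};
  counit : {lrmorphism hopf_alg -> C^o};
  antipode : {linear hopf_alg -> hopf_alg};
  comul1 : comul 1 = 1 ⊗ 1;
  comulM : forall x y, comul (x * y) =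
    tlift (fun x' x'' => tlift (fun y' y'' => (x' * y') ⊗ (x'' * y''))
      (comul y)) (comul x);
  comulA : forall x,
    tlift (fun x' x'' => x' ⊗ comul x'') (comul x) =
    tlift (fun x' x'' => tlift (fun y y' => y ⊗ (y' ⊗ x'')) (comul x'))
      (comul x);
  counitl : forall x, tlift (fun x' x'' => counit x' *: x'') (comul x) = x;
  counitr : forall x, tlift (fun x' x'' => counit x'' *: x') (comul x) = x;
  antipodel : forall x,
    tlift (fun x' x'' => antipode x' * x'') (comul x) = counit x *: 1;
  antipoder : forall x,
    tlift (fun x' x'' => x' * antipode x'') (comul x) = counit x *: 1 }.

Definition primitive (C : fieldType) (H : hopfAlg C) (x : H) : Prop :=
  comul H x = x ⊗ 1 + 1 ⊗ x.

Record hopfXmod (C : fieldType) := HopfXmod {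
  hI : hopfAlg C;
  hH : hopfAlg C;
  hd : {lrmorphism hI -> hH};
  hact : hH -> hI -> hI;
  hd_comul : forall v,
    comul hH (hd v) = tlift (fun v' v'' => hd v' ⊗ hd v'') (comul hI v);
  hd_counit : forall v, counit hH (hd v) = counit hI v;
  hact_bilin : bilin hact;
  hact1 : forall v, hact 1 v = v;
  hactM : forall x y v, hact (x * y) v = hact x (hact y v);
  hact_mul : forall x u v, hact x (u * v) =
    tlift (fun x' x'' => hact x' u * hact x'' v) (comul hH x);
  hact_one : forall x, hact x 1 = counit hH x *: 1;
  hact_comul : forall x v, comul hI (hact x v) =
    tlift (fun x' x'' => tlift (fun v' v'' => hact x' v' ⊗ hact x'' v'')
      (comul hI v)) (comul hH x);
  hact_counit : forall x v,
    counit hI (hact x v) = counit hH x * counit hI v;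
  hact_cocomm : forall x v,
    tlift (fun x' x'' => x' ⊗ hact x'' v) (comul hH x) =
    tlift (fun x' x'' => x'' ⊗ hact x' v) (comul hH x);
  hpeiffer1 : forall x v, hd (hact x v) =
    tlift (fun x' x'' => x' * hd v * antipode hH x'') (comul hH x);
  hpeiffer2 : forall u v, hact (hd u) v =
    tlift (fun u' u'' => u' * v * antipode hI u'') (comul hI u) }.

(* Unital pre-crossed modules of bare algebras; A itself carries no
   identity, hence is a module with an associative bilinear product. *)
Record prexmod (C : fieldType) := PreXmod {
  xA : lmodType C;
  xB : algType C;
  xmul : xA -> xA -> xA;
  xd : xA -> xB;
  lact : xB -> xA -> xA;
  ract : xA -> xB -> xA;
  xmul_bilin : bilin xmul;
  xmulA : associative xmul;
  xd_lin : linear xd;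
  xdM : forall a b, xd (xmul a b) = xd a * xd b;
  lact_bilin : bilin lact;
  ract_bilin : bilin ract;
  lactM : forall b b' a, lact (b * b') a = lact b (lact b' a);
  ractM : forall a b b', ract a (b * b') = ract (ract a b) b';
  lact_mul : forall b a a', lact b (xmul a a') = xmul (lact b a) a';
  ract_mul : forall a a' b, ract (xmul a a') b = xmul a (ract a' b);
  lract : forall b a b', lact b (ract a b') = ract (lact b a) b';
  xmul_rl : forall a b b' a',
    xmul (ract a b) (lact b' a') = xmul a (lact (b * b') a');
  xmul_lr : forall a b b' a',
    xmul (ract a b) (lact b' a') = xmul (ract a (b * b')) a';
  xd_lact : forall b a, xd (lact b a) = b * xd a;
  xd_ract : forall a b, xd (ract a b) = xd a * b;
  lact1 : forall a, lact 1 a = a;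
  ract1 : forall a, ract a 1 = a }.

Record xmod (C : fieldType) := Xmod {
  xmod_pre :> prexmod C;
  peifferl : forall a' a : xA xmod_pre, lact (xd a') a = xmul a' a;
  peifferr : forall a a' : xA xmod_pre, ract a (xd a') = xmul a a' }.

Section Quot.
Variables (C : fieldType) (V : lmodType C) (J : V -> Prop).
Hypotheses (J0 : J 0) (Jlin : forall a x y, J x -> J y -> J (a *: x + y)).

Definition quot_eq (x y : V) : bool := `[< J (x - y) >].

Let JN x : J x -> J (- x).
Proof. by move=> Jx; rewrite -scaleN1r -[_ *: _]addr0; apply: Jlin. Qed.
Let JD x y : J x -> J y -> J (x + y).
Proof. by move=> Jx Jy; rewrite -[x]scale1r; apply: Jlin. Qed.

Lemma quot_eq_refl : reflexive quot_eq.
Proof. by move=> x; apply/asboolP; rewrite subrr. Qed.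
Lemma quot_eq_sym : symmetric quot_eq.
Proof. by move=> x y; apply/asboolP/asboolP => /JN; rewrite opprB. Qed.
Lemma quot_eq_trans : transitive quot_eq.
Proof.
move=> y x z /asboolP h /asboolP k; apply/asboolP.
by rewrite -(subrKA y); apply: JD.
Qed.
Canonical quot_equiv := EquivRel quot_eq quot_eq_refl quot_eq_sym quot_eq_trans.

Definition quot : Type := {eq_quot quot_equiv}%qT.
HB.instance Definition _ : EqQuotient _ quot_eq quot := EqQuotient.on quot.
HB.instance Definition _ := Choice.on quot.

Definition qpi (x : V) : quot := (\pi_quot x)%qT.

Lemma qpiP x y : (qpi x = qpi y) <-> J (x - y).
Proof. by split=> [/eqmodP/asboolP|h] //; apply/eqmodP/asboolP. Qed.

Lemma qreprK q : qpi (repr q) = q. Proof. exact: reprK. Qed.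
Lemma qrepr x : J (repr (qpi x) - x).
Proof. by apply/qpiP; rewrite qreprK. Qed.

Definition quot_zero : quot := qpi 0.
Definition quot_add (p q : quot) : quot := qpi (repr p + repr q).
Definition quot_opp (p : quot) : quot := qpi (- repr p).
Definition quot_scale a (p : quot) : quot := qpi (a *: repr p).

Lemma qpiD x y : qpi (x + y) = quot_add (qpi x) (qpi y).
Proof.
by apply/esym/qpiP; rewrite opprD addrACA; apply: JD; apply: qrepr.
Qed.
Lemma qpiN x : qpi (- x) = quot_opp (qpi x).
Proof. by apply/esym/qpiP; rewrite -opprD; apply/JN/qrepr. Qed.
Lemma qpiZ a x : qpi (a *: x) = quot_scale a (qpi x).
Proof.
apply/esym/qpiP; rewrite -scalerBr -[_ *: _]addr0; apply: Jlin => //.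
exact: qrepr.
Qed.

Ltac qlift := repeat match goal with p : quot |- _ =>
  rewrite -(qreprK p); move: (repr p) => {}p end.

Lemma quot_addA : associative quot_add.
Proof. by move=> p q r; qlift; rewrite -!qpiD addrA. Qed.
Lemma quot_addC : commutative quot_add.
Proof. by move=> p q; qlift; rewrite -!qpiD addrC. Qed.
Lemma quot_add0 : left_id quot_zero quot_add.
Proof. by move=> p; qlift; rewrite -!qpiD add0r. Qed.
Lemma quot_addN : left_inverse quot_zero quot_opp quot_add.
Proof. by move=> p; qlift; rewrite -qpiN -!qpiD addNr. Qed.
HB.instance Definition _ :=
  GRing.isZmodule.Build quot quot_addA quot_addC quot_add0 quot_addN.

Lemma quot_addE p q : quot_add p q = p + q. Proof. by []. Qed.
Lemma quot_scaleA a b p : quot_scale a (quot_scale b p) = quot_scale (a * b) p.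
Proof. by qlift; rewrite -!qpiZ scalerA. Qed.
Lemma quot_scale1 : left_id 1 quot_scale.
Proof. by move=> p; qlift; rewrite -!qpiZ scale1r. Qed.
Lemma quot_scaleDr : right_distributive quot_scale +%R.
Proof. by move=> a p q; rewrite -!quot_addE; qlift; rewrite -!(qpiZ,qpiD) scalerDr. Qed.
Lemma quot_scaleDl p : {morph quot_scale^~ p : a b / a + b}.
Proof. by move=> a b; rewrite -!quot_addE; qlift; rewrite -!(qpiZ,qpiD) scalerDl. Qed.
HB.instance Definition _ := GRing.Zmodule_isLmodule.Build C quot
  quot_scaleA quot_scale1 quot_scaleDr quot_scaleDl.

Lemma qpi_lin : linear qpi.
Proof. by move=> a x y; rewrite qpiD qpiZ. Qed.

End Quot.
Arguments qpi {C V J J0 Jlin}.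

(* The quotient of a pre-crossed module by the two-sided ideal generated by
   the second Peiffer relations. *)
Section Peiffer.
Variables (C : fieldType) (A : prexmod C).

Record ideal (K : xA A -> Prop) : Prop := Ideal {
  ideal0 : K 0;
  ideal_lin : forall c x y, K x -> K y -> K (c *: x + y);
  ideal_mull : forall a x, K x -> K (xmul a x);
  ideal_mulr : forall x a, K x -> K (xmul x a) }.

Definition peiffer_ideal (x : xA A) : Prop :=
  forall K, ideal K ->
    (forall a a', K (lact (xd a) a' - xmul a a')) ->
    (forall a a', K (ract a (xd a') - xmul a a')) -> K x.

Lemma peiffer_idealP : ideal peiffer_ideal.
Proof.
split=> [K [K0 _ _ _] //|c x y Jx Jy K iK g1 g2|a x Jx K iK g1 g2|x a Jx K iK g1 g2].
- by apply: (ideal_lin iK); [apply: Jx|apply: Jy].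
- by apply: (ideal_mull iK); apply: Jx.
- by apply: (ideal_mulr iK); apply: Jx.
Qed.

Let J0 := ideal0 peiffer_idealP.
Let Jlin := ideal_lin peiffer_idealP.
Local Notation Q := (quot J0 Jlin).
Local Notation pr := (@qpi _ _ _ J0 Jlin).

Lemma peiffer_gen1 a a' : peiffer_ideal (lact (xd a) a' - xmul a a').
Proof. by move=> K _ g1 _. Qed.
Lemma peiffer_gen2 a a' : peiffer_ideal (ract a (xd a') - xmul a a').
Proof. by move=> K _ _ g2. Qed.

Lemma peiffer_lact b x : peiffer_ideal x -> peiffer_ideal (lact b x).
Proof.
have [l1 l2] := @lact_bilin _ A.
have [m1 m2] := @xmul_bilin _ A.
move=> Jx; suff [] : peiffer_ideal x /\ peiffer_ideal (lact b x) by [].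
apply: (Jx (fun x => peiffer_ideal x /\ peiffer_ideal (lact b x))) => [|a a'|a a']; first split.
- by rewrite (lin0 (l2 b)).
- move=> c y z [Jy Jby] [Jz Jbz]; rewrite (l2 b) .
  by split; apply: Jlin.
- move=> a y [Jy Jby]; rewrite lact_mul.
  by split; apply: (ideal_mull peiffer_idealP).
- move=> y a [Jy Jby]; rewrite lact_mul.
  by split; apply: (ideal_mulr peiffer_idealP).
- split; first exact: peiffer_gen1.
  rewrite (linB (l2 b)) -lactM -xd_lact lact_mul; exact: peiffer_gen1.
- split; first exact: peiffer_gen2.
  rewrite (linB (l2 b)) lract lact_mul; exact: peiffer_gen2.
Qed.

Lemma peiffer_ract b x : peiffer_ideal x -> peiffer_ideal (ract x b).
Proof.
have [l1 l2] := @ract_bilin _ A.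
move=> Jx; suff [] : peiffer_ideal x /\ peiffer_ideal (ract x b) by [].
apply: (Jx (fun x => peiffer_ideal x /\ peiffer_ideal (ract x b))) => [|a a'|a a']; first split.
- by rewrite (lin0 (l1 b)).
- move=> c y z [Jy Jby] [Jz Jbz]; rewrite (l1 b) .
  by split; apply: Jlin.
- move=> a y [Jy Jby]; rewrite ract_mul.
  by split; apply: (ideal_mull peiffer_idealP).
- move=> y a [Jy Jby]; rewrite ract_mul.
  by split; apply: (ideal_mulr peiffer_idealP).
- split; first exact: peiffer_gen1.
  rewrite (linB (l1 b)) -lract ract_mul; exact: peiffer_gen1.
- split; first exact: peiffer_gen2.
  rewrite (linB (l1 b)) -ractM -xd_ract ract_mul; exact: peiffer_gen2.
Qed.

Lemma peiffer_xd x : peiffer_ideal x -> xd x = 0.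
Proof.
have xl := @xd_lin _ A; move=> Jx; apply: (Jx (fun x => xd x = 0)) => [|a a'|a a']; first split.
- exact: lin0.
- by move=> c x0 y e1 e2; rewrite xl e1 e2 scaler0 addr0.
- by move=> a y e; rewrite xdM e mulr0.
- by move=> y a e; rewrite xdM e mul0r.
- by rewrite (linB xl) xd_lact xdM subrr.
- by rewrite (linB xl) xd_ract xdM subrr.
Qed.

Definition qmul (p q : Q) : Q := pr (xmul (repr p) (repr q)).
Definition qd (p : Q) : xB A := xd (repr p).
Definition qlact b (p : Q) : Q := pr (lact b (repr p)).
Definition qract (p : Q) b : Q := pr (ract (repr p) b).

Lemma qmulE a b : qmul (pr a) (pr b) = pr (xmul a b).
Proof.
have [m1 m2] := @xmul_bilin _ A.
apply/qpiP; rewrite -[X in peiffer_ideal X](subrKA (xmul (repr (pr a)) b)).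
rewrite -(linB (m2 _)) -(linB (m1 b)) -[X in peiffer_ideal X]scale1r.
rewrite scalerDr [X in _ + X]scale1r; apply: Jlin.
  by apply: (ideal_mull peiffer_idealP); apply: qrepr.
by apply: (ideal_mulr peiffer_idealP); apply: qrepr.
Qed.
Lemma qdE a : qd (pr a) = xd a.
Proof.
apply/eqP; rewrite -subr_eq0 -(linB (@xd_lin _ A)); apply/eqP/peiffer_xd.
exact: qrepr.
Qed.
Lemma qlactE b a : qlact b (pr a) = pr (lact b a).
Proof.
apply/qpiP; rewrite -(linB ((@lact_bilin _ A).2 b)).
by apply: peiffer_lact; apply: qrepr.
Qed.
Lemma qractE a b : qract (pr a) b = pr (ract a b).
Proof.
apply/qpiP; rewrite -(linB ((@ract_bilin _ A).1 b)).
by apply: peiffer_ract; apply: qrepr.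
Qed.

Let prl := qpi_lin J0 Jlin : linear pr.
Let qE := (qmulE, qdE, qlactE, qractE).
Ltac qlift := repeat match goal with p : _ |- _ =>
  rewrite -(qreprK (p : Q)); move: (repr (p : Q)) => {}p end.

Lemma qmul_bilin : bilin qmul.
Proof.
have [m1 m2] := @xmul_bilin _ A.
by split=> [q|p] c x y; qlift; rewrite /= -prl !qE -prl (m1, m2).
Qed.
Lemma qlact_bilin : bilin qlact.
Proof.
have [m1 m2] := @lact_bilin _ A.
split=> [q|p] c x y; qlift; rewrite /=; first by rewrite !qE -prl m1.
by rewrite -prl !qE -prl m2.
Qed.
Lemma qract_bilin : bilin qract.
Proof.
have [m1 m2] := @ract_bilin _ A.
split=> [q|p] c x y; qlift; rewrite /=; last by rewrite !qE -prl m2.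
by rewrite -prl !qE -prl m1.
Qed.

Definition peiffer_pre : prexmod C.
Proof.
refine (@PreXmod C Q (xB A) qmul qd qlact qract qmul_bilin _ _ _
  qlact_bilin qract_bilin _ _ _ _ _ _ _ _ _ _ _).
- by move=> a b c; qlift; rewrite !qE xmulA.
- by move=> c a b; qlift; rewrite -prl !qE (@xd_lin _ A).
- by move=> a b; qlift; rewrite !qE xdM.
- by move=> b b' a; qlift; rewrite !qE lactM.
- by move=> a b b'; qlift; rewrite !qE ractM.
- by move=> b a a'; qlift; rewrite !qE lact_mul.
- by move=> a a' b; qlift; rewrite !qE ract_mul.
- by move=> b a b'; qlift; rewrite !qE lract.
- by move=> a b b' a'; qlift; rewrite !qE xmul_rl.
- by move=> a b b' a'; qlift; rewrite !qE xmul_lr.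
- by move=> b a; qlift; rewrite !qE xd_lact.
- by move=> a b; qlift; rewrite !qE xd_ract.
- by move=> a; qlift; rewrite !qE lact1.
- by move=> a; qlift; rewrite !qE ract1.
Defined.

Definition peiffer : xmod C.
Proof.
refine (@Xmod C peiffer_pre _ _) => p q; qlift; rewrite /= !qE; apply/qpiP.
  exact: peiffer_gen1.
exact: peiffer_gen2.
Defined.

Definition peiffer_proj (a : xA A) : xA peiffer := pr a.

End Peiffer.

Section AugmentationIdeal.
Variables (C : fieldType) (I : hopfAlg C).

Lemma counitM (x y : I) : counit I (x * y) = counit I x * counit I y.
Proof. exact: rmorphM. Qed.
Lemma counitP a (x y : I) :
  counit I (a *: x + y) = a * counit I x + counit I y.
Proof. exact: linearP. Qed.

Definition aug_pred : {pred I} := fun v => counit I v == 0.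
Lemma aug_closed : submod_closed aug_pred.
Proof.
split=> [|a x y]; rewrite !unfold_in ?linear0 //.
by move=> /eqP ex /eqP ey; rewrite counitP ex ey mulr0 addr0.
Qed.
HB.instance Definition _ := GRing.isSubmodClosed.Build C I aug_pred aug_closed.

Record aug := Aug { aug_val : I; aug_valP : aug_val \in aug_pred }.
HB.instance Definition _ := [isSub for aug_val].
HB.instance Definition _ := [Choice of aug by <:].
HB.instance Definition _ := [SubChoice_isSubLmodule of aug by <:].

Lemma aug0 (v : aug) : counit I (aug_val v) = 0.
Proof. by have := aug_valP v; rewrite unfold_in => /eqP. Qed.

Lemma aug_val_lin : linear aug_val.
Proof. by move=> a x y; exact: (linearP (\val : aug -> I)). Qed.

Lemma aug_inj (u v : aug) : aug_val u = aug_val v -> u = v.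
Proof. exact: val_inj. Qed.

End AugmentationIdeal.

Section Semidirect.
Variables (C : fieldType) (X : hopfXmod C).
Local Notation I := (hI X).
Local Notation H := (hH X).
Local Notation I0 := (aug I).
Local Notation "x ▷ v" := (hact x v) (at level 40).

Lemma aug_mul_subproof (u : I0) (w : I) : aug_val u * w \in @aug_pred C I.
Proof. by rewrite unfold_in counitM aug0 mul0r. Qed.
Definition aug_mul u w : I0 := Aug (aug_mul_subproof u w).

Lemma aug_act_subproof (x : H) (v : I0) : x ▷ aug_val v \in @aug_pred C I.
Proof. by rewrite unfold_in hact_counit aug0 mulr0. Qed.
Definition aug_act x v : I0 := Aug (aug_act_subproof x v).

Local Notation E := (tens I0 H).

(* (u ⊗ x)(v ⊗ y) = ∑ u(x' ▷ v) ⊗ x''y *)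
Definition smul (a b : E) : E :=
  tlift (fun u x => tlift (fun v y => tlift (fun x' x'' =>
    aug_mul u (x' ▷ aug_val v) ⊗ (x'' * y)) (comul H x)) b) a.
(* (1 ⊗ x)(v ⊗ y) *)
Definition slact (x : H) (a : E) : E :=
  tlift (fun v y => tlift (fun x' x'' =>
    aug_act x' v ⊗ (x'' * y)) (comul H x)) a.
(* (v ⊗ y)(1 ⊗ x) *)
Definition sract (a : E) (x : H) : E :=
  tlift (fun v y => tlift (fun y' y'' =>
    aug_mul v (y' ▷ 1) ⊗ (y'' * x)) (comul H y)) a.
Definition sd (a : E) : H := tlift (fun v x => hd X (aug_val v) * x) a.

Lemma aug_mulE u w : aug_val (aug_mul u w) = aug_val u * w.
Proof. by []. Qed.
Lemma aug_actE x v : aug_val (aug_act x v) = x ▷ aug_val v.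
Proof. by []. Qed.

Lemma aug_mul_bilin : bilin aug_mul.
Proof.
split=> [w|u] a x y; apply: aug_inj; rewrite aug_val_lin !aug_mulE.
  by rewrite aug_val_lin mulrDl scalerAl.
by rewrite mulrDr scalerAr.
Qed.

Lemma aug_act_bilin : bilin aug_act.
Proof.
have [l1 l2] := @hact_bilin _ X.
split=> [w|u] a x y; apply: aug_inj; rewrite aug_val_lin !aug_actE.
  exact: l1.
by rewrite aug_val_lin l2.
Qed.

Lemma mulr_bilin (B : algType C) : bilin ( *%R : B -> B -> B).
Proof.
split=> [w|u] a x y /=; first by rewrite mulrDl scalerAl.
by rewrite mulrDr scalerAr.
Qed.

Lemma aug_mulA u v w : aug_mul (aug_mul u v) w = aug_mul u (v * w).
Proof. by apply: aug_inj; rewrite !aug_mulE mulrA. Qed.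

Lemma id_lin (U : lmodType C) : linear (@idfun U). Proof. by []. Qed.

Let pb := @pure_bilin C I0 H.
Let ab := aug_act_bilin.
Let mb := aug_mul_bilin.

Definition lmul (u : I0) : E -> E := tlift (fun (w : I0) (y : H) => aug_mul u (aug_val w) ⊗ y).

Lemma lmul_bi u : bilin (fun (w : I0) (y : H) => aug_mul u (aug_val w) ⊗ y).
Proof.
split=> [y|w] a s t; cbv beta.
  by rewrite aug_val_lin (mb.2 u) (pb.1 y).
by rewrite (pb.2 _).
Qed.
Lemma lmul_pure u w y : lmul u (w ⊗ y) = aug_mul u (aug_val w) ⊗ y.
Proof. exact: (tlift_pure _ _ (lmul_bi u)). Qed.
Lemma lmul_lin u : linear (lmul u).
Proof. exact: tlift_linear (lmul_bi u). Qed.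
Lemma lmul_linl a : linear (lmul^~ a).
Proof.
by apply: tlift_param => w y c u v; rewrite (mb.1 _) (pb.1 y).
Qed.

Lemma slact_bi0 v y : bilin (fun x' x'' : H => aug_act x' v ⊗ (x'' * y)).
Proof.
split=> [x|x] a s t; cbv beta; first by rewrite (ab.1 v) (pb.1 _).
by rewrite ((mulr_bilin H).1 y) (pb.2 _).
Qed.
Lemma slact_bi x : bilin (fun (v : I0) (y : H) => tlift (fun x' x'' : H =>
    aug_act x' v ⊗ (x'' * y)) (comul H x)).
Proof.
split=> [y|v].
  by apply: tlift_param => x' x'' a s t; rewrite (ab.2 x') (pb.1 _).
by apply: tlift_param => x' x'' a s t; rewrite ((mulr_bilin H).2 x'') (pb.2 _).
Qed.
Lemma slact_pure x v y :
  slact x (v ⊗ y) = tlift (fun x' x'' => aug_act x' v ⊗ (x'' * y)) (comul H x).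
Proof. exact: (tlift_pure _ _ (slact_bi x)). Qed.
Lemma slact_lin x : linear (slact x).
Proof. exact: tlift_linear (slact_bi x). Qed.
Lemma slact_linl a : linear (slact^~ a).
Proof.
apply: tlift_param => v y c s t; cbv beta.
by rewrite linearP (tlift_linear (slact_bi0 v y)).
Qed.

Lemma smulE a b : smul a b = tlift (fun u x => lmul u (slact x b)) a.
Proof.
apply: eq_tlift => u x; rewrite (tlift_comp _ _ (lmul_lin u)).
apply: eq_tlift => v y; rewrite (tlift_comp _ _ (lmul_lin u)).
by apply: eq_tlift => x' x''; rewrite lmul_pure.
Qed.

Lemma smul_bi b : bilin (fun u x => lmul u (slact x b)).
Proof.
split=> [x|u]; first exact: lmul_linl.
by move=> c s t; cbv beta; rewrite slact_linl lmul_lin.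
Qed.
Lemma smul_pure u x b : smul (u ⊗ x) b = lmul u (slact x b).
Proof. by rewrite smulE (tlift_pure _ _ (smul_bi b)). Qed.
Lemma smul_lin b : linear (smul^~ b).
Proof. by move=> c s t; rewrite /= !smulE (tlift_linear (smul_bi b)). Qed.
Lemma smul_linr a : linear (smul a).
Proof.
move=> c s t; rewrite !smulE; move: c s t; apply: tlift_param => u x c s t.
by rewrite slact_lin lmul_lin.
Qed.
Lemma smul_bilin : bilin smul.
Proof. by split=> [b|a]; [exact: smul_lin|exact: smul_linr]. Qed.


Lemma sract_term v y x : tlift (fun y' y'' =>
    aug_mul v (y' ▷ 1) ⊗ (y'' * x)) (comul H y) = v ⊗ (y * x).
Proof.
have gl : linear (fun z => v ⊗ (z * x)).
  by move=> a s t; rewrite ((mulr_bilin H).1 x) (pb.2 v).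
rewrite -[in RHS](counitl y) [RHS](tlift_comp _ _ gl).
apply: eq_tlift => y' y''; rewrite hact_one (linZ (mb.2 v)) pureZl.
by rewrite -scalerAl pureZr; congr (_ *: (_ ⊗ _)); apply: aug_inj; rewrite aug_mulE mulr1.
Qed.

Lemma sractE a x : sract a x = tlift (fun v y => v ⊗ (y * x)) a.
Proof. by apply: eq_tlift => v y; rewrite sract_term. Qed.
Lemma sract_bi x : bilin (fun (v : I0) (y : H) => v ⊗ (y * x)).
Proof.
split=> [y|v] a s t; cbv beta; first exact: (pb.1 _).
by rewrite ((mulr_bilin H).1 x) (pb.2 v).
Qed.
Lemma sract_pure v y x : sract (v ⊗ y) x = v ⊗ (y * x).
Proof. by rewrite sractE (tlift_pure _ _ (sract_bi x)). Qed.
Lemma sract_lin x : linear (sract^~ x).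
Proof. by move=> a s t; rewrite !sractE (tlift_linear (sract_bi x)). Qed.
Lemma sract_linr a : linear (sract a).
Proof.
move=> c s t; rewrite !sractE; move: c s t; apply: tlift_param => v y c s t.
by rewrite ((mulr_bilin H).2 y) (pb.2 v).
Qed.

Lemma lmul_lmul u w c : lmul (aug_mul u (aug_val w)) c = lmul u (lmul w c).
Proof.
move: c; apply: tens_lin_ext; first exact: lmul_lin.
  exact: lin_comp (lmul_lin u) (lmul_lin w).
by move=> v y; rewrite !lmul_pure aug_mulA.
Qed.

Lemma lmul_sract u b x : lmul u (sract b x) = sract (lmul u b) x.
Proof.
move: b; apply: tens_lin_ext.
- exact: lin_comp (lmul_lin u) (sract_lin x).
- exact: (lin_comp (sract_lin x) (lmul_lin u)).
- by move=> v y; rewrite sract_pure !lmul_pure sract_pure.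
Qed.

Lemma slact_sract x b y : slact x (sract b y) = sract (slact x b) y.
Proof.
move: b; apply: tens_lin_ext.
- exact: lin_comp (slact_lin x) (sract_lin y).
- exact: (lin_comp (sract_lin y) (slact_lin x)).
- move=> v z; rewrite sract_pure !slact_pure.
  rewrite [RHS](tlift_comp _ _ (sract_lin y)); apply: eq_tlift => x' x''.
  by rewrite sract_pure mulrA.
Qed.

Lemma smul_sract a b x : sract (smul a b) x = smul a (sract b x).
Proof.
rewrite !smulE [LHS](tlift_comp _ _ (sract_lin x)); apply: eq_tlift => u y.
by rewrite -lmul_sract slact_sract.
Qed.

Lemma lmul_smul u b c : smul (lmul u b) c = lmul u (smul b c).
Proof.
move: b; apply: tens_lin_ext.
- exact: (lin_comp (smul_lin c) (lmul_lin u)).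
- exact: (lin_comp (lmul_lin u) (smul_lin c)).
- by move=> w y; rewrite lmul_pure !smul_pure lmul_lmul.
Qed.

Lemma tlift_exchange (U V U' V' W : lmodType C) (F : U -> V -> U' -> V' -> W)
    (s : tens U V) (t : tens U' V') :
  tlift (fun x y => tlift (F x y) t) s =
  tlift (fun x' y' => tlift (fun x y => F x y x' y') s) t.
Proof. exact: exchange_big. Qed.

Lemma comulA_lift (W : lmodType C) (F : H -> H -> H -> W) x :
  (forall b c, linear (fun a => F a b c)) -> (forall a, bilin (F a)) ->
  tlift (fun x' x'' => tlift (F x') (comul H x'')) (comul H x) =
  tlift (fun x' x'' => tlift (fun y y' => F y y' x'') (comul H x'))
    (comul H x).
Proof.
move=> F1 F2; pose G := fun a t => tlift (F a) t.
have Gb : bilin G.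
  split=> [t|a]; last exact: tlift_linear.
  by apply: tlift_param => b c; exact: F1.
have := congr1 (tlift G) (comulA x).
rewrite !(tlift_comp _ _ (tlift_linear Gb)) => e.
transitivity (tlift (fun x' x'' => tlift G (x' ⊗ comul H x'')) (comul H x)).
  by apply: eq_tlift => x' x''; rewrite tlift_pure.
rewrite e; apply: eq_tlift => x' x''.
rewrite (tlift_comp _ _ (tlift_linear Gb)); apply: eq_tlift => y y'.
by rewrite tlift_pure// /G tlift_pure.
Qed.

Lemma slactM x y a : slact (x * y) a = slact x (slact y a).
Proof.
move: a; apply: tens_lin_ext.
- exact: slact_lin.
- exact: lin_comp (slact_lin x) (slact_lin y).
move=> v z; rewrite !slact_pure comulM.
rewrite (tlift_comp _ _ (tlift_linear (slact_bi0 v z))).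
rewrite [RHS](tlift_comp _ _ (slact_lin x)).
transitivity (tlift (fun x' x'' => tlift (fun y' y'' =>
    aug_act (x' * y') v ⊗ (x'' * y'' * z)) (comul H y)) (comul H x)).
  apply: eq_tlift => x' x''.
  rewrite (tlift_comp _ _ (tlift_linear (slact_bi0 v z))).
  by apply: eq_tlift => y' y''; rewrite (tlift_pure _ _ (slact_bi0 v z)).
rewrite tlift_exchange; apply: eq_tlift => y' y''; rewrite slact_pure.
apply: eq_tlift => x' x''; rewrite mulrA; congr (_ ⊗ _).
by apply: aug_inj; rewrite !aug_actE hactM.
Qed.

Lemma slact1 a : slact 1 a = a.
Proof.
move: a; apply: (tens_lin_ext (slact_lin 1) (@id_lin _)) => v z.
rewrite slact_pure comul1 (tlift_pure _ _ (slact_bi0 v z)) mul1r.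
by congr (_ ⊗ _); apply: aug_inj; rewrite aug_actE hact1.
Qed.

Lemma slact_lmul x u b : slact x (lmul u b) =
  tlift (fun x' x'' => lmul (aug_act x' u) (slact x'' b)) (comul H x).
Proof.
move: b; apply: tens_lin_ext.
- exact: lin_comp (slact_lin x) (lmul_lin u).
- by apply: tlift_param => x' x'' c s t; rewrite slact_lin lmul_lin.
move=> w z; rewrite lmul_pure slact_pure.
pose F (a b c : H) : E := aug_mul (aug_act a u) (b ▷ aug_val w) ⊗ (c * z).
transitivity (tlift (fun x' x'' => tlift (fun y y' => F y y' x'') (comul H x'))
    (comul H x)).
  apply: eq_tlift => x' x''.
  have gl : linear (fun p : I0 => p ⊗ (x'' * z)) by exact: (pb.1 _).
  rewrite -[RHS](tlift_comp _ _ gl); congr (_ ⊗ _); apply: aug_inj.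
  rewrite aug_actE aug_mulE hact_mul.
  by rewrite (tlift_comp _ _ (@aug_val_lin _ _)).
rewrite -comulA_lift.
- apply: eq_tlift => x' x''; rewrite slact_pure.
  rewrite (tlift_comp _ _ (lmul_lin _)); apply: eq_tlift => y y'.
  by rewrite lmul_pure.
- by move=> b c k s t; rewrite /F (ab.1 u) (mb.1 _) (pb.1 _).
- move=> a; split=> [c|b] k s t; rewrite /F.
    by rewrite ((@hact_bilin _ X).1 (aug_val w)) (mb.2 _) (pb.1 _).
  by rewrite ((mulr_bilin H).1 z) (pb.2 _).
Qed.

Lemma slact_smul x a b : slact x (smul a b) = smul (slact x a) b.
Proof.
move: a; apply: tens_lin_ext.
- exact: (lin_comp (slact_lin x) (smul_lin b)).
- exact: (lin_comp (smul_lin b) (slact_lin x)).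
move=> u y; rewrite smul_pure slact_lmul slact_pure.
rewrite (tlift_comp _ _ (smul_lin b)); apply: eq_tlift => x' x''.
by rewrite smul_pure slactM.
Qed.

Lemma smulA : associative smul.
Proof.
move=> a b c; move: a; apply: tens_lin_ext.
- exact: smul_lin.
- exact: (lin_comp (smul_lin c) (smul_lin b)).
by move=> u x; rewrite !smul_pure lmul_smul slact_smul.
Qed.

Lemma sd_bi : bilin (fun (v : I0) (x : H) => hd X (aug_val v) * x).
Proof.
split=> [y|v] a s t; cbv beta; last exact: ((mulr_bilin H).2 _).
by rewrite aug_val_lin linearP ((mulr_bilin H).1 y).
Qed.
Lemma sd_pure v x : sd (v ⊗ x) = hd X (aug_val v) * x.
Proof. exact: (tlift_pure _ _ sd_bi). Qed.
Lemma sd_lin : linear sd. Proof. exact: tlift_linear sd_bi. Qed.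

Lemma sd_lmul u c : sd (lmul u c) = hd X (aug_val u) * sd c.
Proof.
move: c; apply: tens_lin_ext.
- exact: lin_comp sd_lin (lmul_lin u).
- exact: (lin_comp ((mulr_bilin H).2 _) sd_lin).
by move=> w y; rewrite lmul_pure !sd_pure aug_mulE rmorphM mulrA.
Qed.

Lemma sd_slact x a : sd (slact x a) = x * sd a.
Proof.
move: a; apply: tens_lin_ext.
- exact: lin_comp sd_lin (slact_lin x).
- exact: (lin_comp ((mulr_bilin H).2 _) sd_lin).
have m1 := (mulr_bilin H).1; have m2 := (mulr_bilin H).2.
move=> v z; rewrite slact_pure sd_pure (tlift_comp _ _ sd_lin).
pose F (a b c : H) : H := a * hd X (aug_val v) * antipode H b * (c * z).
transitivity (tlift (fun x' x'' => tlift (fun y y' => F y y' x'') (comul H x'))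
    (comul H x)).
  apply: eq_tlift => x' x''; rewrite sd_pure aug_actE hpeiffer1.
  by rewrite (tlift_comp _ _ (m1 _)).
rewrite -comulA_lift.
- transitivity (tlift (fun x' x'' =>
      (counit H x'' *: x') * (hd X (aug_val v) * z)) (comul H x)); last first.
    by rewrite -(tlift_comp _ _ (m1 _)) counitr.
  apply: eq_tlift => x' x''; have gl : linear (fun p : H =>
      x' * hd X (aug_val v) * p * z).
    by move=> c s t; rewrite m2 m1.
  transitivity (tlift (fun y y' =>
      x' * hd X (aug_val v) * (antipode H y * y') * z) (comul H x'')).
    by apply: eq_tlift => y y'; rewrite /F !mulrA.
  rewrite -(tlift_comp _ _ gl) antipodel -scalerAr mulr1 -!scalerAl.
  by rewrite !mulrA.
- by move=> b c k s t; rewrite /F !m1.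
- move=> a; split=> [c|b] k s t; rewrite /F.
    by rewrite linearP m2 m1.
  by rewrite m1 m2.
Qed.

Lemma sd_smul a b : sd (smul a b) = sd a * sd b.
Proof.
move: a; apply: tens_lin_ext.
- exact: (lin_comp sd_lin (smul_lin b)).
- exact: (lin_comp ((mulr_bilin H).1 _) sd_lin).
by move=> u x; rewrite smul_pure sd_lmul sd_slact sd_pure mulrA.
Qed.

Lemma sd_sract a x : sd (sract a x) = sd a * x.
Proof.
move: a; apply: tens_lin_ext.
- exact: (lin_comp sd_lin (sract_lin x)).
- exact: (lin_comp ((mulr_bilin H).1 _) sd_lin).
by move=> u y; rewrite sract_pure !sd_pure mulrA.
Qed.

Lemma smul_rl a x y b : smul (sract a x) (slact y b) = smul a (slact (x * y) b).
Proof.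
move: a; apply: tens_lin_ext.
- exact: (lin_comp (smul_lin _) (sract_lin x)).
- exact: smul_lin.
by move=> u z; rewrite sract_pure !smul_pure -!slactM mulrA.
Qed.

Lemma smul_lr a x y b : smul (sract a x) (slact y b) = smul (sract a (x * y)) b.
Proof.
move: a; apply: tens_lin_ext.
- exact: (lin_comp (smul_lin _) (sract_lin x)).
- exact: (lin_comp (smul_lin _) (sract_lin _)).
by move=> u z; rewrite !sract_pure !smul_pure -!slactM mulrA.
Qed.

Lemma sractM a x y : sract a (x * y) = sract (sract a x) y.
Proof.
move: a; apply: tens_lin_ext.
- exact: sract_lin.
- exact: (lin_comp (sract_lin y) (sract_lin x)).
by move=> u z; rewrite !sract_pure mulrA.
Qed.

Lemma sract1 a : sract a 1 = a.
Proof.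
move: a; apply: (tens_lin_ext (sract_lin 1) (@id_lin _)) => v z.
by rewrite sract_pure mulr1.
Qed.

Definition semidirect : prexmod C := @PreXmod C E H smul sd slact sract
  smul_bilin smulA sd_lin sd_smul
  (conj slact_linl slact_lin) (conj sract_lin sract_linr)
  slactM sractM slact_smul smul_sract slact_sract smul_rl smul_lr
  sd_slact sd_sract slact1 sract1.

Definition BA : xmod C := peiffer semidirect.

End Semidirect.

(* A[[h]] is represented by sequences of coefficients; every bilinear
   operation extends to it by the Cauchy product. *)
Notation fps A := (nat -> A).

Section Fps.

Definition cauchy (A B : Type) (D : nmodType) (op : A -> B -> D)
    (x : fps A) (y : fps B) : fps D :=
  fun n => \sum_(i < n.+1) op (x i) (y (n - i)%N).

Definition monom (A : nmodType) (k : nat) (a : A) : fps A :=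
  fun n => if n == k then a else 0.

Definition is_fps_inv (A : nmodType) (mul : A -> A -> A) (one : A)
    (x y : fps A) : Prop :=
  cauchy mul x y = monom 0 one /\ cauchy mul y x = monom 0 one.

(* the two-sided inverse of x, if there is one *)
Definition fps_inv (A : nmodType) (mul : A -> A -> A) (one : A)
    (x : fps A) : fps A :=
  xget x [set y | is_fps_inv mul one x y].

End Fps.

Section GroupLike.
Variables (C : fieldType) (H : hopfAlg C).

Record gl := Gl {
  gl_val :> fps H;
  gl_one : gl_val 0%N = 1;
  gl_unit : exists y, is_fps_inv *%R 1 gl_val y;
  gl_comul : forall n, comul H (gl_val n) = cauchy (@pure C H H) gl_val gl_val n }.

End GroupLike.

Section AdjoinUnit.
Variables (C : fieldType) (A : xmod C).

(* C ⊕ A, the algebra A with an identity adjoined *)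
Definition adj : lmodType C := (C^o * xA A)%type.
Definition adj_mul (p q : adj) : adj :=
  (p.1 * q.1, p.1 *: q.2 + q.1 *: p.2 + xmul p.2 q.2).
Definition adj_one : adj := (1, 0).

(* series 1 + ∑_{n ≥ 1} h^n a_n with a_n ∈ A *)
Record adj_star := AdjStar {
  as_val :> fps adj;
  as_one : as_val 0%N = adj_one;
  as_pos : forall n, (0 < n)%N -> (as_val n).1 = 0 }.

Record b_star := BStar {
  bs_val :> fps (xB A);
  bs_one : bs_val 0%N = 1 }.

End AdjoinUnit.

(* The cells of the 2-groupoids C^×(X) and C^+(A): their 1-morphisms and
   2-morphisms, a 2-morphism being given by its bottom boundary and an element
   of the top group (respectively algebra). Compositions are not recorded, as
   equality of maps into a 2-groupoid only involves cells. *)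
Record cells := Cells { mor1 : Type; mor2 : Type }.

Record cells_map (X Y : cells) := CellsMap {
  map1 : mor1 X -> mor1 Y;
  map2 : mor2 X -> mor2 Y }.

Definition cells_comp (X Y Z : cells) (g : cells_map Y Z) (f : cells_map X Y) :=
  CellsMap (map1 g \o map1 f) (map2 g \o map2 f).

Definition ctimes (G E : Type) := Cells G (G * E).

Definition ctimes_map (G E G' E' : Type) (fG : G -> G') (fE : E -> E') :
    cells_map (ctimes G E) (ctimes G' E') :=
  @CellsMap (ctimes G E) (ctimes G' E') fG (fun ge => (fG ge.1, fE ge.2)).

Definition cplus (C : fieldType) (A : xmod C) :=
  Cells (fps (xB A)) (fps (xB A) * fps (xA A)).

(* (g, e) ↦ (g, (e^-1 - 1) ⋖ g); subtracting 1 from e^-1 leaves its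
   component in A. *)
Definition TA (C : fieldType) (A : xmod C) :
    cells_map (ctimes (b_star A) (adj_star A)) (cplus A) :=
  @CellsMap (ctimes (b_star A) (adj_star A)) (cplus A)
    (fun b => bs_val b)
    (fun ge => (bs_val ge.1,
       cauchy (@ract _ A)
         (snd \o fps_inv (@adj_mul _ A) (adj_one A) (as_val ge.2)) (bs_val ge.1))).

Section Inc.
Variables (C : fieldType) (X : hopfXmod C).

Definition inc_H (g : gl (hH X)) : b_star (BA X) :=
  @BStar _ (BA X) (gl_val g) (gl_one g).

(* v ⊗ x in BA(H), for v ∈ I0; insubd sends v ∉ I0 to 0. *)
Definition ba_pure (v : hI X) (x : hH X) : xA (BA X) :=
  peiffer_proj (insubd (0 : aug (hI X)) v ⊗ x : xA (semidirect X)).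

Definition inc_I_val (e : gl (hI X)) : fps (adj (BA X)) :=
  fun n => if n == 0%N then adj_one _ else (0, ba_pure (e n) 1).
Lemma inc_I_one e : inc_I_val e 0%N = adj_one _. Proof. by []. Qed.
Lemma inc_I_pos e n : (0 < n)%N -> (inc_I_val e n).1 = 0.
Proof. by case: n. Qed.
Definition inc_I (e : gl (hI X)) : adj_star (BA X) :=
  AdjStar (inc_I_one e) (@inc_I_pos e).

Definition Inc := ctimes_map inc_H inc_I.

End Inc.

(* Calculus for functions with values in a finite dimensional subspace of a
   complex vector space V: real functions combine finitely many vectors. *)
Section VectorCalculus.
Variables (R : realType) (V : lmodType R[i]).

Definition lincomb n (e : 'I_n -> V) (c : 'I_n -> R) : V :=
  \sum_(i < n) (c i)%:C%C *: e i.

Definition is_vderive (U : normedModType R) (f : U -> V) (x v : U) (w : V) :=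
  exists n (e : 'I_n -> V) (c : 'I_n -> U -> R),
    [/\ \forall y \near x, f y = lincomb e (c ^~ y),
        forall i, derivable (c i) x v
      & w = lincomb e (fun i => 'D_v (c i) x)].

Definition vderive (U : normedModType R) (f : U -> V) (x v : U) : V :=
  xget 0 [set w | is_vderive f x v w].

Local Notation mu := (@lebesgue_measure R).

Definition is_vint01 (f : R -> V) (w : V) :=
  exists n (e : 'I_n -> V) (c : 'I_n -> R -> R),
    [/\ {ae mu, forall t, 0 <= t <= 1 -> f t = lincomb e (c ^~ t)},
        forall i, mu.-integrable `[0, 1] (EFin \o c i)
      & w = lincomb e (fun i => Rintegral mu `[0, 1] (c i))].

Definition vint01 (f : R -> V) : V := xget 0 [set w | is_vint01 f w].

(* f is continuous on [0, 1] and solves f' = g off a finite set. *)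
Definition is_primitive01 (f g : R -> V) :=
  exists n (e : 'I_n -> V) (c : 'I_n -> R -> R) (E : seq R),
    [/\ forall t, 0 <= t <= 1 -> f t = lincomb e (c ^~ t),
        forall i, {within `[0, 1], continuous (c i)}
      & forall t, 0 < t < 1 -> t \notin E ->
          (forall i, derivable (c i) t 1) /\
          lincomb e (fun i => 'D_1 (c i) t) = g t].

End VectorCalculus.

Definition is_primitive01_fps (R : realType) (V : lmodType R[i])
    (f g : R -> fps V) :=
  forall n, is_primitive01 (f ^~ n) (g ^~ n).

Definition vint01_fps (R : realType) (V : lmodType R[i]) (f : R -> fps V) :
    fps V :=
  fun n => vint01 (f ^~ n).

Section Smooth.
Variables (R : realType) (U W : normedModType R).

Definition iterD (vs : seq U) (f : U -> W) : U -> W :=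
  foldr (fun v g x => 'D_v g x) f vs.

Definition smooth_on (A : set U) (f : U -> W) :=
  forall vs x, A x -> differentiable (iterD vs f) x.

End Smooth.

Record chart (R : realType) (M : topologicalType) (d : nat) := Chart {
  cdom : set M;
  cmap : M -> 'rV[R]_d;
  cinv : 'rV[R]_d -> M;
  cdom_open : open cdom;
  cimg_open : open (cmap @` cdom);
  cmap_cont : {within cdom, continuous cmap};
  cinv_cont : {within cmap @` cdom, continuous cinv};
  cmapK : forall p, cdom p -> cinv (cmap p) = p }.

Definition cimg (R : realType) (M : topologicalType) d (c : chart R M d) :=
  cmap c @` cdom c.

Record manifold (R : realType) := Manifold {
  mcarrier :> topologicalType;
  mdim : nat;
  matlas : set (chart R mcarrier mdim);
  mhausdorff : hausdorff_space mcarrier;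
  mcountable : @second_countable mcarrier;
  mcover : forall p, exists2 c, matlas c & cdom c p;
  mcompat : forall c c', matlas c -> matlas c' ->
    smooth_on (cmap c @` (cdom c `&` cdom c')) (cmap c' \o cinv c) }.

Definition chart_at (R : realType) (M : manifold R) (p : M) :=
  s2val (cid2 (mcover p)).

(* f : A → M is smooth, for an arbitrary A ⊂ U: in suitable charts it has
   smooth local extensions to open sets of U. *)
Definition smooth_into (R : realType) (M : manifold R) (U : normedModType R)
    (A : set U) (f : U -> M) :=
  forall x, A x -> exists c N (g : U -> 'rV[R]_(mdim M)),
    [/\ matlas c, open N, N x, smooth_on N g
      & forall y, N y -> A y -> cdom c (f y) /\ cmap c (f y) = g y].

(* Differential forms are families of local representatives: f1 c x v is the
   value at the point of coordinates x in the chart c, on the tangent vector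
   of coordinates v; only charts of the atlas and x in the image of c matter. *)
Section Forms.
Variables (R : realType) (M : manifold R) (V : lmodType R[i]).
Local Notation vec := 'rV[R]_(mdim M).
Local Notation mchart := (chart R M (mdim M)).

Record form1 := Form1 {
  f1 :> mchart -> vec -> vec -> V;
  f1_linear : forall c x, matlas c -> cimg c x ->
    forall (a : R) v w, f1 c x (a *: v + w) = a%:C%C *: f1 c x v + f1 c x w;
  f1_smooth : exists n (e : 'I_n -> V), forall c, matlas c ->
    exists a : 'I_n -> vec -> vec -> R,
      (forall i v, smooth_on (cimg c) (a i ^~ v)) /\
      (forall x v, cimg c x -> f1 c x v = lincomb e (fun i => a i x v));
  f1_compat : forall c c' p v, matlas c -> matlas c' -> cdom c p -> cdom c' p ->
    f1 c (cmap c p) v =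
    f1 c' (cmap c' p) ('D_v (cmap c' \o cinv c) (cmap c p)) }.

Record form2 := Form2 {
  f2 :> mchart -> vec -> vec -> vec -> V;
  f2_linearl : forall c x, matlas c -> cimg c x ->
    forall (a : R) v w u,
      f2 c x (a *: v + w) u = a%:C%C *: f2 c x v u + f2 c x w u;
  f2_linearr : forall c x, matlas c -> cimg c x ->
    forall (a : R) u v w,
      f2 c x u (a *: v + w) = a%:C%C *: f2 c x u v + f2 c x u w;
  f2_alt : forall c x, matlas c -> cimg c x -> forall v, f2 c x v v = 0;
  f2_smooth : exists n (e : 'I_n -> V), forall c, matlas c ->
    exists a : 'I_n -> vec -> vec -> vec -> R,
      (forall i v w, smooth_on (cimg c) (fun x => a i x v w)) /\
      (forall x v w, cimg c x -> f2 c x v w = lincomb e (fun i => a i x v w));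
  f2_compat : forall c c' p v w, matlas c -> matlas c' ->
    cdom c p -> cdom c' p ->
    f2 c (cmap c p) v w =
    f2 c' (cmap c' p) ('D_v (cmap c' \o cinv c) (cmap c p))
                      ('D_w (cmap c' \o cinv c) (cmap c p)) }.

Definition lie_bracket (X Y : vec -> vec) (x : vec) : vec :=
  'D_(X x) Y x - 'D_(Y x) X x.

(* dω(X, Y) = X ω(Y) - Y ω(X) - ω([X, Y]) in the chart c *)
Definition ext_d (w : form1) (c : mchart) (X Y : vec -> vec) (x : vec) : V :=
  vderive (fun y => w c y (Y y)) x (X x) -
  vderive (fun y => w c y (X y)) x (Y x) -
  w c x (lie_bracket X Y x).

(* ω(γ'(t)) *)
Definition pull1 (w : form1) (g : R -> M) (t : R) : V :=
  let c := chart_at (g t) in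
  w c (cmap c (g t)) ('D_1 (cmap c \o g) t).

(* m(∂Γ/∂s, ∂Γ/∂u) at (u, s) *)
Definition pull2 (m : form2) (G : R * R -> M) (u s : R) : V :=
  let c := chart_at (G (u, s)) in
  m c (cmap c (G (u, s)))
    ('D_((0, 1) : R * R) (cmap c \o G) (u, s))
    ('D_((1, 0) : R * R) (cmap c \o G) (u, s)).

End Forms.

Section Paths.
Variables (R : realType) (M : manifold R).

Record path1 := Path1 {
  p1 :> R -> M;
  p1_cont : {within `[0, 1], continuous p1};
  p1_pw : exists k (t : nat -> R), [/\ t 0%N = 0, t k = 1 &
    forall i, (i < k)%N ->
      t i < t i.+1 /\ smooth_into `[t i, t i.+1] p1] }.

Definition square : set (R * R) := `[0, 1] `*` `[0, 1].

(* Polygons are convex, given by half-planes a t + b s <= c coded (a, b, c);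
   any paving by polygons refines to one of this kind. An edge inside the
   square which meets a side without lying in it is transverse to that side,
   so that transversality to the boundary needs no clause. *)
Definition polygon (E : seq (R * R * R)) : set (R * R) :=
  [set p | forall e, e \in E -> e.1.1 * p.1 + e.1.2 * p.2 <= e.2].

Definition paving (P : seq (seq (R * R * R))) :=
  [/\ square = \bigcup_(E in [set` P]) polygon E,
      forall E, E \in P -> (polygon E)° !=set0
    & forall i j, (i < j < size P)%N ->
        (polygon (nth [::] P i))° `&` (polygon (nth [::] P j))° = set0].

Record path2 := Path2 {
  p2 :> R * R -> M;
  p2_cont : {within square, continuous p2};
  p2_pw : exists2 P, paving P &
    forall E, E \in P -> smooth_into (polygon E) p2;
  p2_left : forall s, 0 <= s <= 1 -> p2 (0, s) = p2 (0, 0);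
  p2_right : forall s, 0 <= s <= 1 -> p2 (1, s) = p2 (1, 0) }.

Record paths_map (X : cells) := PathsMap {
  on1 : path1 -> mor1 X;
  on2 : path2 -> mor2 X }.

Definition paths_comp (X Y : cells) (T : cells_map X Y) (F : paths_map X) :=
  PathsMap (map1 T \o on1 F) (map2 T \o on2 F).

End Paths.

Record hopf2conn (R : realType) (X : hopfXmod R[i]) (M : manifold R) :=
  Hopf2conn {
  omega : form1 M (hH X);
  conn_m1 : form2 M (hI X);
  conn_m2 : form2 M (hI X);
  conn_m1_d : forall c, matlas c -> forall Y Z,
    smooth_on (cimg c) Y -> smooth_on (cimg c) Z ->
    forall x, cimg c x -> hd X (conn_m1 c x (Y x) (Z x)) = ext_d omega c Y Z x;
  conn_m2_bracket : forall c x, matlas c -> cimg c x -> forall v w,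
    hd X (conn_m2 c x v w) =
    - (omega c x v * omega c x w - omega c x w * omega c x v) }.

Section Holonomy.
Variables (R : realType) (X : hopfXmod R[i]) (M : manifold R).
Variable A : hopf2conn X M.
Local Notation H := (hH X).
Local Notation I := (hI X).

Definition fully_primitive := forall c x, matlas c -> cimg c x ->
  (forall v, primitive (omega A c x v)) /\
  (forall v w, primitive (conn_m1 A c x v w) /\ primitive (conn_m2 A c x v w)).

(* the solution of dP/dt = ω̄(γ'(t)) P with P(t0) = 1 *)
Definition holP_sol (g : R -> M) (t0 : R) : R -> fps H :=
  xget (fun=> monom 0 1) [set P | P t0 = monom 0 1 /\
    is_primitive01_fps P
      (fun t => cauchy *%R (monom 1 (pull1 (omega A) g t)) (P t))].

(* P(γ, [t, t0]) *)
Definition holP (g : R -> M) (t t0 : R) : fps H := holP_sol g t0 t.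

Definition slice (G : R * R -> M) (s : R) : R -> M := fun t => G (t, s).

(* P(Γ,[0,u],s) ▷ m̄(∂Γ/∂s, ∂Γ/∂u) *)
Definition integrand (G : R * R -> M) (s u : R) : fps I :=
  cauchy (@hact _ X) (holP (slice G s) 0 u)
    (monom 1 (pull2 (conn_m1 A) G u s) + monom 2 (pull2 (conn_m2 A) G u s)).

(* the solution of dQ/ds = -(∫ P ▷ m̄ du) Q with Q(s0) = 1 *)
Definition holQ_sol (G : R * R -> M) (s0 : R) : R -> fps I :=
  xget (fun=> monom 0 1) [set Q | Q s0 = monom 0 1 /\
    is_primitive01_fps Q
      (fun s => - cauchy *%R (vint01_fps (integrand G s)) (Q s))].

Definition holQ (G : R * R -> M) (s s0 : R) : fps I := holQ_sol G s0 s.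

Definition finv (B : hopfAlg R[i]) (x : fps B) : fps B := fps_inv *%R 1 x.

(* Stated as a property of F because the values are to be group-like. *)
Definition exact_holonomy (F : paths_map M (ctimes (gl H) (gl I))) :=
  (forall g : path1 M, gl_val (on1 F g) = finv (holP g 1 0)) /\
  (forall G : path2 M,
     gl_val (on2 F G).1 = finv (holP (slice G 0) 1 0) /\
     gl_val (on2 F G).2 = finv (holQ G 1 0)).

Definition fuzzyR (G : R * R -> M) : fps (xA (BA X)) :=
  - vint01_fps (fun s => vint01_fps (fun u =>
      cauchy (@ba_pure _ X) (integrand G s u) (holP (slice G s) 0 1))).

Definition fuzzy_holonomy : paths_map M (cplus (BA X)) :=
  @PathsMap _ M (cplus (BA X)) (fun g => finv (holP g 1 0))
    (fun G => (finv (holP (slice G 0) 1 0), fuzzyR G)).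

End Holonomy.

(* Main.v *)
(* Write P_s(u) for P(Γ,[0,u],s), a_s = ω(∂_u Γ) and M_s = ∫ P_s ▷ m. All the holonomies are
   formal series solving linear equations without term of degree 0, so each coefficient is
   an ordinary primitive of coefficients of lower degree, and identities between holonomies
   follow from uniqueness of primitives. In particular primitivity of ω, m_1, m_2 makes the
   transports group-like, so that ∂(P ▷ m) = P ∂(m) P^-1.

   Duhamel's formula expresses P_s(1) - P_{s0}(1) by the integral over u of
   P_s (a_s - a_{s0}) P_{s0}^-1. Stokes' formula on a thin strip of the square, which only
   needs first derivatives of Γ off the edges of the paving, and the structure equations for
   ∂(m_1), ∂(m_2) then give d/ds P_s(1) = - ∂(M_s) P_s(1). As Q' = - M Q, uniqueness yields
   ∂(Q_s) P_0(1) = P_s(1). In BA(H) the second Peiffer relation says vw ⊗ x = v ⊗ ∂(w) x, so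
     d/ds (Q_s - 1) ⊗ P_0(1) = - M_s Q_s ⊗ P_0(1) = - M_s ⊗ P_s(1),
   and integrating over [0,1] shows that R(Γ) is (Q_1 - 1) ⊗ P_0(1), which is what T ∘ Inc
   makes of the exact holonomy. *)

(* The coefficient algebras carry no topology: a derivative or an integral exists only through a
   presentation by finitely many vectors with real coefficient functions, and presentations are not
   unique. Real-linear functionals separate vectors, so identities are tested on real functions;
   dual systems turn any presentation into one whose coefficients are functionals of the function
   itself.

   Stokes is therefore derived from difference quotients in s: in a chart ω(∂_u Γ) is a sum of terms
   ψ ∂_u x, and integrating by parts in u before passing to the limit leaves difference quotients of
   ψ and x only. Rows on the line of a horizontal edge, finitely many, are excluded.

   Transports and integrals are picked by [xget], so every fact about them passes through existence
   and uniqueness, on [0, 1] and off finite sets. *)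
From Pilot Require Import Defs.
From HB Require Import structures.
From mathcomp Require Import all_boot all_order all_algebra.
From mathcomp Require Import all_classical all_reals all_analysis.
From mathcomp Require Import complex.
From mathcomp Require Import ring lra.

Set Implicit Arguments.
Unset Strict Implicit.
Unset Printing Implicit Defensive.
Import Order.TTheory GRing.Theory Num.Theory.
Import numFieldNormedType.Exports.
Local Open Scope classical_set_scope.
Local Open Scope ring_scope.

(** * Piecewise continuous functions *)

Section PiecewiseContinuous.
Variable R : realType.
Local Notation mu := (@lebesgue_measure R).
Implicit Types (a b t B : R) (E : seq R) (c f : R -> R).

(** Nothing is asked at the end points or on the finite list [E], where the data coming from a
    paving are arbitrary. The uniform bound [B] gives integrability, and later the domination needed
    for limits. *)
Definition pcw a b E B c := forall t, a < t < b -> t \notin E ->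
  `|c t| <= B /\ {for t, continuous c}.

Lemma open_notin E : open [set t : R | t \notin E].
Proof.
have -> : [set t : R | t \notin E] = ~` [set` E].
  by apply/seteqP; split => t /=; [move=> /negP|move=> /negP].
rewrite openC; have h : accessible_space R by exact/hausdorff_accessible/Rhausdorff.
exact: (iffLR (@accessible_finite_set_closed _) h _ (finite_seq E)).
Qed.

(** The interval splits into an open set, on which [c] is continuous, and a finite set, on which
    every function is measurable. *)
Lemma pcw_measurable a b E B c : pcw a b E B c -> measurable_fun `[a, b] c.
Proof.
move=> pc; pose D := `]a, b[%classic `&` [set t | t \notin E].
pose F := `[a, b]%classic `&` [set` [:: a, b & E]].
have cF : countable F by apply/finite_set_countable/finite_setIr/finite_seq.
have -> : `[a, b]%classic = D `|` F.
  apply/seteqP; split => t /=; rewrite /D /F /=.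
    rewrite !in_itv/= => /andP[ta tb].
    case: (boolP (t \in [:: a, b & E])) => [?|]; first by right; rewrite ta tb.
    rewrite !inE !negb_or => /and3P[t1 t2 t3]; left; split => //.
    by rewrite !lt_neqAle ta tb t2 eq_sym t1.
  rewrite !in_itv/= => -[[/andP[ta tb] _]|[-> //]].
  by rewrite !ltW.
have mF : measurable F by exact: countable_measurable.
have oD : open D by apply: openI; [exact: interval_open|exact: open_notin].
apply/measurable_funU => //; first exact: measurable_realfun.open_measurable.
split.
  apply: measurable_realfun.open_continuous_measurable_fun => // t; rewrite inE => -[].
  by rewrite /= in_itv/= => ht hE; have [] := pc t ht hE.
move=> _ Y mY; apply: countable_measurable => //.
exact: sub_countable (subset_card_le (@subIsetl _ _ _)) cF.
Qed.

Lemma pcw_integrable a b E B c : pcw a b E B c ->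
  mu.-integrable `[a, b] (EFin \o c).
Proof.
move=> pc; apply: measurable_bounded_integrable => //.
- by have := @lebesgue_measure_itv R `[a, b] => /= ->; case: ifP => _; rewrite ltry.
- exact: pcw_measurable pc.
(* A bound is needed at every point of the closed interval, so the values at the end points and on
   [E] are added to [B]. *)
exists (`|B| + \sum_(e <- [:: a, b & E]) `|c e|); split; first exact: num_real.
move=> M hM t /=; rewrite in_itv/= => /andP[ta tb].
apply: le_trans (ltW hM).
have [tE|] := boolP (t \in [:: a, b & E]).
  rewrite (big_rem _ tE)/= addrCA lerDl addr_ge0//.
  by apply: sumr_ge0 => e _.
rewrite !inE !negb_or => /and3P[t1 t2 t3].
have [|le _] := pc t _ t3; first by rewrite !lt_neqAle ta tb t2 eq_sym t1.
apply: (le_trans le); apply: (le_trans (ler_norm _)).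
by rewrite lerDl sumr_ge0.
Qed.

Lemma pcwS a b a' b' E B c : a <= a' -> b' <= b -> pcw a b E B c ->
  pcw a' b' E B c.
Proof.
move=> aa bb pc t /andP[h1 h2] tE; apply: pc => //.
by rewrite (le_lt_trans aa h1) (lt_le_trans h2 bb).
Qed.

Lemma pcw_sub a b E E' B B' c : {subset E <= E'} -> B <= B' ->
  pcw a b E B c -> pcw a b E' B' c.
Proof.
move=> EE BB pc t ht tE; have [|h1 h2] := pc t ht.
  by apply: contra tE; exact: EE.
by split=> //; exact: le_trans h1 BB.
Qed.

Lemma pcwD a b E E' B B' c c' : pcw a b E B c -> pcw a b E' B' c' ->
  pcw a b (E ++ E') (B + B') (fun t => c t + c' t).
Proof.
move=> p1 p2 t ht; rewrite mem_cat negb_or => /andP[tE tE'].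
have [h1 h2] := p1 t ht tE; have [h3 h4] := p2 t ht tE'.
split; last exact: continuousD.
by apply: (le_trans (ler_normD _ _)); exact: lerD.
Qed.

Lemma pcwM a b E E' B B' c c' : pcw a b E B c -> pcw a b E' B' c' ->
  pcw a b (E ++ E') (B * B') (fun t => c t * c' t).
Proof.
move=> p1 p2 t ht; rewrite mem_cat negb_or => /andP[tE tE'].
have [h1 h2] := p1 t ht tE; have [h3 h4] := p2 t ht tE'.
split; last exact: continuousM.
by rewrite normrM; apply: ler_pM.
Qed.

Lemma pcw_cst a b (k : R) : pcw a b [::] `|k| (fun=> k).
Proof. by move=> t _ _; split => //; exact: cst_continuous. Qed.

Lemma pcwN a b E B c : pcw a b E B c -> pcw a b E B (fun t => - c t).
Proof.
move=> p1 t ht tE; have [h1 h2] := p1 t ht tE.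
by split; [rewrite normrN|exact: continuousN].
Qed.

Lemma pcw_eq a b E E' B c c' : pcw a b E B c ->
  (forall t, a < t < b -> t \notin E' -> c t = c' t) -> pcw a b (E ++ E') B c'.
Proof.
move=> p e t ht; rewrite mem_cat negb_or => /andP[tE tE'].
have [h1 h2] := p t ht tE; split; first by rewrite -e.
apply: (cvg_trans _ ) ; last first.
  rewrite /continuous_at -(e t ht tE'); exact: h2.
apply: near_eq_cvg.
have : nbhs t [set x | x \notin E'] by apply: open_nbhs_nbhs; split => //; exact: open_notin.
have : \forall x \near t, a < x < b.
  have [h3 h4] := andP ht.
  by near=> x; apply/andP; split; near: x; [exact: lt_nbhsr|exact: lt_nbhsl].
apply: filterS2 => x hx xE; by rewrite e.
Unshelve. all: by end_near. Qed.

Lemma ae_notin E : {ae mu, forall t, t \notin E}.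
Proof.
have cE : countable [set` E] := finite_set_countable (finite_seq E).
exists [set` E]; split; first exact: countable_measurable.
  exact: countable_lebesgue_measure0.
by move=> t /= /negP; rewrite negbK.
Qed.

Lemma Rint_congr a b E B c c' : pcw a b E B c ->
  (forall t, a < t < b -> t \notin E -> c t = c' t) ->
  \int[mu]_(t in `[a, b]) c t = \int[mu]_(t in `[a, b]) c' t.
Proof.
move=> p e; have p' := pcw_eq p e.
rewrite /Rintegral; congr fine; apply: ae_eq_integral => //.
- by have /integrableP[] := pcw_integrable p.
- by have /integrableP[] := pcw_integrable p'.
have := ae_notin [:: a, b & E].
apply: filterS; first exact: (ae_filter_ringOfSetsType mu).
move=> t tE /=; rewrite in_itv/= => /andP[ta tb].
move: tE; rewrite !inE !negb_or => /and3P[t1 t2 t3].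
by rewrite e// !lt_neqAle ta tb t2 eq_sym t1.
Qed.

Lemma Rint_bound a b E B c : a <= b -> 0 <= B -> pcw a b E B c ->
  `|\int[mu]_(t in `[a, b]) c t| <= B * (b - a).
Proof.
(* [c'] vanishes off the regular points: its norm is at most [B] everywhere, while the integral is
   unchanged. *)
move=> ab B0 p; pose c' t := if (a < t < b) && (t \notin E) then c t else 0.
have e t : a < t < b -> t \notin E -> c t = c' t.
  by move=> ht hE; rewrite /c' ht hE.
have p' := pcw_eq p e.
rewrite (Rint_congr p e).
apply: (le_trans (le_normr_Rintegral _ (pcw_integrable p'))) => //.
have -> : B * (b - a) = \int[mu]_(t in `[a, b]) B.
  rewrite Rintegral_cst//; congr (_ * _).
  have := @lebesgue_measure_itv R `[a, b] => /= ->.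
  rewrite lte_fin; case: ltP => //= h.
  by apply/eqP; rewrite subr_eq0 eq_le ab h.
apply: le_Rintegral => //.
- have p'' : pcw a b (E ++ E) B (fun t => `|c' t|).
    move=> t ht hE; have [h1 h2] := p' t ht hE.
    split; first by rewrite normr_id.
    exact: (continuous_comp h2 (@norm_continuous _ _ _)).
  exact: (pcw_integrable p'').
- exact: (pcw_integrable (pcw_cst B)).
move=> t _; rewrite /c'; case: ifP => [/andP[ht hE]|_]; last by rewrite normr0.
by have [] := p t ht hE.
Qed.

(* induction on the exceptional set: split the interval at its first point *)
Lemma mean_value_bound E f B x y : x <= y ->
  {within `[x, y], continuous f} ->
  (forall t, x < t < y -> t \notin E -> derivable f t 1 /\ `|'D_1 f t| <= B) ->
  `|f y - f x| <= B * (y - x).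
Proof.
elim: E x y => [|e E ih] x y.
  rewrite le_eqVlt => /orP[/eqP<-|xy] cf df; first by rewrite !subrr normr0 mulr0.
  have hd t : t \in `]x, y[%R -> is_derive t 1 f ('D_1 f t).
    rewrite in_itv/= => ht; have [] := df t ht isT => ? _.
    exact/derivableP.
  have [t tab ->] := MVT xy hd cf.
  rewrite normrM (@ger0_norm _ (y - x)) ?subr_ge0 ?(ltW xy)// ler_wpM2r//.
    by rewrite subr_ge0 ltW.
  by rewrite in_itv/= in tab; have [] := df t tab isT.
move=> xy cf df; have [/andP[xe ey]|he] := boolP (x < e < y); last first.
  apply: ih => // t ht tE; apply: df => //; rewrite inE negb_or tE andbT.
  by apply: contraNneq he => <-.
have -> : f y - f x = (f y - f e) + (f e - f x) by rewrite addrA subrK.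
have -> : B * (y - x) = B * (y - e) + B * (e - x) by ring.
apply: (le_trans (ler_normD _ _)); apply: lerD; apply: ih; rewrite ?ltW//.
- apply: continuous_subspaceW cf => t /=; rewrite !in_itv/= => /andP[h1 ->].
  by rewrite (le_trans (ltW xe) h1).
- move=> t /andP[h1 h2] tE; apply: df; first by rewrite h2 (lt_trans xe h1).
  by rewrite inE negb_or tE andbT gt_eqF.
- apply: continuous_subspaceW cf => t /=; rewrite !in_itv/= => /andP[-> h1].
  by rewrite (le_trans h1 (ltW ey)).
- move=> t /andP[h1 h2] tE; apply: df; first by rewrite h1 (lt_trans h2 ey).
  by rewrite inE negb_or tE andbT lt_eqF.
Qed.

Lemma primitive_pcw a b E B c : a <= b -> pcw a b E B c ->
  let F x := \int[mu]_(t in `[a, x]) c t in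
  {within `[a, b], continuous F} /\
  forall t, a < t < b -> t \notin E -> is_derive t 1 F (c t).
Proof.
move=> ab p F; have ic := pcw_integrable p; split.
  exact: parameterized_integral_continuous.
move=> t /andP[at_ tb] tE; have [|_ ct] := p t _ tE; first by rewrite at_.
have [d e] := continuous_FTC1_closed tb ic at_ ct.
by apply: (DeriveDef d); rewrite -derive1E e.
Qed.

Lemma eq_of_derive E a b f g : a <= b ->
  {within `[a, b], continuous f} -> {within `[a, b], continuous g} ->
  (forall t, a < t < b -> t \notin E -> exists d, is_derive t 1 f d /\ is_derive t 1 g d) ->
  f b - f a = g b - g a.
Proof.
move=> ab cf cg h.
have : `|(f b - g b) - (f a - g a)| <= 0 * (b - a).
  apply: (@mean_value_bound E (fun t => f t - g t)) => //.
    move=> t; apply: continuousB; [exact: cf|exact: cg].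
  move=> t ht tE; have [d [hf hg]] := h t ht tE.
  have hd := @is_deriveB _ _ _ f g t 1 d d hf hg.
  split; first exact: (@ex_derive _ _ _ _ _ _ _ hd).
  by have := @derive_val _ _ _ _ _ _ _ hd; rewrite /= => ->; rewrite subrr normr0.
rewrite mul0r normr_le0 => /eqP; lra.
Qed.

(** [f] and the indefinite integral of [c] are continuous with equal derivatives off a finite set,
    so their increments agree. *)
Lemma FTC2_pcw a b E B c f : a <= b -> pcw a b E B c ->
  {within `[a, b], continuous f} ->
  (forall t, a < t < b -> t \notin E -> is_derive t 1 f (c t)) ->
  \int[mu]_(t in `[a, b]) c t = f b - f a.
Proof.
move=> ab p cf df; have [cF dF] := primitive_pcw ab p.
rewrite -(eq_of_derive ab cF cf (E:=E)) => [|t ht hE].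
  by rewrite [X in _ - X](_ : _ = 0) ?subr0// set_itv1 Rintegral_set1.
by exists (c t); split; [exact: dF|exact: df].
Qed.

(** The integral over the second interval is an increment of the primitive based at [a]. *)
Lemma Rint_split a b b' E B c : a <= b -> b <= b' -> pcw a b' E B c ->
  \int[mu]_(t in `[a, b']) c t =
  \int[mu]_(t in `[a, b]) c t + \int[mu]_(t in `[b, b']) c t.
Proof.
move=> ab bb p; have [cF dF] := primitive_pcw (le_trans ab bb) p.
have -> : \int[mu]_(t in `[b, b']) c t =
  \int[mu]_(t in `[a, b']) c t - \int[mu]_(t in `[a, b]) c t.
  apply: (FTC2_pcw (E:=E) (B:=B) (f:=fun x => \int[mu]_(t in `[a, x]) c t)) => //.
      exact: pcwS ab (lexx _) p.
    apply: continuous_subspaceW cF => t /=; rewrite !in_itv/= => /andP[h ->].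
    by rewrite (le_trans ab h).
  by move=> t /andP[h1 h2]; apply: dF; rewrite (le_lt_trans ab h1).
by rewrite addrC subrK.
Qed.

Lemma pcw_sum a b E K (I : finType) (f : I -> R -> R) :
  (forall j, pcw a b E K (f j)) ->
  pcw a b E (\sum_(j : I) K) (fun u => \sum_j f j u) /\
  \int[mu]_(u in `[a, b]) (\sum_j f j u) = \sum_j \int[mu]_(u in `[a, b]) f j u.
Proof.
move=> hf; suff : forall r : seq I,
   pcw a b E (\sum_(j <- r) K) (fun u => \sum_(j <- r) f j u) /\
   \int[mu]_(u in `[a, b]) (\sum_(j <- r) f j u) =
   \sum_(j <- r) \int[mu]_(u in `[a, b]) f j u by [].
elim=> [|j r [ih1 ih2]].
  rewrite (_ : (fun u => _) = cst 0); last by apply/funext => u; rewrite big_nil.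
  rewrite !big_nil; split; last by rewrite Rintegral_cst// mul0r.
  by apply: pcw_sub (pcw_cst 0) => //; rewrite normr0.
rewrite (_ : (fun u => _) = (fun u => f j u + \sum_(j <- r) f j u)); last first.
  by apply/funext => u; rewrite big_cons.
rewrite !big_cons; split.
  by apply: pcw_sub (pcwD (hf j) ih1) => // z; rewrite mem_cat orbb.
rewrite RintegralD//; [|exact: pcw_integrable (hf j)|exact: pcw_integrable ih1].
by rewrite ih2.
Qed.

End PiecewiseContinuous.

(** * Dominated convergence along a trace of a neighbourhood filter *)

Section DominatedConvergence.
Variable R : realType.
Local Notation mu := (@lebesgue_measure R).

(* Sequences test convergence along a trace of nbhs s0. *)
Lemma within_seq_cvg (s0 l : R) (D : set R) (f : R -> R) (P : set R) :
  (\forall s \near within D (nbhs s0), P s) ->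
  (forall u : nat -> R, (forall n, P (u n)) ->
     u @ \oo --> within D (nbhs s0) -> f \o u @ \oo --> l) ->
  f @ within D (nbhs s0) --> l.
Proof.
move=> nP h; apply/cvgrPdist_lt => e e0; apply: contrapT => nh.
have ex (n : nat) : exists s, [/\ P s, D s, `|s0 - s| < n.+1%:R^-1 & ~ `|l - f s| < e].
  apply: contrapT => hn; apply: nh.
  have nb : \forall s \near s0, `|s0 - s| < n.+1%:R^-1.
    by apply: nbhsx_ballx; rewrite invr_gt0.
  change (nbhs s0 [set s | D s -> P s]) in nP.
  change (nbhs s0 [set s | D s -> `|l - f s| < e]).
  apply: filterS2 nP nb => s /= hP hs Ds.
  by apply: contrapT => hf; apply: hn; exists s; split => //; exact: hP.
have [u hu] := choice ex.
have cu : u @ \oo --> within D (nbhs s0).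
  move=> A /= [r /= r0 hA].
  have : \forall n \near \oo, n.+1%:R^-1 < r.
    by have := near_infty_natSinv_lt (PosNum r0).
  apply: filterS => n hn; have [_ Dn ln _] := hu n.
  by apply: hA => //; exact: lt_trans ln hn.
have /cvgrPdist_lt/(_ _ e0) : f \o u @ \oo --> l.
  by apply: h cu => n; have [] := hu n.
by move=> [N _ hN]; have [_ _ _] := hu N; apply; exact: (hN N (leqnn N)).
Qed.

Lemma dct (s0 : R) (D : set R) (a b : R) (E : R -> seq R) (E0 E1 : seq R)
    (B B1 : R) (c : R -> R -> R) (l : R -> R) : a <= b ->
  (\forall s \near within D (nbhs s0), pcw a b (E s) B (c s)) ->
  pcw a b E1 B1 l ->
  (forall u, a < u < b -> u \notin E0 ->
     c s u @[s --> within D (nbhs s0)] --> l u) ->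
  \int[mu]_(u in `[a, b]) c s u @[s --> within D (nbhs s0)] -->
    \int[mu]_(u in `[a, b]) l u.
Proof.
move=> ab pc pl cl; apply: (within_seq_cvg pc) => v pv cv.
have il := pcw_integrable pl.
have [] := @dominated_convergence _ _ R mu `[a, b]%classic
  (measurable_itv _) (fun n u => (c (v n) u)%:E) (EFin \o l) (cst B%:E).
- by move=> n; have /integrableP[] := pcw_integrable (pv n).
- by have /integrableP[] := il.
- have : {ae mu, forall t, t \notin [:: a, b & E0]} by exact: ae_notin.
  apply: filterS; first exact: (ae_filter_ringOfSetsType mu).
  move=> u; rewrite !inE !negb_or => /and3P[u1 u2 u3] /=.
  rewrite in_itv/= => /andP[h1 h2].
  have hu : a < u < b by rewrite !lt_neqAle h1 h2 u2 eq_sym u1.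
  apply: cvg_EFin; first by apply: nearW.
  exact: cvg_comp cv (cl u hu u3).
- exact: (pcw_integrable (pcw_cst B)).
(* The exceptional points of the integrands change along the sequence; their union is countable,
   hence still negligible. *)
- have cE : countable (\bigcup_n [set` [:: a, b & E (v n)]]).
    by apply: bigcup_countable => // n _; exact: finite_set_countable (finite_seq _).
  exists (\bigcup_n [set` [:: a, b & E (v n)]]); split.
  + exact: countable_measurable.
  + exact: countable_lebesgue_measure0.
  move=> u /= hu; apply: contrapT => nu; apply: hu => n.
  rewrite in_itv/= => /andP[h1 h2]; rewrite lee_fin.
  have ua : u != a by apply/eqP => ua; apply: nu; exists 0%N => //=; rewrite ua mem_head.
  have ub : u != b by apply/eqP => ub; apply: nu; exists 0%N => //=; rewrite ub !inE eqxx orbT.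
  have [] := pv n u _ _ => //.
    by rewrite !lt_neqAle h1 h2 ub eq_sym ua.
  by apply/negP => hE; apply: nu; exists n => //=; rewrite !inE hE !orbT.
move=> _ _ h; rewrite /Rintegral; apply: fine_cvg.
rewrite fineK//; exact: integrable_fin_num.
Qed.

End DominatedConvergence.

(** * Functions on the square and their integrals along rows *)

Section Square.
Variable R : realType.
Local Notation mu := (@lebesgue_measure R).
Implicit Types (T : set R) (Bad : R -> seq R) (B u s : R) (c : R * R -> R).

Local Notation sq := (@square R).

(** [T] is the set of admissible heights and [Bad s] the finite list of exceptional abscissae on the
    row of height [s]. Continuity is joint, relative to the square, because limits are taken along
    rows as well as across them. *)
Definition regc T Bad B c := forall u s, T s -> 0 < u < 1 -> u \notin Bad s ->
  `|c (u, s)| <= B /\ c x @[x --> within sq (nbhs (u, s))] --> c (u, s).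

Lemma regc_cst T Bad k : regc T Bad `|k| (fun=> k).
Proof. by move=> u s _ _ _; split=> //; exact: cvg_cst. Qed.

Lemma regcM T Bad B B' c c' : regc T Bad B c -> regc T Bad B' c' ->
  regc T Bad (B * B') (fun y => c y * c' y).
Proof.
move=> p q u s Ts hu hb; have [h1 h2] := p u s Ts hu hb.
have [h3 h4] := q u s Ts hu hb; split; last exact: cvgM.
by rewrite normrM; exact: ler_pM.
Qed.

Lemma regcS T T' Bad B c : T' `<=` T -> regc T Bad B c -> regc T' Bad B c.
Proof. by move=> TT p u s /TT Ts; exact: p. Qed.

Lemma regc_continuous T Bad B c : T `<=` `[0, 1] ->
  (forall y, sq y -> `|c y| <= B) ->
  (forall y, sq y -> T y.2 -> c x @[x --> within sq (nbhs y)] --> c y) ->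
  regc T Bad B c.
Proof.
move=> T01 cB cc u s Ts /andP[u0 u1] _.
have hy : sq (u, s).
  by split; [rewrite /= in_itv/= !ltW|exact: T01].
by split; [exact: cB|exact: cc].
Qed.

Lemma cvg_slice1 u s : 0 < u < 1 -> 0 <= s <= 1 ->
  (x, s) @[x --> u] --> within sq (nbhs (u, s)).
Proof.
move=> /andP[u0 u1] hs A; rewrite /within /= => hA.
have : (x, s) @[x --> u] --> (u, s).
  by apply: (@cvg_pair _ _ _ (nbhs u) (nbhs u) (nbhs s)); [exact: cvg_id|exact: cvg_cst].
move=> /(_ _ hA) /= hA'.
change (nbhs u [set x | A (x, s)]).
change (nbhs u [set x | sq (x, s) -> A (x, s)]) in hA'.
have ne : \forall x \near u, 0 < x < 1.
  by near=> x; apply/andP; split; near: x; [exact: lt_nbhsr|exact: lt_nbhsl].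
apply: filterS2 hA' ne => x /= hx /andP[x0 x1]; apply: hx.
by split; rewrite /= in_itv/= ?hs// !ltW.
Unshelve. all: by end_near. Qed.

Lemma cvg_slice2 (D : set R) u s : 0 <= u <= 1 -> D `<=` `[0, 1] ->
  (u, x) @[x --> within D (nbhs s)] --> within sq (nbhs (u, s)).
Proof.
move=> hu hD A; rewrite /within /= => hA.
have : (u, x) @[x --> s] --> (u, s).
  by apply: (@cvg_pair _ _ _ (nbhs s) (nbhs u) (nbhs s)); [exact: cvg_cst|exact: cvg_id].
move=> /(_ _ hA) /= hA'.
change (nbhs s [set x | D x -> A (u, x)]).
change (nbhs s [set x | sq (u, x) -> A (u, x)]) in hA'.
apply: filterS hA' => x /= hx Dx; apply: hx.
by split; [rewrite /= in_itv/=|exact: hD].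
Qed.

Lemma regc_pcw T Bad B c s : T `<=` `[0, 1] -> T s -> regc T Bad B c ->
  pcw 0 1 (Bad s) B (fun u => c (u, s)).
Proof.
move=> T01 Ts p u hu hb; have [h1 h2] := p u s Ts hu hb; split => //.
apply: (cvg_comp _ _ (cvg_slice1 hu _) h2).
by have := T01 _ Ts; rewrite /= in_itv.
Qed.

Section Param.
Variables (T : set R) (Bad : R -> seq R) (B : R) (c : R * R -> R).
Hypotheses (T01 : T `<=` `[0, 1])
  (Topen : forall s, T s -> \forall x \near within `[0, 1] (nbhs s), T x)
  (p : regc T Bad B c) (B0 : 0 <= B).

Lemma param_int_cvg u s : 0 <= u <= 1 -> T s ->
  \int[mu]_(v in `[0, u]) c (v, x) @[x --> within `[0, 1] (nbhs s)] -->
  \int[mu]_(v in `[0, u]) c (v, s).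
Proof.
move=> /andP[u0 u1] Ts.
apply: (@dct _ s _ 0 u Bad (Bad s) (Bad s) B B (fun x v => c (v, x))) => //.
- near=> x; apply: (pcwS (lexx _) u1); apply: (regc_pcw (T:=T)) => //.
  by near: x; exact: Topen.
- by apply: (pcwS (lexx _) u1); exact: (regc_pcw (T:=T)).
move=> v /andP[v0 v1] vb.
have hv : 0 < v < 1 by rewrite v0 (lt_le_trans v1).
have [_ h2] := p Ts hv vb.
by apply: (cvg_comp _ _ (@cvg_slice2 _ v s _ _) h2) => //; rewrite !ltW// (lt_le_trans v1).
Unshelve. all: by end_near. Qed.

Lemma param_prim_lip u u' s : T s -> 0 <= u <= 1 -> 0 <= u' <= 1 ->
  `|\int[mu]_(v in `[0, u]) c (v, s) - \int[mu]_(v in `[0, u']) c (v, s)| <=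
  B * `|u - u'|.
Proof.
move=> Ts; wlog uu : u u' / u <= u'.
  move=> h hu hu'; have [|/ltW] := leP u u' => uu; first exact: h.
  by rewrite distrC (distrC u); exact: h.
move=> /andP[u0 u1] /andP[u'0 u'1]; have pc := regc_pcw T01 Ts p.
rewrite (Rint_split u0 uu (pcwS (lexx _) u'1 pc)) opprD addNKr normrN.
rewrite (distrC u) (@ger0_norm _ (u' - u)) ?subr_ge0//.
exact: Rint_bound (pcwS u0 u'1 pc).
Qed.

(** Joint continuity follows from continuity in the height at fixed [u] and from the Lipschitz bound
    in [u], which is uniform in the height. *)
Lemma param_prim_cvg y : sq y -> T y.2 ->
  \int[mu]_(v in `[0, x.1]) c (v, x.2) @[x --> within sq (nbhs y)] -->
  \int[mu]_(v in `[0, y.1]) c (v, y.2).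
Proof.
case: y => u s [/= hu hs] Ts; rewrite /= in_itv/= in hu.
apply/cvgrPdist_lt => e e0.
have e20 : 0 < e / 2 by rewrite divr_gt0.
have /cvgrPdist_lt/(_ _ e20) h1 := param_int_cvg hu Ts.
change (nbhs s [set x | `[0, 1]%classic x -> `|\int[mu]_(v in `[0, u]) c (v, s) -
   \int[mu]_(v in `[0, u]) c (v, x)| < e / 2]) in h1.
have h2 : nbhs s [set x | `[0, 1]%classic x -> T x] := Topen Ts.
(* Dividing by [B + 1] keeps the radius below meaningful when [B] is 0. *)
have B1 : 0 < B + 1 by rewrite ltr_wpDl.
have h3 : \forall x \near u, `|u - x| < e / 2 / (B + 1).
  by apply: nbhsx_ballx; rewrite divr_gt0.
change (nbhs (u, s) [set x | sq x -> `|\int[mu]_(v in `[0, u]) c (v, s) -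
   \int[mu]_(v in `[0, x.1]) c (v, x.2)| < e]).
have h1' : nbhs (u, s) [set x | `[0, 1]%classic x.2 -> `|\int[mu]_(v in `[0, u]) c (v, s) -
   \int[mu]_(v in `[0, u]) c (v, x.2)| < e / 2] .
  exact: (cvg_snd h1).
have h2' : nbhs (u, s) [set x | `[0, 1]%classic x.2 -> T x.2] .
  exact: (cvg_snd h2).
have h3' : nbhs (u, s) [set x | `|u - x.1| < e / 2 / (B + 1)] .
  exact: (cvg_fst h3).
near=> x => -[x1 x2].
have Tx : T x.2 by move: x2; near: x.
have k1 : `|\int[mu]_(v in `[0, u]) c (v, s) -
   \int[mu]_(v in `[0, u]) c (v, x.2)| < e / 2.
  by move: x2; near: x.
have k2 : `|u - x.1| < e / 2 / (B + 1) by near: x.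
rewrite -(subrKA (\int[mu]_(v in `[0, u]) c (v, x.2))) (splitr e).
apply: (le_lt_trans (ler_normD _ _)); apply: ltr_leD => //.
have hx1 : 0 <= x.1 <= 1 by move: x1; rewrite /= in_itv.
apply: (le_trans (param_prim_lip Tx hu hx1)).
rewrite ltr_pdivlMr// in k2.
have := normr_ge0 (u - x.1); nra.
Unshelve. all: by end_near. Qed.

Lemma param_prim_bound y : sq y -> T y.2 ->
  `|\int[mu]_(v in `[0, y.1]) c (v, y.2)| <= B.
Proof.
case: y => u s [/= hu _] Ts; rewrite /= in_itv/= in hu.
have := param_prim_lip Ts hu (u':=0); rewrite lexx ler01 => /(_ isT).
rewrite set_itv1 Rintegral_set1 !subr0 => h; apply: (le_trans h).
by have /andP[h0 h1] := hu; rewrite (ger0_norm h0) -[leRHS]mulr1 ler_wpM2l.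
Qed.

Lemma param_prim_derive u s : T s -> 0 < u < 1 -> u \notin Bad s ->
  is_derive u 1 (fun u => \int[mu]_(v in `[0, u]) c (v, s)) (c (u, s)).
Proof.
move=> Ts hu hb; have pc := regc_pcw T01 Ts p.
by have [_] := primitive_pcw ler01 pc; apply.
Qed.

End Param.

End Square.

(** * Real functionals and vector-valued primitives *)

Section Functionals.
Variables (R : realType) (V : lmodType R[i]).
Implicit Types (v w : V) (l : V -> R).

(** Real-linear and not complex-linear: the coefficient functions in [lincomb] are real, and a
    functional must turn such a combination into a real combination. *)
Definition rlin l := (forall v w, l (v + w) = l v + l w) /\
  (forall a v, l (a%:C%C *: v) = a * l v).

Lemma rlin0 l : rlin l -> l 0 = 0.
Proof. by move=> [_ h]; have := h 0 0; rewrite scaler0 mul0r. Qed.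

Lemma rlinN l v : rlin l -> l (- v) = - l v.
Proof.
move=> [_ h]; have := h (-1) v; rewrite mulN1r => <-.
by rewrite rmorphN1 scaleN1r.
Qed.

Lemma rlinB l v w : rlin l -> l (v - w) = l v - l w.
Proof. by move=> hl; rewrite hl.1 rlinN. Qed.

Lemma rlin_sum l (I : Type) (r : seq I) (P : pred I) (F : I -> V) : rlin l ->
  l (\sum_(i <- r | P i) F i) = \sum_(i <- r | P i) l (F i).
Proof.
move=> hl; elim/big_rec2: _ => [|i x y _ <-]; first exact: rlin0.
by rewrite hl.1.
Qed.

Lemma rlin_lincomb l n (e : 'I_n -> V) (c : 'I_n -> R) : rlin l ->
  l (lincomb e c) = \sum_i c i * l (e i).
Proof. by move=> hl; rewrite rlin_sum//; apply: eq_bigr => i _; rewrite hl.2. Qed.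

Let rsub (W : set V) := W 0 /\ (forall a v w, W v -> W w -> W (a%:C%C *: v + w)).

(* A maximal real subspace W avoiding v has codimension one: the coordinate along v is the functional. *)
Lemma rlin_separating v : v != 0 -> exists l, rlin l /\ l v = 1.
Proof.
move=> v0.
have [W [[[W0 Wl] Wv] Wmax]] : exists W, (rsub W /\ ~ W v) /\
    forall W', W `<` W' -> ~ (rsub W' /\ ~ W' v).
  pose P (W : set V) := W = set0 \/ (rsub W /\ ~ W v).
  have [W [PW Wmax]] : exists W, P W /\ forall W', W `<` W' -> ~ P W'.
    apply: Zorn_bigcup => F FP Ftot.
    have [[W FW [x Wx]]|nF] := pselect (exists2 W, F W & W !=set0); last first.
      left; apply/seteqP; split => // x [W FW Wx]; apply: nF.
      by exists W => //; exists x.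
    have hF W' x' : F W' -> W' x' -> rsub W' /\ ~ W' v.
      by move=> FW' Wx'; have [h|//] := FP _ FW'; rewrite h in Wx'.
    right; split; last by move=> [W' FW' Wv]; have [_] := hF _ _ FW' Wv; apply.
    split; first by exists W => //; have [[]] := hF _ _ FW Wx.
    move=> a y z [Y FY Yy] [Z FZ Zz].
    have [YZ|ZY] := Ftot _ _ FY FZ.
      by exists Z => //; have [[_ h] _] := hF _ _ FZ Zz; apply: h => //; exact: YZ.
    by exists Y => //; have [[_ h] _] := hF _ _ FY Yy; apply: h => //; exact: ZY.
  have hW : rsub W /\ ~ W v.
    case: PW => // W0; exfalso; apply: (Wmax [set 0]).
      rewrite W0; split => // h; have /= := h 0; exact.
    right; split; last by move=> /= h; rewrite h eqxx in v0.
    by split => // a y z /= -> ->; rewrite scaler0 addr0.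
  exists W; split => // W' WW' h; apply: (Wmax _ WW'); by right.
have Z0 : (0 : R)%:C%C = 0 by [].
have WZ a x : W x -> W (a%:C%C *: x) by move=> Wx; rewrite -[_ *: _]addr0; exact: Wl.
have WD x y : W x -> W y -> W (x + y).
  by move=> Wx Wy; rewrite -[x]scale1r; exact: (Wl 1).
have WN x : W x -> W (- x).
  by move=> /(WZ (-1)); rewrite rmorphN1 scaleN1r.
have uniq a b x : W (x - a%:C%C *: v) -> W (x - b%:C%C *: v) -> a = b.
  move=> h1 h2; apply/eqP/negPn/negP => ab; apply: Wv.
  have := WD _ _ h2 (WN _ h1); rewrite opprB addrCA addrAC subrr.
  rewrite -[X in W X -> _]/(_) sub0r => h.
  have h' : W ((a - b)%:C%C *: v).
    by rewrite rmorphB scalerBl.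
  by have := WZ (a - b)^-1 _ h'; rewrite scalerA -rmorphM mulVf ?subr_eq0// scale1r.
have ex x : exists a, W (x - a%:C%C *: v).
  have [Wx|nWx] := pselect (W x); first by exists 0; rewrite scale0r subr0.
  pose W' := [set y | exists a : R, W (y - a%:C%C *: x)].
  have WW' : W `<` W'.
    split=> [y Wy|h]; first by exists 0; rewrite scale0r subr0.
    by apply: nWx; apply: h; exists 1; rewrite scale1r subrr.
  have rW' : rsub W'.
    split; first by exists 0; rewrite scale0r subr0.
    move=> k y z [a ha] [b hb]; exists (k * a + b).
    rewrite rmorphD rmorphM scalerDl -scalerA opprD addrACA -scalerBr.
    exact: Wl.
  have [a ha] : W' v by apply: contrapT => nv; exact: (Wmax _ WW').
  have a0 : a != 0 by apply: contra_not_neq Wv => a0; rewrite a0 scale0r subr0 in ha.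
  exists a^-1; have := WN _ (WZ a^-1 _ ha).
  by rewrite scalerBr opprB scalerA -rmorphM mulVf// scale1r.
have [l hl] := choice ex.
have lE x a : W (x - a%:C%C *: v) -> l x = a by move=> h; exact: uniq (hl x) h.
exists l; split; last by apply: lE; rewrite scale1r subrr.
split=> [x y|a x]; apply: lE.
  rewrite rmorphD scalerDl opprD addrACA; exact: WD.
by rewrite rmorphM -scalerA -scalerBr; exact: WZ.
Qed.

Lemma rlin_ext v w : (forall l, rlin l -> l v = l w) -> v = w.
Proof.
move=> h; apply/eqP; rewrite -subr_eq0; apply/negPn/negP => /rlin_separating.
move=> [l [hl]]; rewrite rlinB// h// subrr => /eqP.
by rewrite eq_sym oner_eq0.
Qed.

(** The vectors [e i] may be dependent, so the coefficients of a combination of them are not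
    determined by it. Here coefficients become values of functionals defined on all of [V], hence
    functions of the combined vector alone. *)
Lemma dual_system n (e : 'I_n -> V) : exists m (b : 'I_m -> V) (l : 'I_m -> V -> R),
  (forall k, rlin (l k)) /\ (forall i, e i = lincomb b (fun k => l k (e i))).
Proof.
suff [m [b [l [hl hb he]]]] : exists m (b : 'I_m -> V) (l : 'I_m -> V -> R),
    [/\ forall k, rlin (l k), forall j k, l j (b k) = (j == k)%:R
      & forall i, e i = lincomb b (fun k => l k (e i))].
  by exists m, b, l.
elim: n e => [|n ih] e.
  by exists 0%N, (fun=> 0), (fun=> fun=> 0); split; case.
have [m [b [l [hl hb he]]]] := ih (e \o lift ord0).
(* [p] projects onto the span already treated; a new vector matters only through its remainder,
   called [r] below. *)
pose p v := lincomb b (fun k => l k v).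
have lp k v : l k (p v) = l k v.
  rewrite rlin_lincomb// (bigD1 k)//= hb eqxx mulr1 big1 ?addr0// => j jk.
  by rewrite hb eq_sym (negPf jk) mulr0.
have [e0|r0] := eqVneq (e ord0 - p (e ord0)) 0.
  exists m, b, l; split => // i; case: (unliftP ord0 i) => [j ->|->]; first exact: he.
  by apply/eqP; rewrite -subr_eq0; apply/eqP.
have [l' [hl' l'1]] := rlin_separating r0.
pose r := e ord0 - p (e ord0).
pose b' (k : 'I_m.+1) := if unlift ord0 k is Some j then b j else r.
(* Composing [l'] with the complement of [p] makes the new functional vanish on the old basis, which
   keeps the system biorthogonal. *)
pose L (k : 'I_m.+1) := if unlift ord0 k is Some j then l j else fun v => l' (v - p v).
have pD v w : p (v + w) = p v + p w.
  rewrite /p /lincomb -big_split/=; apply: eq_bigr => k _.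
  by rewrite (hl k).1 rmorphD scalerDl.
have pZ a v : p (a%:C%C *: v) = a%:C%C *: p v.
  rewrite /p /lincomb scaler_sumr; apply: eq_bigr => k _.
  by rewrite (hl k).2 rmorphM scalerA.
have pp k : p (b k) = b k.
  rewrite /p /lincomb (bigD1 k)//= hb eqxx scale1r big1 ?addr0// => j jk.
  by rewrite hb (negPf jk) scale0r.
have pr : p r = 0.
  rewrite /p /lincomb big1// => k _.
  by rewrite rlinB// lp subrr scale0r.
have hL k : rlin (L k).
  rewrite /L; case: unliftP => // _; split=> [v w|a v].
    by rewrite pD opprD addrACA (hl'.1 (v - p v)).
  by rewrite pZ -scalerBr hl'.2.
have comb v : lincomb b' (fun k => L k v) = (l' (v - p v))%:C%C *: r + p v.
  rewrite /lincomb big_ord_recl /b' /L unlift_none; congr (_ + _).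
  by apply: eq_bigr => k _; rewrite liftK.
exists m.+1, b', L; split => //.
  move=> j k; rewrite /L /b'; case: (unliftP ord0 j) => [j' ->|->];
    case: (unliftP ord0 k) => [k' ->|->].
  - by rewrite hb (inj_eq lift_inj).
  - by rewrite rlinB// lp subrr eq_sym (negPf (neq_lift _ _)).
  - by rewrite pp subrr rlin0// (negPf (neq_lift _ _)).
  - by rewrite pr subr0 eqxx.
move=> i; rewrite comb; case: (unliftP ord0 i) => [j ->|->].
  have pe : p (e (lift ord0 j)) = e (lift ord0 j) by rewrite [RHS]he.
  by rewrite pe subrr rlin0// scale0r add0r.
by rewrite l'1 scale1r /r subrK.
Qed.

End Functionals.

Section FiniteCombinations.
Variable R : realType.
Local Notation mu := (@lebesgue_measure R).

(** Indexed by any finite type, so that sums and bilinear products of combinations are indexed by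
    sums and products of the index types. *)
Definition fcomb (V : lmodType R[i]) (I : finType) (e : I -> V) (c : I -> R) : V :=
  \sum_i (c i)%:C%C *: e i.

Lemma fcomb_lincomb (V : lmodType R[i]) (I : finType) (e : I -> V) (c : I -> R) :
  fcomb e c = lincomb (fun k : 'I_#|I| => e (enum_val k)) (fun k => c (enum_val k)).
Proof. by rewrite /fcomb (reindex _ (onW_bij _ (@enum_val_bij I))). Qed.

Lemma rlin_fcomb (V : lmodType R[i]) (I : finType) (e : I -> V) (c : I -> R) l :
  rlin l -> l (fcomb e c) = \sum_i c i * l (e i).
Proof. by move=> hl; rewrite rlin_sum//; apply: eq_bigr => i _; rewrite hl.2. Qed.

Lemma lin_fcomb (V W : lmodType R[i]) (f : V -> W) (I : finType) (e : I -> V) (c : I -> R) :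
  linear f -> f (fcomb e c) = fcomb (f \o e) c.
Proof.
by move=> fl; rewrite (lin_sum fl); apply: eq_bigr => i _; rewrite (linZ fl).
Qed.

Lemma fcomb_bilin (U V W : lmodType R[i]) (op : U -> V -> W) (I J : finType)
    (e : I -> U) (c : I -> R) (e' : J -> V) (c' : J -> R) : bilin op ->
  op (fcomb e c) (fcomb e' c') =
  fcomb (fun p : I * J => op (e p.1) (e' p.2)) (fun p => c p.1 * c' p.2).
Proof.
move=> [l1 l2]; rewrite [X in op X]/fcomb (lin_sum (l1 _)) [RHS]/fcomb.
rewrite -(pair_bigA _ (fun i j => (c i * c' j)%:C%C *: op (e i) (e' j)))/=.
apply: eq_bigr => i _; rewrite (linZ (l1 _)) [X in op _ X]/fcomb (lin_sum (l2 _)) scaler_sumr.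
by apply: eq_bigr => j _; rewrite (linZ (l2 _)) scalerA -rmorphM.
Qed.

Lemma fcombD (V : lmodType R[i]) (I J : finType) (e : I -> V) (c : I -> R)
    (e' : J -> V) (c' : J -> R) :
  fcomb e c + fcomb e' c' =
  fcomb (fun x => match x with inl i => e i | inr j => e' j end)
        (fun x => match x with inl i => c i | inr j => c' j end).
Proof. by rewrite /fcomb big_sumType. Qed.

Lemma fcombDl (V : lmodType R[i]) (I : finType) (e : I -> V) (c c' : I -> R) :
  fcomb e c + fcomb e c' = fcomb e (fun i => c i + c' i).
Proof.
by rewrite /fcomb -big_split; apply: eq_bigr => i _; rewrite rmorphD scalerDl.
Qed.

Section Prim.
Variable V : lmodType R[i].
Implicit Types (f g : R -> V) (E : seq R).

Definition derivable_fcomb E f g := exists (I : finType) (e : I -> V) (c d : I -> R -> R),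
  [/\ forall t, 0 <= t <= 1 -> f t = fcomb e (c ^~ t),
      forall i, {within `[0, 1], continuous (c i)}
    & forall t, 0 < t < 1 -> t \notin E ->
        (forall i, is_derive t 1 (c i) (d i t)) /\ fcomb e (d ^~ t) = g t].

Lemma prim01P f g : is_primitive01 f g <-> exists E, derivable_fcomb E f g.
Proof.
split=> [[n [e [c [E [h1 h2 h3]]]]]|[E [I [e [c [d [h1 h2 h3]]]]]]].
  exists E, 'I_n, e, c, (fun i t => 'D_1 (c i) t); split => // t ht tE.
  by have [h4 <-] := h3 t ht tE; split => // i; exact/derivableP.
exists #|I|, (fun k => e (enum_val k)), (fun k => c (enum_val k)), E; split => //.
  by move=> t ht; rewrite h1// fcomb_lincomb.
move=> t ht tE; have [h4 <-] := h3 t ht tE; split.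
  by move=> i; have := h4 (enum_val i) => -[].
rewrite fcomb_lincomb; apply: eq_bigr => i _; congr (_%:C%C *: _).
by have := h4 (enum_val i) => -[].
Qed.

Lemma in01_0 : 0 <= (0 : R) <= 1. Proof. by rewrite lexx ler01. Qed.
Lemma in01_1 : 0 <= (1 : R) <= 1. Proof. by rewrite lexx ler01. Qed.

Lemma near_open01 (t : R) : 0 < t < 1 -> \forall x \near t, 0 <= x <= 1.
Proof.
move=> /andP[t0 t1]; near=> x; apply/andP; split; apply: ltW; near: x.
  exact: lt_nbhsr.
exact: lt_nbhsl.
Unshelve. all: by end_near. Qed.

Lemma eq_within (T : topologicalType) (U : topologicalType) (A : set T) (f g : T -> U) :
  (forall t, A t -> f t = g t) -> {within A, continuous f} -> {within A, continuous g}.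
Proof.
by move=> h; apply: subspace_eq_continuous => t /set_mem; exact: h.
Qed.

Lemma is_derive_near_eq (W : normedModType R) (f g : R -> W) t d : (\near t, f t = g t) ->
  is_derive t 1 f d -> is_derive t 1 g d.
Proof.
by move=> h; apply: near_eq_is_derive.
Qed.

Lemma within_mul (A : set R) (f g : R -> R) : {within A, continuous f} ->
  {within A, continuous g} -> {within A, continuous (fun t => f t * g t)}.
Proof. by move=> hf hg x; apply: continuousM; [exact: hf|exact: hg]. Qed.

Lemma within_sub (A : set R) (f g : R -> R) : {within A, continuous f} ->
  {within A, continuous g} -> {within A, continuous (fun t => f t - g t)}.
Proof. by move=> hf hg x; apply: continuousB; [exact: hf|exact: hg]. Qed.

Lemma within_sum (A : set R) (I : finType) (F : I -> R -> R) :
  (forall i, {within A, continuous (F i)}) ->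
  {within A, continuous (fun t => \sum_i F i t)}.
Proof.
move=> h; rewrite (_ : (fun _ => _) = \sum_i F i); last by apply/funext => t; rewrite fct_sumE.
elim/big_ind: _ => //.
  by move=> x; exact: cst_continuous.
by move=> f g hf hg x; apply: continuousD; [exact: hf|exact: hg].
Qed.

Lemma is_derive_fsum (I : finType) (F : I -> R -> R) (d : I -> R) (t : R) :
  (forall i, is_derive t 1 (F i) (d i)) ->
  is_derive t 1 (fun t => \sum_i F i t) (\sum_i d i).
Proof.
move=> h; rewrite (_ : (fun _ => _) = \sum_i F i); last by apply/funext => x; rewrite fct_sumE.
elim/big_ind2: _ => //; first exact: is_derive_cst.
by move=> f d1 g d2 hf hg; exact: is_deriveD.
Qed.

Lemma is_derive_mul (f g : R -> R) (t df dg : R) : is_derive t 1 f df ->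
  is_derive t 1 g dg -> is_derive t 1 (fun x => f x * g x) (df * g t + f t * dg).
Proof.
move=> h1 h2; have := @is_deriveM _ _ f g t 1 _ _ h1 h2.
rewrite (_ : f * g = fun x => f x * g x)// => h3.
by apply: (@is_derive_eq _ _ _ _ _ _ _ _ h3); rewrite /GRing.scale/= addrC mulrC.
Qed.

(** One exceptional set serves all functionals, since it comes from the coefficients. *)
Lemma prim01_rlin f g : is_primitive01 f g -> exists E, forall l, rlin l ->
  {within `[0, 1], continuous (l \o f)} /\
  forall t, 0 < t < 1 -> t \notin E -> is_derive t 1 (l \o f) (l (g t)).
Proof.
move=> /prim01P[E [I [e [c [d [h1 h2 h3]]]]]]; exists E => l hl.
have h4 t : 0 <= t <= 1 -> \sum_i c i t * l (e i) = (l \o f) t.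
  by move=> ht; rewrite /= h1// rlin_fcomb.
split.
  apply: (eq_within (f := fun t => \sum_i c i t * l (e i))).
    by move=> t /=; rewrite in_itv/=; exact: h4.
  apply: within_sum => i x; apply: continuousM; first exact: h2.
  exact: cst_continuous.
move=> t ht tE; have [h5 <-] := h3 t ht tE.
apply: (is_derive_near_eq (f := fun t => \sum_i c i t * l (e i))).
  by apply: filterS (near_open01 ht) => x; exact: h4.
rewrite rlin_fcomb//.
apply: is_derive_fsum => i; have := is_derive_mul (h5 i) (is_derive_cst (l (e i)) t 1).
by rewrite mulr0 addr0.
Qed.

(** The hypothesis differentiates functionals of [f], not the coefficients [c], which may be badly
    chosen. Passing to a dual system makes every coefficient a functional of [f]. *)
Lemma prim01_weak E f g (I : finType) (e : I -> V) (c : I -> R -> R) :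
  (forall t, 0 <= t <= 1 -> f t = fcomb e (c ^~ t)) ->
  (forall i, {within `[0, 1], continuous (c i)}) ->
  (forall l t, rlin l -> 0 < t < 1 -> t \notin E -> is_derive t 1 (l \o f) (l (g t))) ->
  is_primitive01 f g.
Proof.
move=> h1 h2 h3.
have [m [b [l [hl he]]]] := dual_system (fun k : 'I_#|I| => e (enum_val k)).
have he' i : e i = lincomb b (fun k => l k (e i)) by have := he (enum_rank i); rewrite enum_rankK.
pose p v := lincomb b (fun k => l k v).
have pD v w : p (v + w) = p v + p w.
  rewrite /p /lincomb -big_split/=; apply: eq_bigr => k _.
  by rewrite (hl k).1 rmorphD scalerDl.
have pZ a v : p (a%:C%C *: v) = a%:C%C *: p v.
  rewrite /p /lincomb scaler_sumr; apply: eq_bigr => k _.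
  by rewrite (hl k).2 rmorphM scalerA.
have pf t : 0 <= t <= 1 -> p (f t) = f t.
  move=> ht; rewrite h1// /fcomb (big_morph p pD (_ : p 0 = 0)).
    by apply: eq_bigr => i _; rewrite pZ [in RHS]he'.
  by rewrite /p /lincomb big1// => k _; rewrite rlin0// scale0r.
exists m, b, (fun k t => l k (f t)), E; split.
- by move=> t ht; rewrite -[LHS]pf.
- move=> k; apply: (eq_within (f := fun t => \sum_i c i t * l k (e i))).
    by move=> t /=; rewrite in_itv/= => ht; rewrite h1// rlin_fcomb.
  apply: within_sum => i x; apply: continuousM; first exact: h2.
  exact: cst_continuous.
move=> t ht tE; have h4 k := h3 (l k) t (hl k) ht tE.
split; first by move=> k; have := h4 k => -[].
(* [g t] is not known beforehand to lie in the span. It does, because [p] fixes [f]: for each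
   functional [l'], both [l' (g t)] and [l' (p (g t))] are the derivative of [l' \o f]. *)
transitivity (p (g t)).
  by apply: eq_bigr => k _; congr (_%:C%C *: _); have := h4 k => -[].
apply: rlin_ext => l' hl'.
have hq : rlin (l' \o p) by split=> [v w|a v] /=; rewrite (pD, pZ) (hl'.1, hl'.2).
have d1 := h3 _ t hq ht tE; have d2 := h3 _ t hl' ht tE.
have d3 : is_derive t 1 (l' \o f) ((l' \o p) (g t)).
  apply: is_derive_near_eq d1; apply: filterS (near_open01 ht) => x hx /=.
  by rewrite pf.
by rewrite -(@derive_val _ _ _ _ _ _ _ d2) (@derive_val _ _ _ _ _ _ _ d3).
Qed.

Lemma prim01_eq E f f' g g' : is_primitive01 f g ->
  (forall t, 0 <= t <= 1 -> f t = f' t) ->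
  (forall t, 0 < t < 1 -> t \notin E -> g t = g' t) -> is_primitive01 f' g'.
Proof.
move=> /prim01P[E' [I [e [c [d [h1 h2 h3]]]]]] ef eg; apply/prim01P.
exists (E ++ E'), I, e, c, d; split => //.
  by move=> t ht; rewrite -ef// h1.
move=> t ht; rewrite mem_cat negb_or => /andP[tE tE'].
by rewrite -eg//; exact: h3.
Qed.

Lemma prim01_cst (v : V) : is_primitive01 (fun=> v) (fun=> 0).
Proof.
apply/prim01P; exists [::], unit, (fun=> v), (fun _ _ => 1), (fun _ _ => 0); split.
- by move=> t _; rewrite /fcomb (big_pred1 tt)/= ?scale1r// => -[].
- by move=> _ x; exact: cst_continuous.
move=> t _ _; split; first by move=> _; exact: is_derive_cst.
by rewrite /fcomb big1// => i _; rewrite scale0r.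
Qed.

Lemma prim01D f f' g g' : is_primitive01 f g -> is_primitive01 f' g' ->
  is_primitive01 (fun t => f t + f' t) (fun t => g t + g' t).
Proof.
move=> /prim01P[E [I [e [c [d [h1 h2 h3]]]]]].
move=> /prim01P[E' [J [e' [c' [d' [h1' h2' h3']]]]]]; apply/prim01P.
exists (E ++ E'), (I + J)%type,
 (fun x => match x with inl i => e i | inr j => e' j end),
 (fun x => match x with inl i => c i | inr j => c' j end),
 (fun x => match x with inl i => d i | inr j => d' j end); split.
- move=> t ht; rewrite h1// h1'// fcombD.
  by apply: eq_bigr; case.
- by case.
move=> t ht; rewrite mem_cat negb_or => /andP[tE tE'].
have [h4 <-] := h3 t ht tE; have [h5 <-] := h3' t ht tE'; split; first by case.
by rewrite fcombD; apply: eq_bigr; case.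
Qed.

Lemma prim01_sum (J : Type) (r : seq J) (f g : J -> R -> V) :
  (forall j, is_primitive01 (f j) (g j)) ->
  is_primitive01 (fun t => \sum_(j <- r) f j t) (fun t => \sum_(j <- r) g j t).
Proof.
move=> h; elim: r => [|j r ih].
  apply: (prim01_eq (E := [::]) (prim01_cst 0)) => t; by rewrite big_nil.
by apply: (prim01_eq (E := [::]) (prim01D (h j) ih)) => t; rewrite big_cons.
Qed.

Lemma prim01_unique E f f' g g' t0 : is_primitive01 f g -> is_primitive01 f' g' ->
  (forall t, 0 < t < 1 -> t \notin E -> g t = g' t) ->
  0 <= t0 <= 1 -> f t0 = f' t0 -> forall t, 0 <= t <= 1 -> f t = f' t.
Proof.
move=> /prim01_rlin[E1 h1] /prim01_rlin[E2 h2] eg ht0 e t ht.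
apply: rlin_ext => l hl; have [c1 d1] := h1 l hl; have [c2 d2] := h2 l hl.
have key x y : 0 <= x -> x <= y -> y <= 1 ->
    l (f y) - l (f x) = l (f' y) - l (f' x).
  move=> x0 xy y1; apply: (@eq_of_derive _ (E ++ E1 ++ E2) x y (l \o f) (l \o f')) => //.
  - apply: continuous_subspaceW c1 => z /=; rewrite !in_itv/= => /andP[h3 h4].
    by rewrite (le_trans x0 h3) (le_trans h4).
  - apply: continuous_subspaceW c2 => z /=; rewrite !in_itv/= => /andP[h3 h4].
    by rewrite (le_trans x0 h3) (le_trans h4).
  move=> z /andP[h3 h4]; rewrite !mem_cat !negb_or => /and3P[n0 n1 n2].
  have hz : 0 < z < 1 by rewrite (le_lt_trans x0 h3) (lt_le_trans h4).
  exists (l (g z)); split; first exact: d1.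
  by rewrite eg//; exact: d2.
have /andP[a1 a2] := ht0; have /andP[b1 b2] := ht.
have [h|/ltW h] := leP t0 t.
  by have := key _ _ a1 h b2; rewrite e => /addIr.
by have := key _ _ b1 h a2; rewrite e => /addrI/oppr_inj.
Qed.

Definition pcV (g : R -> V) := exists E B (I : finType) (e : I -> V) (c : I -> R -> R),
  (forall i, pcw 0 1 E B (c i)) /\
  forall t, 0 < t < 1 -> t \notin E -> g t = fcomb e (c ^~ t).

Lemma pcV_eq E g g' : pcV g -> (forall t, 0 < t < 1 -> t \notin E -> g t = g' t) ->
  pcV g'.
Proof.
move=> [E' [B [I [e [c [h1 h2]]]]]] eg; exists (E ++ E'), B, I, e, c; split.
  by move=> i; apply: pcw_sub (h1 i) => // x; rewrite mem_cat orbC => ->.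
by move=> t ht; rewrite mem_cat negb_or => /andP[tE tE']; rewrite -eg// h2.
Qed.

Lemma pcV_prim f g : is_primitive01 f g -> pcV f.
Proof.
move=> /prim01P[E [I [e [c [d [h1 h2 h3]]]]]].
have hb i : exists B, forall t, 0 <= t <= 1 -> `|c i t| <= B.
  have : compact ((c i) @` `[0, 1]).
    by apply: continuous_compact => //; exact: segment_compact.
  move=> /compact_bounded[M [_ hM]]; exists (M + 1) => t ht.
  by apply: (hM (M + 1)); [rewrite ltrDl|exists t => //=; rewrite in_itv].
have [B hB] := choice hb.
exists [::], (\sum_i `|B i|), I, e, c; split.
  move=> i t ht _; split.
    apply: (@le_trans _ _ (B i)); first by apply: hB; case/andP: ht => *; rewrite !ltW.
    by apply: (le_trans (ler_norm _)); rewrite (bigD1 i)//= lerDl sumr_ge0.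
  by apply: (within_continuous_continuous ltr01 (h2 i)); rewrite in_itv.
by move=> t /andP[t0 t1] _; rewrite h1// !ltW.
Qed.

Lemma pcVD g g' : pcV g -> pcV g' -> pcV (fun t => g t + g' t).
Proof.
move=> [E [B [I [e [c [h1 h2]]]]]] [E' [B' [I' [e' [c' [h1' h2']]]]]].
exists (E ++ E'), (Num.max B B'), (I + I')%type,
 (fun x => match x with inl i => e i | inr j => e' j end),
 (fun x => match x with inl i => c i | inr j => c' j end); split.
  case=> i.
    by apply: pcw_sub (h1 i); [move=> x; rewrite mem_cat => ->|rewrite le_max lexx].
  by apply: pcw_sub (h1' i); [move=> x; rewrite mem_cat orbC => ->|rewrite le_max lexx orbT].
move=> t ht; rewrite mem_cat negb_or => /andP[tE tE'].
by rewrite h2// h2'// fcombD; apply: eq_bigr; case.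
Qed.

Lemma pcV_cst (v : V) : pcV (fun=> v).
Proof. exact: pcV_prim (prim01_cst v). Qed.

Lemma pcV_sum (J : Type) (r : seq J) (g : J -> R -> V) :
  (forall j, pcV (g j)) -> pcV (fun t => \sum_(j <- r) g j t).
Proof.
move=> h; elim: r => [|j r ih].
  by apply: (pcV_eq (E := [::]) (pcV_cst 0)) => t; rewrite big_nil.
by apply: (pcV_eq (E := [::]) (pcVD (h j) ih)) => t; rewrite big_cons.
Qed.

Lemma prim01_exists g t0 (v0 : V) : pcV g -> 0 <= t0 <= 1 ->
  exists f, is_primitive01 f g /\ f t0 = v0.
Proof.
move=> [E [B [I [e [c [h1 h2]]]]]] ht0.
pose C i t := \int[mu]_(x in `[0, t]) c i x.
have hC i := primitive_pcw ler01 (h1 i).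
pose f t := fcomb e (C ^~ t).
have pf : is_primitive01 f g.
  apply/prim01P; exists E, I, e, C, c; split => //.
    by move=> i; have [] := hC i.
  move=> t ht tE; split; last by rewrite h2.
  by move=> i; have [_] := hC i; apply.
exists (fun t => f t + (v0 - f t0)); split; last by rewrite addrCA subrr addr0.
by apply: (prim01_eq (E := [::]) (prim01D pf (prim01_cst _))) => // t; rewrite addr0.
Qed.

Lemma is_vint01_rlin (f : R -> V) w (l : V -> R) : is_vint01 f w -> rlin l ->
  exists g : R -> R, [/\ mu.-integrable `[0, 1] (fun t => (g t)%:E),
    {ae mu, forall t, 0 <= t <= 1 -> l (f t) = g t} & l w = \int[mu]_(t in `[0, 1]) g t].
Proof.
move=> [n [e [c [h1 h2 h3]]]] hl; exists (fun t => \sum_i c i t * l (e i)).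
have int i : mu.-integrable `[0, 1] (fun t => (c i t * l (e i))%:E).
  rewrite (_ : (fun t => _) = fun t => ((c i t)%:E * (l (e i))%:E)%E)//.
  by apply: integrableZr => //; exact: h2.
have sumE : forall r : seq 'I_n,
    mu.-integrable `[0, 1] (fun t => (\sum_(i <- r) c i t * l (e i))%:E) /\
    \int[mu]_(t in `[0, 1]) (\sum_(i <- r) c i t * l (e i)) =
    \sum_(i <- r) Rintegral mu `[0, 1] (c i) * l (e i).
  elim=> [|i r [ih1 ih2]].
    have z : (fun t => \sum_(i <- [::]) c i t * l (e i)) = cst 0 by apply/funext => t; rewrite big_nil.
    rewrite big_nil; split; last by rewrite z Rintegral_cst// mul0r.
    apply: (pcw_integrable (E := [::]) (B := `|0 : R|)).
    by rewrite z; exact: pcw_cst.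
  rewrite (_ : (fun t => _) = (fun t => c i t * l (e i) + \sum_(i <- r) c i t * l (e i))); last first.
    by apply/funext => t; rewrite big_cons.
  split.
    rewrite (_ : (fun t => _) = fun t => ((c i t * l (e i))%:E + (\sum_(i <- r) c i t * l (e i))%:E)%E)//.
      by apply: integrableD => //; exact: int.
    by apply/funext => t; rewrite big_cons EFinD.
  rewrite RintegralD//; last exact: int.
  by rewrite ih2 big_cons RintegralZr//; exact: h2.
have [s1 s2] := sumE (index_enum 'I_n).
split => //; last by rewrite h3 rlin_lincomb// s2.
apply: filterS h1; first exact: (ae_filter_ringOfSetsType mu).
by move=> t ht /ht ->; rewrite rlin_lincomb.
Qed.

(** Two presentations of one function become, under any functional, real integrands that agree
    almost everywhere. This is what makes the value picked by [vint01] computable. *)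
Lemma is_vint01_unique (f : R -> V) w w' : is_vint01 f w -> is_vint01 f w' -> w = w'.
Proof.
move=> h h'; apply: rlin_ext => l hl.
have [g [i1 e1 ->]] := is_vint01_rlin h hl.
have [g' [i2 e2 ->]] := is_vint01_rlin h' hl.
rewrite /Rintegral; congr fine; apply: ae_eq_integral => //.
- by case/integrableP: i1.
- by case/integrableP: i2.
have FF := ae_filter_ringOfSetsType mu.
apply: (@filterS2 _ _ FF _ _ _ _ e1 e2) => t h1 h2 /=.
by rewrite in_itv/= => ht; rewrite -h1// h2.
Qed.

Lemma pcV_vint01 E B (I : finType) (e : I -> V) (c : I -> R -> R) g :
  (forall i, pcw 0 1 E B (c i)) ->
  (forall t, 0 < t < 1 -> t \notin E -> g t = fcomb e (c ^~ t)) ->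
  vint01 g = fcomb e (fun i => \int[mu]_(t in `[0, 1]) c i t).
Proof.
move=> h1 h2; set w := RHS.
have hw : is_vint01 g w.
  exists #|I|, (fun k => e (enum_val k)), (fun k => c (enum_val k)); split.
  - have := @ae_notin R [:: 0, 1 & E].
    apply: filterS; first exact: (ae_filter_ringOfSetsType mu).
    move=> t; rewrite !inE !negb_or => /and3P[t1 t2 t3] /andP[t4 t5].
    by rewrite h2 ?fcomb_lincomb// !lt_neqAle t4 t5 t2 eq_sym t1.
  - by move=> k; exact: pcw_integrable (h1 _).
  - by rewrite /w fcomb_lincomb.
exact: is_vint01_unique (xgetI 0 hw) hw.
Qed.

Lemma vint01_rlin g (l : V -> R) : pcV g -> rlin l -> exists c E B,
  [/\ pcw 0 1 E B c, forall t, 0 < t < 1 -> t \notin E -> l (g t) = c t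
    & l (vint01 g) = \int[mu]_(t in `[0, 1]) c t].
Proof.
move=> [E [B [I [e [c [h1 h2]]]]]] hl.
rewrite (pcV_vint01 h1 h2).
suff h : forall r : seq I, exists E' B',
  pcw 0 1 E' B' (fun t => \sum_(i <- r) c i t * l (e i)) /\
  \int[mu]_(t in `[0, 1]) (\sum_(i <- r) c i t * l (e i)) =
  \sum_(i <- r) (\int[mu]_(t in `[0, 1]) c i t) * l (e i).
  have [E' [B' [k1 k2]]] := h (index_enum I).
  exists (fun t => \sum_i c i t * l (e i)), (E ++ E'), B'; split.
  - by apply: pcw_sub k1 => // x; rewrite mem_cat orbC => ->.
  - move=> t ht; rewrite mem_cat negb_or => /andP[tE _].
    by rewrite h2// rlin_fcomb.
  - by rewrite rlin_fcomb// k2.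
elim=> [|i r [E' [B' [k1 k2]]]].
  rewrite (_ : (fun t => _) = cst 0); last by apply/funext => t; rewrite big_nil.
  exists [::], `|0 : R|; split; first exact: pcw_cst.
  by rewrite Rintegral_cst// mul0r big_nil.
rewrite (_ : (fun t => _) = (fun t => c i t * l (e i) + \sum_(i <- r) c i t * l (e i))); last first.
  by apply/funext => t; rewrite big_cons.
have p1 := pcwM (h1 i) (pcw_cst (a := 0) (b := 1) (l (e i))).
exists ((E ++ [::]) ++ E'), (B * `|l (e i)| + B'); split; first exact: pcwD.
rewrite RintegralD//; [|exact: pcw_integrable p1|exact: pcw_integrable k1].
by rewrite k2 big_cons RintegralZr//; exact: pcw_integrable (h1 i).
Qed.

Lemma vint01_prim f g : is_primitive01 f g -> pcV g -> vint01 g = f 1 - f 0.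
Proof.
move=> /prim01_rlin[E h1] pg; apply: rlin_ext => l hl.
have [c [E' [B [p e ->]]]] := vint01_rlin pg hl.
have [cf df] := h1 l hl; rewrite rlinB//.
apply: (FTC2_pcw (E := E ++ E') (B := B) (f := l \o f)) => //.
  by apply: pcw_sub p => // x; rewrite mem_cat orbC => ->.
by move=> t ht; rewrite mem_cat negb_or => /andP[tE tE']; rewrite -e//; exact: df.
Qed.

Lemma vint01_eq E g g' : pcV g ->
  (forall t, 0 < t < 1 -> t \notin E -> g t = g' t) -> vint01 g = vint01 g'.
Proof.
move=> [E' [B [I [e [c [h1 h2]]]]]] eg.
have h1' i : pcw 0 1 (E ++ E') B (c i).
  by apply: pcw_sub (h1 i) => // x; rewrite mem_cat orbC => ->.
rewrite (pcV_vint01 h1 h2) (pcV_vint01 (g := g') (e := e) h1')// => t ht.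
by rewrite mem_cat negb_or => /andP[tE tE']; rewrite -eg// h2.
Qed.

Lemma vint01D g g' : pcV g -> pcV g' ->
  vint01 (fun t => g t + g' t) = vint01 g + vint01 g'.
Proof.
move=> pg pg'; have [f [hf _]] := prim01_exists 0 pg in01_0.
have [f' [hf' _]] := prim01_exists 0 pg' in01_0.
rewrite (vint01_prim (prim01D hf hf') (pcVD pg pg')) (vint01_prim hf pg) (vint01_prim hf' pg').
by rewrite opprD addrACA.
Qed.

End Prim.

Lemma prim01_lin (V W : lmodType R[i]) (phi : V -> W) f g : linear phi ->
  is_primitive01 f g -> is_primitive01 (phi \o f) (phi \o g).
Proof.
move=> pl /prim01P[E [I [e [c [d [h1 h2 h3]]]]]]; apply/prim01P.
exists E, I, (phi \o e), c, d; split => //.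
  by move=> t ht; rewrite /= h1// lin_fcomb.
move=> t ht tE; have [h4 h5] := h3 t ht tE; split => //.
by rewrite /= -h5 lin_fcomb.
Qed.

Lemma pcV_lin (V W : lmodType R[i]) (phi : V -> W) g : linear phi -> pcV g -> pcV (phi \o g).
Proof.
move=> pl [E [B [I [e [c [h1 h2]]]]]]; exists E, B, I, (phi \o e), c; split => //.
by move=> t ht tE; rewrite /= h2// lin_fcomb.
Qed.

Lemma vint01_lin (V W : lmodType R[i]) (phi : V -> W) g : linear phi -> pcV g ->
  vint01 (phi \o g) = phi (vint01 g).
Proof.
move=> pl pg; have [f [hf _]] := prim01_exists 0 pg in01_0.
rewrite (vint01_prim (prim01_lin pl hf) (pcV_lin pl pg)) (vint01_prim hf pg).
by rewrite (linB pl).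
Qed.

Lemma pcV_bilin (U V W : lmodType R[i]) (op : U -> V -> W) g g' : bilin op ->
  pcV g -> pcV g' -> pcV (fun t => op (g t) (g' t)).
Proof.
move=> ob [E [B [I [e [c [h1 h2]]]]]] [E' [B' [I' [e' [c' [h1' h2']]]]]].
exists (E ++ E'), (B * B'), (I * I')%type, (fun p => op (e p.1) (e' p.2)),
  (fun p t => c p.1 t * c' p.2 t); split; first by move=> p; exact: pcwM.
move=> t ht; rewrite mem_cat negb_or => /andP[tE tE'].
by rewrite h2// h2'// fcomb_bilin.
Qed.

Lemma prim01_bilin (U V W : lmodType R[i]) (op : U -> V -> W) f g f' g' : bilin op ->
  is_primitive01 f g -> is_primitive01 f' g' ->
  is_primitive01 (fun t => op (f t) (f' t)) (fun t => op (g t) (f' t) + op (f t) (g' t)).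
Proof.
move=> ob /prim01P[E [I [e [c [d [h1 h2 h3]]]]]].
move=> /prim01P[E' [J [e' [c' [d' [h1' h2' h3']]]]]]; apply/prim01P.
exists (E ++ E'), (I * J)%type, (fun p => op (e p.1) (e' p.2)),
  (fun p t => c p.1 t * c' p.2 t),
  (fun p t => d p.1 t * c' p.2 t + c p.1 t * d' p.2 t); split.
- by move=> t ht; rewrite h1// h1'// fcomb_bilin.
- by move=> p x; apply: continuousM; [exact: h2|exact: h2'].
move=> t ht; rewrite mem_cat negb_or => /andP[tE tE'].
have [h4 h6] := h3 t ht tE; have [h5 h7] := h3' t ht tE'; split.
  move=> p; have h8 := h4 p.1; have h9 := h5 p.2.
  exact: is_derive_mul.
have t01 : 0 <= t <= 1 by case/andP: ht => *; rewrite !ltW.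
rewrite -h6 -h7 (h1 t t01) (h1' t t01) !(fcomb_bilin _ _ _ _ ob).
exact/esym/(fcombDl (fun p : I * J => op (e p.1) (e' p.2)) (fun p => d p.1 t * c' p.2 t) (fun p => c p.1 t * d' p.2 t)).
Qed.

End FiniteCombinations.

(** * Stokes' formula near a point of the square *)

Section ScalarStokes.
Variable R : realType.
Local Notation mu := (@lebesgue_measure R).
Local Notation sq := (@square R).
Implicit Types (u s p q : R) (y : R * R).

Lemma derive_quotient (f : R -> R) (a d : R) : is_derive a 1 f d ->
  (f s - f a) / (s - a) @[s --> a^'] --> d.
Proof.
move=> [+ <-]; rewrite /derivable /derive => h.
have h' : (fun k => k^-1 *: ((f \o shift a) (k *: 1) - f a)) @ 0^' -->
   lim ((fun k => k^-1 *: ((f \o shift a) (k *: 1) - f a)) @ 0^') by [].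
have sh : s - a @[s --> a^'] --> (0 : R)^'.
  move=> A [r /= r0 hA]; exists r => //= z hz za; apply: hA.
    by rewrite /= sub0r normrN distrC.
  by rewrite subr_eq0.
have := cvg_comp _ _ sh h'; apply: cvg_trans; apply: near_eq_cvg.
near=> s; rewrite /= /GRing.scale/= mulr1 subrK mulrC//.
Unshelve. all: by end_near. Qed.

Variable cs : seq (R * R * R).
(** A triple [(a, b, c)] codes the line [a u + b s = c]. A derivative in u is safe off the lines
    that a horizontal displacement crosses, those with [a] nonzero; [reg2] is the analogue for s. *)
Definition reg1 y := forall e, e \in cs -> e.1.1 != 0 -> e.1.1 * y.1 + e.1.2 * y.2 != e.2.
Definition reg2 y := forall e, e \in cs -> e.1.2 != 0 -> e.1.1 * y.1 + e.1.2 * y.2 != e.2.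
(** Abscissae at which the row of height [s] meets the lines that it crosses. *)
Definition bad1 s := [seq (e.2 - e.1.2 * s) / e.1.1 | e : R * R * R <- cs & e.1.1 != 0].
Definition bad2 u := [seq (e.2 - e.1.1 * u) / e.1.2 | e : R * R * R <- cs & e.1.2 != 0].
(** Heights of the horizontal lines: a row at such a height may run along an edge, where vertical
    derivatives can fail on a whole interval. *)
Definition levels := [seq e.2 / e.1.2 | e : R * R * R <- cs & e.1.1 == 0].

Lemma reg1P u s : u \notin bad1 s -> reg1 (u, s).
Proof.
move=> h e ec e0 /=; apply: contraNneq h => he; apply/mapP; exists e.
  by rewrite mem_filter e0.
by rewrite -he addrK mulrC mulKf.
Qed.

Lemma reg2P u s : s \notin bad2 u -> reg2 (u, s).
Proof.
move=> h e ec e0 /=; apply: contraNneq h => he; apply/mapP; exists e.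
  by rewrite mem_filter e0.
by rewrite -he addrC addKr mulrC mulKf.
Qed.

(** A line is either horizontal, and then avoided by the choice of the height, or crossed by the
    row, and then avoided off [bad1 s]. So on such a row vertical derivatives are safe off a finite
    set. *)
Lemma reg2_level u s : s \notin levels -> u \notin bad1 s -> reg2 (u, s).
Proof.
move=> hs hu e ec e0; have [e1|e1] := eqVneq e.1.1 0; last exact: (reg1P hu).
rewrite /= e1 mul0r add0r; apply: contraNneq hs => he; apply/mapP; exists e.
  by rewrite mem_filter e1 eqxx.
by rewrite -he mulrC mulKf.
Qed.

(** [Y1] and [Y2] are the partial derivatives where these exist. One constant bounds the three
    functions, to serve for domination. *)
Record nice (N : set (R * R)) (B : R) (Y Y1 Y2 : R * R -> R) : Prop := Nice {
  nice0 : forall y, N y -> sq y ->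
    `|Y y| <= B /\ Y x @[x --> within sq (nbhs y)] --> Y y;
  nice1 : forall y, N y -> sq y -> reg1 y -> 0 < y.1 < 1 ->
    [/\ is_derive y.1 1 (fun u => Y (u, y.2)) (Y1 y), `|Y1 y| <= B
      & Y1 x @[x --> within sq (nbhs y)] --> Y1 y];
  nice2 : forall y, N y -> sq y -> reg2 y -> 0 < y.2 < 1 ->
    [/\ is_derive y.2 1 (fun s => Y (y.1, s)) (Y2 y), `|Y2 y| <= B
      & Y2 x @[x --> within sq (nbhs y)] --> Y2 y] }.

Section Local.
Variables (p q s0 eta B : R).
Hypotheses (pq : p < q) (p0 : 0 <= p) (q1 : q <= 1) (s01 : 0 < s0 < 1)
  (eta0 : 0 < eta) (s0l : s0 \notin levels).
Let N : set (R * R) := [set y | p <= y.1 <= q /\ `|y.2 - s0| < eta].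
Variables (phi phi1 phi2 x x1 x2 : R * R -> R).
Hypotheses (nphi : nice N B phi phi1 phi2) (nx : nice N B x x1 x2).
Variables (W W1 : R -> R -> R) (bp bq : R).
Hypotheses
  (Wc : \forall s \near s0, {within `[0, 1], continuous (W s)})
  (WB : \forall s \near s0, forall u, 0 <= u <= 1 -> `|W s u| <= B)
  (Wd : \forall s \near s0, forall u, 0 < u < 1 -> u \notin bad1 s ++ bad1 s0 ->
     is_derive u 1 (W s) (W1 s u))
  (W1c : \forall s \near s0, pcw 0 1 (bad1 s ++ bad1 s0) B (W1 s))
  (Wl : forall u, 0 <= u <= 1 -> W s u @[s --> s0] --> W s0 u)
  (W1l : forall u, 0 < u < 1 -> u \notin bad1 s0 -> W1 s u @[s --> s0] --> W1 s0 u).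
Hypotheses
  (hbp : (x (p, s) - x (p, s0)) / (s - s0) @[s --> s0^'] --> bp)
  (hbq : (x (q, s) - x (q, s0)) / (s - s0) @[s --> s0^'] --> bq).

Let B0 : 0 <= B.
Proof.
have [|//|h _] := nphi.(nice0) (y := (p, s0)).
- by split; rewrite /= ?subrr ?normr0// lexx ltW.
- have /andP[h1 h2] := s01.
  by split; rewrite /= in_itv/= ?p0 ?(le_trans (ltW pq) q1)// !ltW.
exact: le_trans h.
Qed.

Let near_s : \forall s \near s0, 0 < s < 1 /\ `|s - s0| < eta.
Proof.
have /andP[h1 h2] := s01; near=> s; split.
  by apply/andP; split; near: s; [exact: lt_nbhsr|exact: lt_nbhsl].
by rewrite distrC; near: s; apply: nbhsx_ballx.
Unshelve. all: by end_near. Qed.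

Let Nin u s : p <= u <= q -> `|s - s0| < eta -> N (u, s). Proof. by []. Qed.
Let sqin u s : p <= u <= q -> 0 < s < 1 -> sq (u, s).
Proof.
move=> /andP[h1 h2] /andP[h3 h4]; split; rewrite /= in_itv/=.
  by rewrite (le_trans p0 h1) (le_trans h2 q1).
by rewrite !ltW.
Qed.
Let s0eta : `|s0 - s0| < eta. Proof. by rewrite subrr normr0. Qed.
Let in01 u : p < u < q -> 0 < u < 1.
Proof. by move=> /andP[h1 h2]; rewrite (le_lt_trans p0 h1) (lt_le_trans h2 q1). Qed.
Let inpq u : p < u < q -> p <= u <= q.
Proof. by move=> /andP[h1 h2]; rewrite !ltW. Qed.

Lemma nice_slice_continuous Y Y1 Y2 s : nice N B Y Y1 Y2 -> 0 < s < 1 -> `|s - s0| < eta ->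
  {within `[p, q], continuous (fun u => Y (u, s))}.
Proof.
move=> n hs he; apply/subspace_continuousP => u /=; rewrite in_itv/= => hu.
have [_ h] := n.(nice0) (Nin hu he) (sqin hu hs).
apply: cvg_comp h => A hA.
have [C0 C1] : nbhs (u, s) [set y | sq y -> A y] /\ True by split.
have : (z, s) @[z --> u] --> (u, s).
  by apply: (@cvg_pair _ _ _ (nbhs u) (nbhs u) (nbhs s)); [exact: cvg_id|exact: cvg_cst].
move=> /(_ _ C0) /= h2.
change (nbhs u [set z | sq (z, s) -> A (z, s)]) in h2.
change (nbhs u [set z | `[p, q]%classic z -> A (z, s)]).
apply: filterS h2 => z /= h3; rewrite in_itv/= => hz; apply: h3; exact: sqin.
Qed.

Lemma nice_vertical_continuous Y Y1 Y2 u : nice N B Y Y1 Y2 -> p <= u <= q ->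
  forall s, 0 < s < 1 -> `|s - s0| < eta -> {for s, continuous (fun s => Y (u, s))}.
Proof.
move=> n hu s hs he.
have [_ h] := n.(nice0) (Nin hu he) (sqin hu hs).
apply: cvg_comp h => A hA.
have C0 : nbhs (u, s) [set y | sq y -> A y] by [].
have : (u, z) @[z --> s] --> (u, s).
  by apply: (@cvg_pair _ _ _ (nbhs s) (nbhs u) (nbhs s)); [exact: cvg_cst|exact: cvg_id].
move=> /(_ _ C0) /= h2.
change (nbhs s [set z | sq (u, z) -> A (u, z)]) in h2.
change (nbhs s [set z | A (u, z)]).
have /andP[h3 h4] := hs; near=> z.
have : sq (u, z) -> A (u, z) by near: z.
by apply; apply: sqin => //; apply/andP; split; near: z; [exact: lt_nbhsr|exact: lt_nbhsl].
Unshelve. all: by end_near. Qed.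

(** Difference quotients in s are bounded uniformly in [u] and [s], which dominates them in the
    limit. The mean value bound tolerates the finitely many heights in [bad2 u] at which the
    vertical derivative may fail. *)
Lemma nice_lipschitz Y Y1 Y2 u s : nice N B Y Y1 Y2 -> p <= u <= q ->
  0 < s < 1 -> `|s - s0| < eta -> `|Y (u, s) - Y (u, s0)| <= B * `|s - s0|.
Proof.
move=> n hu hs he.
have key a b : a <= b -> 0 < a -> b < 1 -> `|a - s0| < eta -> `|b - s0| < eta ->
    `|Y (u, b) - Y (u, a)| <= B * (b - a).
  move=> ab a0 b1 ae be.
  have hz z : a <= z <= b -> 0 < z < 1 /\ `|z - s0| < eta.
    move=> /andP[h1 h2]; rewrite (lt_le_trans a0 h1) (le_lt_trans h2 b1); split=> //.
    by move: ae be; rewrite !ltr_norml => /andP[? ?] /andP[? ?]; apply/andP; split; lra.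
  apply: (@mean_value_bound _ (bad2 u) (fun s => Y (u, s))) => //.
    apply: continuous_in_subspaceT => z /set_mem /=; rewrite in_itv/= => /hz[h1 h2].
    exact: (nice_vertical_continuous n).
  move=> z /andP[h1 h2] zb; have [|h3 h4] := hz z; first by rewrite !ltW.
  have [d bd _] := n.(nice2) (Nin hu h4) (sqin hu h3) (reg2P zb) h3.
  by split; [exact: (@ex_derive _ _ _ _ _ _ _ d)|rewrite (@derive_val _ _ _ _ _ _ _ d)].
have /andP[h1 h2] := hs; have /andP[h3 h4] := s01.
have [h|/ltW h] := leP s0 s.
  by rewrite (ger0_norm (x := s - s0)) ?subr_ge0//; exact: key.
rewrite distrC (distrC s) (ger0_norm (x := s0 - s)) ?subr_ge0//; exact: key.
Qed.

Let dq (Y : R * R -> R) s u := (Y (u, s) - Y (u, s0)) / (s - s0).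

Let dq_bound Y Y1 Y2 u s : nice N B Y Y1 Y2 -> p <= u <= q ->
  0 < s < 1 -> `|s - s0| < eta -> s != s0 -> `|dq Y s u| <= B.
Proof.
move=> n hu hs he ss; rewrite /dq normrM normfV ler_pdivrMr ?normr_gt0 ?subr_eq0//.
exact: (nice_lipschitz n hu hs he).
Qed.

Let dq_cvg Y Y1 Y2 u : nice N B Y Y1 Y2 -> p < u < q -> u \notin bad1 s0 ->
  dq Y s u @[s --> s0^'] --> Y2 (u, s0).
Proof.
move=> n hu ub.
have [d _ _] := n.(nice2) (Nin (inpq hu) s0eta) (sqin (inpq hu) s01) (reg2_level s0l ub) s01.
exact: derive_quotient d.
Qed.

Let slice_cont (Y : R * R -> R) u s : p < u < q -> 0 < s < 1 ->
  Y z @[z --> within sq (nbhs (u, s))] --> Y (u, s) ->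
  {for u, continuous (fun u => Y (u, s))}.
Proof.
move=> hu /andP[h1 h2]; apply: cvg_comp; apply: cvg_slice1; first exact: in01.
by rewrite !ltW.
Qed.

Let vert_cont (Y : R * R -> R) u : p < u < q ->
  Y z @[z --> within sq (nbhs (u, s0))] --> Y (u, s0) ->
  Y (u, s) @[s --> s0^'] --> Y (u, s0).
Proof.
move=> hu h; have /andP[u0 u1] := in01 hu; have /andP[h1 h2] := s01.
have : Y (u, s) @[s --> within `[0, 1] (nbhs s0)] --> Y (u, s0).
  by apply: (cvg_comp _ _ (cvg_slice2 _ _) h); rewrite ?ltW.
apply: cvg_trans => A.
change (nbhs s0 [set s | `[0, 1]%classic s -> A (Y (u, s))] -> nbhs s0 [set s | s != s0 -> A (Y (u, s))]).
move=> hA; near=> s => _.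
have : `[0, 1]%classic s -> A (Y (u, s)) by near: s.
by apply; rewrite /= in_itv/=; apply/andP; split; apply: ltW; near: s; [exact: lt_nbhsr|exact: lt_nbhsl].
Unshelve. all: by end_near. Qed.

(** [main] is the integrand that remains after integration by parts in u, [bnd] the boundary term,
    and [MB] the bound found factor by factor. *)
Let main s u := W s u * dq phi s u * x1 (u, s) -
  (W1 s u * phi (u, s0) + W s u * phi1 (u, s0)) * dq x s u.
Let bnd s := W s q * phi (q, s0) * dq x s q - W s p * phi (p, s0) * dq x s p.
Let lim_main u := W s0 u * phi2 (u, s0) * x1 (u, s0) -
  (W1 s0 u * phi (u, s0) + W s0 u * phi1 (u, s0)) * x2 (u, s0).
Let MB := B * B * B + (B * B + B * B) * B.

Let Wnear : \forall s \near s0, [/\ {within `[0, 1], continuous (W s)},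
  forall u, 0 <= u <= 1 -> `|W s u| <= B,
  forall u, 0 < u < 1 -> u \notin bad1 s ++ bad1 s0 -> is_derive u 1 (W s) (W1 s u)
  & pcw 0 1 (bad1 s ++ bad1 s0) B (W1 s)].
Proof. by near=> s; split; near: s. Unshelve. all: by end_near. Qed.

Lemma W_pcw s : {within `[0, 1], continuous (W s)} ->
  (forall u, 0 <= u <= 1 -> `|W s u| <= B) -> pcw p q [::] B (W s).
Proof.
move=> c b u hu _; have hu' := in01 hu; split.
  by apply: b; case/andP: hu' => *; rewrite !ltW.
by apply: (within_continuous_continuous ltr01 c); rewrite in_itv.
Qed.

Lemma nice_pcw Y Y1 Y2 s : nice N B Y Y1 Y2 -> 0 < s < 1 -> `|s - s0| < eta ->
  pcw p q [::] B (fun u => Y (u, s)).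
Proof.
move=> n hs he u hu _.
have [h1 h2] := n.(nice0) (Nin (inpq hu) he) (sqin (inpq hu) hs).
by split => //; exact: slice_cont h2.
Qed.

Lemma nice1_pcw Y Y1 Y2 s : nice N B Y Y1 Y2 -> 0 < s < 1 -> `|s - s0| < eta ->
  pcw p q (bad1 s) B (fun u => Y1 (u, s)).
Proof.
move=> n hs he u hu ub.
have [_ h1 h2] := n.(nice1) (Nin (inpq hu) he) (sqin (inpq hu) hs) (reg1P ub) (in01 hu).
by split => //; exact: slice_cont h2.
Qed.

Lemma nice2_pcw Y Y1 Y2 : nice N B Y Y1 Y2 ->
  pcw p q (bad1 s0) B (fun u => Y2 (u, s0)).
Proof.
move=> n u hu ub.
have [_ h1 h2] := n.(nice2) (Nin (inpq hu) s0eta) (sqin (inpq hu) s01) (reg2_level s0l ub) s01.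
by split => //; exact: slice_cont h2.
Qed.

Let dq_pcw Y Y1 Y2 s : nice N B Y Y1 Y2 -> 0 < s < 1 -> `|s - s0| < eta ->
  s != s0 -> pcw p q [::] B (dq Y s).
Proof.
move=> n hs he ss u hu _; split; first by apply: dq_bound n _ _ _ _ => //; exact: inpq.
have [_ h1] := nice_pcw n hs he hu (isT : u \notin [::]).
have [_ h2] := nice_pcw n s01 s0eta hu (isT : u \notin [::]).
rewrite /dq; apply: continuousM; last exact: cst_continuous.
exact: continuousB.
Qed.

Let main_pcw : \forall s \near s0^', exists E, pcw p q E MB (main s).
Proof.
have h1 : \forall s \near s0^', s != s0 by exact: nbhs_dnbhs_neq.
near=> s.
have [hs he] : 0 < s < 1 /\ `|s - s0| < eta by near: s; exact: nbhs_dnbhs near_s.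
have ss : s != s0 by near: s.
have [k1 k2 k3 k4] : [/\ {within `[0, 1], continuous (W s)},
  forall u, 0 <= u <= 1 -> `|W s u| <= B,
  forall u, 0 < u < 1 -> u \notin bad1 s ++ bad1 s0 -> is_derive u 1 (W s) (W1 s u)
  & pcw 0 1 (bad1 s ++ bad1 s0) B (W1 s)] by near: s; exact: nbhs_dnbhs Wnear.
have w := W_pcw k1 k2; have w1 := pcwS p0 q1 k4.
eexists; apply: pcwD; last apply: pcwN.
  by apply: pcwM; [apply: pcwM; [exact: w|exact: (dq_pcw nphi)]|exact: (nice1_pcw nx)].
apply: pcwM; last exact: (dq_pcw nx).
by apply: pcwD; apply: pcwM; [exact: w1|exact: (nice_pcw nphi)|exact: w|exact: (nice1_pcw nphi)].
Unshelve. all: by end_near. Qed.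

(** With dq the difference quotient in s, the quotient of [phi x1] equals dq phi times [x1] at
    height s, plus [phi] at height s0 times the u-derivative of dq x. The second term is integrated
    by parts against [W phi]. Only quotients of [phi] and [x] remain, never of [x1], and dominated
    convergence turns them into [phi2] and [x2]. *)
Lemma stokes_local :
  \int[mu]_(u in `[p, q])
     (W s u * ((phi (u, s) * x1 (u, s) - phi (u, s0) * x1 (u, s0)) / (s - s0)))
    @[s --> s0^'] -->
  W s0 q * phi (q, s0) * bq - W s0 p * phi (p, s0) * bp +
  \int[mu]_(u in `[p, q])
    (W s0 u * (phi2 (u, s0) * x1 (u, s0) - phi1 (u, s0) * x2 (u, s0)) -
     W1 s0 u * (phi (u, s0) * x2 (u, s0))).
Proof.
have h01 : 0 <= p <= 1 by rewrite p0 (le_trans (ltW pq) q1).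
have h01q : 0 <= q <= 1 by rewrite q1 (le_trans p0 (ltW pq)).
have ne : \forall s \near s0^', s != s0 by exact: nbhs_dnbhs_neq.
have [k1 k2 k3 k4] := nbhs_singleton Wnear.
have lp : pcw p q ((([::] ++ bad1 s0) ++ bad1 s0) ++ (((bad1 s0 ++ bad1 s0) ++ [::]) ++ ([::] ++ bad1 s0)) ++ bad1 s0) MB lim_main.
  apply: pcwD; last apply: pcwN.
    apply: pcwM; last exact: (nice1_pcw nx).
    by apply: pcwM; [exact: W_pcw|exact: (nice2_pcw nphi)].
  apply: pcwM; last exact: (nice2_pcw nx).
  apply: pcwD; apply: pcwM; [exact: (pcwS p0 q1 k4)|exact: (nice_pcw nphi)|exact: W_pcw|exact: (nice1_pcw nphi)].
have -> : \int[mu]_(u in `[p, q])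
    (W s0 u * (phi2 (u, s0) * x1 (u, s0) - phi1 (u, s0) * x2 (u, s0)) -
     W1 s0 u * (phi (u, s0) * x2 (u, s0))) = \int[mu]_(u in `[p, q]) lim_main u.
  by apply: eq_Rintegral => u _; rewrite /lim_main; ring.
have e : {near s0^', (fun s => \int[mu]_(u in `[p, q])
     (W s u * ((phi (u, s) * x1 (u, s) - phi (u, s0) * x1 (u, s0)) / (s - s0))))
   =1 (fun s => bnd s + \int[mu]_(u in `[p, q]) main s u)}.
  near=> s.
  have [hs he] : 0 < s < 1 /\ `|s - s0| < eta by near: s; exact: nbhs_dnbhs near_s.
  have ss : s != s0 by near: s.
  have [j1 j2 j3 j4] : [/\ {within `[0, 1], continuous (W s)},
    forall u, 0 <= u <= 1 -> `|W s u| <= B,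
    forall u, 0 < u < 1 -> u \notin bad1 s ++ bad1 s0 -> is_derive u 1 (W s) (W1 s u)
    & pcw 0 1 (bad1 s ++ bad1 s0) B (W1 s)] by near: s; exact: nbhs_dnbhs Wnear.
  have [E pm] : exists E, pcw p q E MB (main s) by near: s.
  (* The increment of [K] over [p, q] is [bnd s]; [K1] is its derivative off the bad abscissae of
     both rows. *)
  pose K u := W s u * phi (u, s0) * dq x s u.
  pose K1 u := (W1 s u * phi (u, s0) + W s u * phi1 (u, s0)) * dq x s u +
    W s u * phi (u, s0) * ((x1 (u, s) - x1 (u, s0)) / (s - s0)).
  have w := W_pcw j1 j2; have w1 := pcwS p0 q1 j4.
  have [E' [B' pK]] : exists E B, pcw p q E B K1.
    do 2 eexists; apply: pcwD; apply: pcwM.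
    - by apply: pcwD; apply: pcwM; [exact: w1|exact: (nice_pcw nphi)|exact: w|exact: (nice1_pcw nphi)].
    - exact: (dq_pcw nx).
    - by apply: pcwM; [exact: w|exact: (nice_pcw nphi)].
    apply: pcwM; last exact: pcw_cst.
    by apply: pcwD; [exact: (nice1_pcw nx)|apply: pcwN; exact: (nice1_pcw nx)].
  have iK : \int[mu]_(u in `[p, q]) K1 u = bnd s.
    rewrite (_ : bnd s = K q - K p)//.
    apply: (FTC2_pcw (E := bad1 s ++ bad1 s0 ++ E') (B := B')) => //; first exact: ltW.
    - by apply: pcw_sub pK => // z hz; rewrite !mem_cat hz !orbT.
    - have c1 : {within `[p, q], continuous (W s)}.
        apply: continuous_subspaceW j1 => z /=; rewrite !in_itv/= => /andP[h1 h2].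
        by rewrite (le_trans p0 h1) (le_trans h2 q1).
      have c2 := nice_slice_continuous nphi s01 s0eta.
      have c3 := nice_slice_continuous nx hs he.
      have c4 := nice_slice_continuous nx s01 s0eta.
      apply: within_mul; first exact: within_mul.
      apply: within_mul; first exact: within_sub.
      by move=> z; exact: cst_continuous.
    move=> u hu; rewrite !mem_cat !negb_or => /and3P[u1 u2 _].
    have dW := j3 u (in01 hu) (_ : u \notin bad1 s ++ bad1 s0).
    have {}dW := dW (_ : _); rewrite mem_cat negb_or u1 u2 in dW; have {}dW := dW isT.
    have [dphi _ _] := nphi.(nice1) (Nin (inpq hu) s0eta) (sqin (inpq hu) s01) (reg1P u2) (in01 hu).
    have [dx _ _] := nx.(nice1) (Nin (inpq hu) he) (sqin (inpq hu) hs) (reg1P u1) (in01 hu).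
    have [dx0 _ _] := nx.(nice1) (Nin (inpq hu) s0eta) (sqin (inpq hu) s01) (reg1P u2) (in01 hu).
    have dy := is_derive_mul (is_deriveB dx dx0) (is_derive_cst (s - s0)^-1 u 1).
    have := is_derive_mul (is_derive_mul dW dphi) dy.
    by rewrite /= mulr0 addr0.
  rewrite -iK -RintegralD//; [|exact: pcw_integrable pK|exact: pcw_integrable pm].
  by apply: eq_Rintegral => u _; rewrite /K1 /main /dq; ring.
have c1 : bnd s @[s --> s0^'] --> W s0 q * phi (q, s0) * bq - W s0 p * phi (p, s0) * bp.
  by apply: cvgB; apply: cvgM => //; apply: cvgM;
    [apply: cvg_within_filter; exact: Wl|exact: cvg_cst|apply: cvg_within_filter; exact: Wl|exact: cvg_cst].
suff c2 : \int[mu]_(u in `[p, q]) main s u @[s --> s0^'] -->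
    \int[mu]_(u in `[p, q]) lim_main u.
  apply: cvg_trans (cvgD c1 c2); apply: near_eq_cvg.
  by apply: filterS e => s /= h; exact: esym h.
(* [dct] takes the exceptional list as a function of [s], so one is chosen for each row. *)
have [F hF] : exists F : R -> seq R, \forall s \near s0^', pcw p q (F s) MB (main s).
  have : forall s, exists E, (exists E, pcw p q E MB (main s)) -> pcw p q E MB (main s).
    move=> s; have [[E h]|n] := pselect (exists E, pcw p q E MB (main s)); first by exists E.
    by exists [::] => /n.
  move=> /choice[F hF]; exists F; apply: filterS main_pcw => s; exact: hF.
apply: (dct (E := F) (E0 := bad1 s0) (ltW pq) hF lp) => u hu ub.
have cW : W s u @[s --> s0^'] --> W s0 u.
  by apply: cvg_within_filter; apply: Wl; case/andP: (in01 hu) => *; rewrite !ltW.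
have cW1 : W1 s u @[s --> s0^'] --> W1 s0 u.
  by apply: cvg_within_filter; apply: W1l => //; exact: in01.
have [_ _ cx1] := nx.(nice1) (Nin (inpq hu) s0eta) (sqin (inpq hu) s01) (reg1P ub) (in01 hu).
apply: cvgB.
  apply: cvgM; last exact: vert_cont.
  by apply: cvgM => //; exact: dq_cvg nphi _ _.
apply: cvgM; last exact: dq_cvg nx _ _.
by apply: cvgD; apply: cvgM => //; exact: cvg_cst.
Unshelve. all: by end_near. Qed.

End Local.

End ScalarStokes.

(** * Piecewise smooth maps of the square *)

Section ContinuouslyDifferentiable.
Variable R : realType.

Lemma near_seqP (T : topologicalType) (y : T) (I : eqType) (r : seq I) (Q : I -> T -> Prop) :
  (forall i, i \in r -> \forall z \near y, Q i z) ->
  \forall z \near y, forall i, i \in r -> Q i z.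
Proof.
elim: r => [|i r ih] h; first by apply: nearW.
have h1 := h i (mem_head _ _).
have h2 : \forall z \near y, forall i, i \in r -> Q i z.
  by apply: ih => j jr; apply: h; rewrite inE jr orbT.
apply: filterS2 h1 h2 => z q1 q2 j; rewrite inE => /orP[/eqP-> //|]; exact: q2.
Qed.

Lemma cvg_fsum (W : normedModType R) (T : Type) (F : set_system T) {FF : Filter F}
    (I : finType) (f : I -> T -> W) (l : I -> W) :
  (forall i, f i @ F --> l i) -> (fun z => \sum_i f i z) @ F --> \sum_i l i.
Proof.
move=> h; rewrite (_ : (fun z => _) = \sum_i f i); last by apply/funext => z; rewrite fct_sumE.
elim/big_ind2: _ => //; first exact: cvg_cst.
by move=> a x b y ha hb; exact: cvgD.
Qed.

Lemma near_all (T : topologicalType) (y : T) (Q : T -> Prop) :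
  (forall z, Q z) -> \forall z \near y, Q z.
Proof. by move=> h; apply: (@nearW _ (nbhs y) _ (nbhs_filter y)). Qed.

Lemma cvg_near_eq (T : Type) (F : set_system T) {FF : Filter F} (f g : T -> R) (k : R) :
  (\forall x \near F, f x = g x) -> f @ F --> k -> g @ F --> k.
Proof.
move=> e h.
exact: cvg_trans (near_eq_cvg e) h.
Qed.

Lemma near_gt (T : topologicalType) (f : T -> R) y a :
  f @ nbhs y --> f y -> a < f y -> \forall z \near y, a < f z.
Proof. by move=> /cvgr_gt; apply. Qed.

Lemma near_lt (T : topologicalType) (f : T -> R) y a :
  f @ nbhs y --> f y -> f y < a -> \forall z \near y, f z < a.
Proof. by move=> /cvgr_lt; apply. Qed.

Lemma near_line (U : normedModType R) (y v : U) (Q : U -> Prop) :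
  (\forall z \near y, Q z) -> \forall h \near (0 : R), Q (h *: v + y).
Proof.
have hline : (h *: v + y) @[h --> (0 : R)] --> y.
  rewrite -[X in _ --> X]add0r -[X in X + _](scale0r v).
  by apply: cvgD; [apply: cvgZl; exact: cvg_id|exact: cvg_cst].
by move=> /hline.
Qed.

Lemma cvg_fsumR (T : Type) (F : set_system T) {FF : Filter F}
    (I : finType) (f : I -> T -> R) (l : I -> R) :
  (forall i, f i @ F --> l i) -> (fun z => \sum_i f i z) @ F --> \sum_i l i.
Proof. exact: cvg_fsum. Qed.

(** Only first derivatives of Γ are ever used, and this form of smoothness survives composition with
    a change of chart. *)
Definition C1at (U W : normedModType R) (g : U -> W) (y : U) :=
  (\forall z \near y, differentiable g z) /\
  forall v, {for y, continuous (fun z => 'D_v g z)}.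

Lemma smooth_C1at (U W : normedModType R) (A : set U) (f : U -> W) y :
  open A -> smooth_on A f -> A y -> C1at f y.
Proof.
move=> oA sf Ay; split.
  have : nbhs y A by exact: open_nbhs_nbhs.
  by apply: filterS => z; exact: (sf [::]).
move=> v; apply: differentiable_continuous; exact: (sf [:: v]).
Qed.

Lemma C1at_continuous (U W : normedModType R) (g : U -> W) y :
  C1at g y -> {for y, continuous g}.
Proof. by move=> [h _]; apply/differentiable_continuous/(nbhs_singleton h). Qed.

Lemma C1at_coord d (j : 'I_d) (y : 'rV[R]_d) : C1at (fun z : 'rV[R]_d => z ord0 j) y.
Proof.
split; first by apply: (@nearW _ (nbhs y) _ (nbhs_filter y)) => z; exact: differentiable_coord.
move=> v; rewrite (_ : (fun z => _) = cst (v ord0 j)); first exact: cst_continuous.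
apply/funext => z; rewrite deriveE; last exact: differentiable_coord.
have lc : linear (fun z : 'rV[R]_d => z ord0 j : R) by move=> a x w; rewrite !mxE.
pose l := GRing.isLinear.Build R 'rV[R]_d R *:%R (fun z : 'rV[R]_d => z ord0 j) lc.
pose L : {linear 'rV[R]_d -> R} := HB.pack (fun z : 'rV[R]_d => z ord0 j) l.
by rewrite (@diff_lin _ _ _ L)//; exact: coord_continuous.
Qed.

Lemma C1at_sum (U : normedModType R) n (f : 'I_n -> U -> R) (k : 'I_n -> R) z :
  (forall i, C1at (f i) z) -> C1at (fun x => \sum_i f i x * k i) z.
Proof.
move=> hf; rewrite (_ : (fun x => _) = \sum_i (k i *: f i)); last first.
  by apply/funext => x; rewrite fct_sumE; apply: eq_bigr => i _; rewrite mulrC.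
have nd : \forall z' \near z, forall i, i \in enum 'I_n -> differentiable (f i) z'.
  by apply: near_seqP => i _; have [] := hf i.
have nd' : \forall z' \near z, forall i, differentiable (f i) z'.
  by apply: filterS nd => z' h i; apply: h; rewrite mem_enum.
split.
  apply: filterS nd' => z' h; apply: differentiable_sum => i.
  exact: differentiableZ.
move=> v; pose D z' := \sum_i k i * 'D_v (f i) z'.
have eD : {near z, D =1 'D_v (\sum_i (k i *: f i))}.
  apply: filterS nd' => z' h; rewrite /D derive_sum; last first.
    by move=> i; apply: derivableZ; exact: diff_derivable.
  by apply: eq_bigr => i _; rewrite deriveZ//; exact: diff_derivable.
have eD' : {near z, 'D_v (\sum_i (k i *: f i)) =1 D} by apply: filterS eD => z' ->.
have cD : D @ nbhs z --> D z.
  by apply: cvg_fsum => i; apply: cvgM; [exact: cvg_cst|exact: (hf i).2].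
rewrite /prop_for /continuous_at -(nbhs_singleton eD : D z = _).
exact: cvg_trans (near_eq_cvg eD) cD.
Qed.

Lemma deriv_comp (U W : normedModType R) d (f : 'rV[R]_d -> W) (g : U -> 'rV[R]_d) y v :
  differentiable g y -> differentiable f (g y) ->
  'D_v (f \o g) y = 'D_('D_v g y) f (g y).
Proof.
move=> dg df; rewrite deriveE; last exact: differentiable_comp.
by rewrite diff_comp//= deriveE// deriveE.
Qed.

Lemma derive_rowE (W : normedModType R) d (f : 'rV[R]_d -> W) z (w : 'rV[R]_d) :
  differentiable f z -> 'D_w f z = \sum_j w ord0 j *: 'D_(delta_mx ord0 j) f z.
Proof.
move=> df; rewrite deriveE// [in LHS](row_sum_delta w) linear_sum.
by apply: eq_bigr => j _; rewrite linearZ -deriveE.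
Qed.

Lemma C1at_comp (U W : normedModType R) d (f : 'rV[R]_d -> W) (g : U -> 'rV[R]_d) y :
  C1at g y -> C1at f (g y) -> C1at (f \o g) y.
Proof.
move=> Cg Cf; have gc := C1at_continuous Cg.
have nd : \forall z \near y, differentiable g z /\ differentiable f (g z).
  have h : \forall z \near y, differentiable f (g z) by exact: (gc _ Cf.1).
  by apply: filterS2 Cg.1 h.
split; first by apply: filterS nd => z [h1 h2]; exact: differentiable_comp.
move=> v.
(* The chain rule is expanded in coordinates: the direction ['D_v g z] moves with [z], whereas
   continuity of the derivatives of [f] is known for fixed directions. *)
pose F z := \sum_j ('D_v g z) ord0 j *: 'D_(delta_mx ord0 j) f (g z).
have e : {near y, 'D_v (f \o g) =1 F}.
  by apply: filterS nd => z [h1 h2]; rewrite deriv_comp// derive_rowE.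
have e' : {near y, F =1 'D_v (f \o g)} by apply: filterS e => z /= ->.
suff cF : F @ nbhs y --> F y.
  rewrite /prop_for /continuous_at (nbhs_singleton e : 'D_v (f \o g) y = F y).
  exact: cvg_trans (near_eq_cvg e') cF.
apply: cvg_fsum => j.
apply: cvgZ; last first.
  apply: (@cvg_comp _ _ _ g ('D_(delta_mx ord0 j) f)); first exact: gc.
  exact: Cf.2.
apply: (@cvg_comp _ _ _ ('D_v g) (fun w : 'rV[R]_d => w ord0 j)); first exact: Cg.2.
exact: coord_continuous.
Qed.

(* A directional derivative only sees the values along the line. *)
Lemma derive_line (U W : normedModType R) (Y g : U -> W) y v :
  (\forall h \near (0 : R), Y (h *: v + y) = g (h *: v + y)) ->
  derivable g y v -> derivable Y y v /\ 'D_v Y y = 'D_v g y.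
Proof.
move=> e dg; have e0 : Y y = g y by have := nbhs_singleton e; rewrite scale0r add0r.
have E : {near (0 : R)^', (fun h => h^-1 *: ((g \o shift y) (h *: v) - g y)) =1
                         (fun h => h^-1 *: ((Y \o shift y) (h *: v) - Y y))}.
  by apply: nbhs_dnbhs; apply: filterS e => h /= ->; rewrite e0.
have E' : {near (0 : R)^', (fun h => h^-1 *: ((Y \o shift y) (h *: v) - Y y)) =1
                         (fun h => h^-1 *: ((g \o shift y) (h *: v) - g y))}.
  by apply: filterS E => h ->.
have c : (fun h => h^-1 *: ((Y \o shift y) (h *: v) - Y y)) @ 0^' --> 'D_v g y.
  exact: cvg_trans (near_eq_cvg E) dg.
split; first by apply/cvg_ex; exists ('D_v g y).
exact: cvg_lim c.
Qed.

Lemma derivable_comp_line (U W : normedModType R) (Y : U -> W) (k : R -> U) y v a :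
  (forall h, k (h + a) = h *: v + y) ->
  (derivable Y y v <-> derivable (Y \o k) a 1) /\ 'D_v Y y = 'D_1 (Y \o k) a.
Proof.
move=> e.
have E : (fun h => h^-1 *: ((Y \o shift y) (h *: v) - Y y)) =
         (fun h => h^-1 *: (((Y \o k) \o shift a) (h *: 1) - (Y \o k) a)).
  apply/funext => h /=; have -> : h%:A = h :> R by exact: mulr1.
  rewrite e.
  by have := e 0; rewrite scale0r !add0r => ->.
by rewrite /derivable /derive E.
Qed.

Lemma slice1_line (W : normedModType R) (Y : R * R -> W) u s :
  (derivable Y (u, s) (1, 0) <-> derivable (fun u => Y (u, s)) u 1) /\
  'D_((1, 0) : R * R) Y (u, s) = 'D_1 (fun u => Y (u, s)) u.
Proof.
apply: (derivable_comp_line Y (k := fun u => (u, s))) => h.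
by congr (_, _); rewrite /= /GRing.scale/= ?mulr1 ?mulr0 ?add0r.
Qed.

Lemma slice2_line (W : normedModType R) (Y : R * R -> W) u s :
  (derivable Y (u, s) (0, 1) <-> derivable (fun s => Y (u, s)) s 1) /\
  'D_((0, 1) : R * R) Y (u, s) = 'D_1 (fun s => Y (u, s)) s.
Proof.
apply: (derivable_comp_line Y (k := fun s => (u, s))) => h.
by congr (_, _); rewrite /= /GRing.scale/= ?mulr1 ?mulr0 ?add0r.
Qed.

End ContinuouslyDifferentiable.

(** * Moving inside a polygon along a direction *)

Section PolygonCover.
Variable R : realType.
Implicit Types (E : seq (R * R * R)) (y v : R * R).

(** [y] is off every line that the direction [v] crosses, but may lie on a line parallel to [v]. *)
Definition regv (cs : seq (R * R * R)) v y := forall e, e \in cs ->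
  e.1.1 * v.1 + e.1.2 * v.2 != 0 -> e.1.1 * y.1 + e.1.2 * y.2 != e.2.

Lemma reg1_regv cs y : reg1 cs y -> regv cs (1, 0) y.
Proof. by move=> h e ec; rewrite /= mulr1 mulr0 addr0; exact: h. Qed.
Lemma reg2_regv cs y : reg2 cs y -> regv cs (0, 1) y.
Proof. by move=> h e ec; rewrite /= mulr1 mulr0 add0r; exact: h. Qed.

Lemma constraint_continuous (e : R * R * R) y :
  {for y, continuous (fun z : R * R => e.1.1 * z.1 + e.1.2 * z.2)}.
Proof.
apply: continuousD; apply: continuousM; try exact: cst_continuous.
  exact: cvg_fst.
exact: cvg_snd.
Qed.

Lemma polygon_compl E y : ~ polygon E y -> \forall z \near y, ~ polygon E z.
Proof.
move=> h; have [e [eE he]] : exists e, e \in E /\ e.2 < e.1.1 * y.1 + e.1.2 * y.2.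
  apply: contrapT => n; apply: h => e eE; rewrite leNgt; apply/negP => lt.
  by apply: n; exists e.
have := near_gt (@constraint_continuous e y) he.
by apply: filterS => z /= lt /(_ e eE); rewrite leNgt lt.
Qed.

Lemma regv_near cs v y : regv cs v y -> \forall z \near y, regv cs v z.
Proof.
move=> h; apply: near_seqP => e ec.
have [e0|e0] := eqVneq (e.1.1 * v.1 + e.1.2 * v.2) 0.
  by apply: near_all.
have /orP[lt|lt] : (e.1.1 * y.1 + e.1.2 * y.2 < e.2) || (e.2 < e.1.1 * y.1 + e.1.2 * y.2).
- by rewrite -neq_lt; exact: h.
- by apply: filterS (near_lt (@constraint_continuous e y) lt) => z /= l _; rewrite lt_eqF.
- by apply: filterS (near_gt (@constraint_continuous e y) lt) => z /= l _; rewrite gt_eqF.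
Qed.

(** Each constraint is constant along [v] or strict at [y]. Hence a derivative along [v] sees a
    single polygon, even when [y] is on an edge. *)
Lemma regv_stay cs E v y : {subset E <= cs} -> regv cs v y -> polygon E y ->
  \forall h \near (0 : R), polygon E (h *: v + y).
Proof.
move=> Ec r pE; rewrite /polygon /=; apply: (near_seqP (Q := fun e (h : R) =>
  e.1.1 * (h *: v + y).1 + e.1.2 * (h *: v + y).2 <= e.2)) => e eE.
have ex h : e.1.1 * (h *: v + y).1 + e.1.2 * (h *: v + y).2 =
   (e.1.1 * y.1 + e.1.2 * y.2) + h * (e.1.1 * v.1 + e.1.2 * v.2).
  by rewrite /= /GRing.scale/=; ring.
have [e0|e0] := eqVneq (e.1.1 * v.1 + e.1.2 * v.2) 0.
  by apply: near_all => h; rewrite ex e0 mulr0 addr0; exact: pE.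
have lt : (e.1.1 * y.1 + e.1.2 * y.2) + 0 * (e.1.1 * v.1 + e.1.2 * v.2) < e.2.
  by rewrite mul0r addr0 lt_neqAle (r e (Ec _ eE) e0) pE.
have c : {for 0, continuous (fun h : R => (e.1.1 * y.1 + e.1.2 * y.2) + h * (e.1.1 * v.1 + e.1.2 * v.2))}.
  apply: continuousD; first exact: cst_continuous.
  by apply: continuousM => //; exact: cst_continuous.
have := near_lt c lt.
by apply: filterS => h; rewrite ex; exact: ltW.
Qed.

End PolygonCover.

(** * Derivatives of a map that is smooth on each polygon *)

Section PiecewiseSmoothMap.
Variables (R : realType) (M : manifold R) (G : R * R -> M) (P : seq (seq (R * R * R))).
Local Notation sq := (@square R).
Local Notation vec := 'rV[R]_(mdim M).
Hypotheses (Gc : {within sq, continuous G})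
  (Pcov : forall y, sq y -> exists2 E, E \in P & polygon E y)
  (Psub : forall E, E \in P -> polygon E `<=` sq)
  (Psm : forall E, E \in P -> smooth_into (polygon E) G).
Let cs := flatten P.

Let subcs E : E \in P -> {subset E <= cs}.
Proof. by move=> EP e eE; apply/flattenP; exists E. Qed.

Lemma cont_point (T : topologicalType) (U : topologicalType) (A : set T) (f : T -> U) x :
  open A -> A x -> {within A, continuous f} -> {for x, continuous f}.
Proof.
by move=> oA Ax; rewrite continuous_open_subspace// => h; apply: h; rewrite inE.
Qed.

Lemma overlap_open (c c' : chart R M (mdim M)) : matlas c -> matlas c' ->
  open (cmap c' @` (cdom c' `&` cdom c)).
Proof.
move=> cA c'A; rewrite openE => _ [p [h1 h2] <-].
have o := @cimg_open _ _ _ c'; have im : (cmap c' @` cdom c') (cmap c' p) by exists p.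
have cc : {for cmap c' p, continuous (cinv c')} := cont_point o im (cinv_cont (c := c')).
have n1 : \forall z \near cmap c' p, cdom c (cinv c' z).
  by apply: cc; rewrite cmapK//; apply: open_nbhs_nbhs; split => //; exact: cdom_open.
have n2 : \forall z \near cmap c' p, (cmap c' @` cdom c') z by exact: open_nbhs_nbhs.
rewrite /interior; apply: filterS2 n1 n2 => z h3 [p' h4 e].
by exists p' => //; split => //; rewrite -(cmapK h4) e.
Qed.

Lemma chart_domain_near (c : chart R M (mdim M)) y0 : sq y0 -> cdom c (G y0) ->
  \forall y \near y0, sq y -> cdom c (G y).
Proof.
move=> sy h; have /subspace_continuousP/(_ _ sy) Gy := Gc.
apply: Gy; apply: open_nbhs_nbhs; split => //; exact: cdom_open.
Qed.

Section Local.
Variables (W : normedModType R) (c : chart R M (mdim M)) (f : vec -> W).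
Hypotheses (cA : matlas c) (fC : forall z, cimg c z -> C1at f z).
Let Y y := f (cmap c (G y)).

(** [smooth_into] extends Γ in a chart of its own choice; the transition map carries the extension
    to the prescribed chart [c]. Chart overlaps are open, so this works in a whole neighbourhood of
    [y0]. *)
Lemma local_extension E y0 : E \in P -> polygon E y0 -> cdom c (G y0) ->
  exists g : R * R -> W, \forall y \near y0,
    C1at g y /\ (polygon E y -> cdom c (G y) /\ Y y = g y).
Proof.
move=> EP pE hc.
have [c' [N [g' [c'A oN Ny sN hN]]]] := Psm EP pE.
have [h1 h2] := hN _ Ny pE.
pose O := cmap c' @` (cdom c' `&` cdom c).
have oO : open O := overlap_open cA c'A.
have Oy : O (g' y0) by rewrite -h2; exists (G y0).
have NN : \forall y \near y0, N y by exact: open_nbhs_nbhs.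
have g'C y : N y -> C1at g' y by move=> Ny'; exact: smooth_C1at sN Ny'.
have nO : \forall y \near y0, O (g' y).
  by apply: (C1at_continuous (g'C _ Ny)); exact: open_nbhs_nbhs.
exists (f \o ((cmap c \o cinv c') \o g')); apply: filterS2 NN nO => y Ny1 Oy1.
have Ctau : C1at (cmap c \o cinv c') (g' y) := smooth_C1at oO (mcompat c'A cA) Oy1.
split.
  apply: C1at_comp; first exact: C1at_comp (g'C _ Ny1) Ctau.
  apply: fC => /=; have [p [hp1 hp2] <-] := Oy1.
  by exists p => //; rewrite cmapK.
move=> pEy; have [h3 h4] := hN _ Ny1 pEy.
rewrite /Y /= -h4 cmapK//; split => //.
by have [p [hp1 hp2] e] := Oy1; rewrite -(cmapK h3) h4 -e cmapK.
Qed.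

(** ['D_v Y y] does not depend on [E]: at a regular point the extensions from all polygons through
    [y] have the same derivative along [v]. *)
Lemma derive_at_reg E g y v : E \in P -> polygon E y -> regv cs v y ->
  (\forall z \near y, C1at g z /\ (polygon E z -> cdom c (G z) /\ Y z = g z)) ->
  derivable Y y v /\ 'D_v Y y = 'D_v g y.
Proof.
move=> EP pE r n.
apply: derive_line.
  have n' := near_line v n; have st := regv_stay (subcs EP) r pE.
  by apply: filterS2 n' st => h /= [_ h1] h2; have [] := h1 h2.
have [[d _] _] := nbhs_singleton n.
exact/diff_derivable/(nbhs_singleton d).
Qed.

Lemma derivable_reg v y : sq y -> cdom c (G y) -> regv cs v y -> derivable Y y v.
Proof.
move=> sy hc r; have [E EP pE] := Pcov sy.
have [g hg] := local_extension EP pE hc.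
by have [] := derive_at_reg EP pE r hg.
Qed.

(** Pasting over finitely many closed polygons: those that miss [y0] also miss a neighbourhood of
    it, and each of the others has a continuous extension with value [Y y0] at [y0]. *)
Lemma Y_continuous y0 : sq y0 -> cdom c (G y0) -> Y y @[y --> within sq (nbhs y0)] --> Y y0.
Proof.
move=> sy hc; apply/cvgrPdist_lt => e e0.
have h : \forall y \near y0, forall E, E \in P -> polygon E y -> `|Y y0 - Y y| < e.
  apply: near_seqP => E EP; have [pE|nE] := pselect (polygon E y0); last first.
    by apply: filterS (polygon_compl nE) => z.
  have [g hg] := local_extension EP pE hc.
  have [Cg /(_ pE)[_ e1]] := nbhs_singleton hg.
  have /cvgrPdist_lt/(_ _ e0) := C1at_continuous Cg.
  by rewrite -e1; apply: filterS2 hg => y [_ h1] h2 /h1[_ ->].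
change (nbhs y0 [set y | sq y -> `|Y y0 - Y y| < e]).
by apply: filterS h => y h1 /Pcov[E EP pE]; exact: h1 pE.
Qed.

Lemma dY_continuous v y0 : sq y0 -> cdom c (G y0) -> regv cs v y0 ->
  'D_v Y y @[y --> within sq (nbhs y0)] --> 'D_v Y y0.
Proof.
move=> sy hc r; apply/cvgrPdist_lt => e e0.
have h : \forall y \near y0, forall E, E \in P -> polygon E y -> `|'D_v Y y0 - 'D_v Y y| < e.
  apply: near_seqP => E EP; have [pE|nE] := pselect (polygon E y0); last first.
    by apply: filterS (polygon_compl nE) => z.
  have [g hg] := local_extension EP pE hc.
  have [Cg _] := nbhs_singleton hg.
  (* Regularity at [y0] gives the extensions from all polygons the same derivative there, so the
     limits from the different polygons agree. *)
  have [_ e1] := derive_at_reg EP pE r hg.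
  have /cvgrPdist_lt/(_ _ e0) := Cg.2 v; rewrite -e1 => h2.
  have hg' := nbhs_interior hg; have rn := regv_near r.
  near=> y => pEy.
  have [||_ ->] := @derive_at_reg E g y v EP pEy; first by near: y.
    by near: y.
  by near: y.
change (nbhs y0 [set y | sq y -> `|'D_v Y y0 - 'D_v Y y| < e]).
by apply: filterS h => y h1 /Pcov[E EP pE]; exact: h1 pE.
Unshelve. all: by end_near. Qed.

Lemma near_seq_bound (T : topologicalType) (y : T) (I : eqType) (r : seq I)
    (Q : I -> R -> T -> Prop) :
  (forall i b b' z, b <= b' -> Q i b z -> Q i b' z) ->
  (forall i, i \in r -> exists b, \forall z \near y, Q i b z) ->
  exists b, \forall z \near y, forall i, i \in r -> Q i b z.
Proof.
move=> mon; elim: r => [|i r ih] h; first by exists 0; apply: near_all.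
have [b1 h1] := h i (mem_head _ _).
have [b2 h2] : exists b, \forall z \near y, forall i, i \in r -> Q i b z.
  by apply: ih => j jr; apply: h; rewrite inE jr orbT.
exists (Num.max b1 b2); apply: filterS2 h1 h2 => z q1 q2 j; rewrite inE => /orP[/eqP->|jr].
  by apply: mon q1; rewrite le_max lexx.
by apply: mon (q2 j jr); rewrite le_max lexx orbT.
Qed.

(** [y0] may lie on an edge. Derivatives are bounded at the regular points near it, where each is
    the derivative of one of finitely many extensions. *)
Lemma dY_bound v y0 : sq y0 -> cdom c (G y0) -> exists B, \forall y \near y0,
  sq y -> `|Y y| <= B /\ (regv cs v y -> `|'D_v Y y| <= B).
Proof.
move=> sy hc.
have [B hB] : exists B, \forall y \near y0, forall E, E \in P -> polygon E y ->
    `|Y y| <= B /\ (regv cs v y -> `|'D_v Y y| <= B).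
  apply: near_seq_bound => [E b b' z bb h /h[h1 h2]|E EP].
    by split=> [|/h2 h3]; [exact: le_trans h1 bb|exact: le_trans h3 bb].
  have [pE|nE] := pselect (polygon E y0); last first.
    by exists 0; apply: filterS (polygon_compl nE) => z.
  have [g hg] := local_extension EP pE hc.
  have [Cg _] := nbhs_singleton hg.
  have n1 : \forall y \near y0, `|g y| < `|g y0| + 1.
    apply: (near_lt (f := fun y => `|g y|)); last by rewrite ltrDl.
    exact: cvg_norm (C1at_continuous Cg).
  have n2 : \forall y \near y0, `|'D_v g y| < `|'D_v g y0| + 1.
    apply: (near_lt (f := fun y => `|'D_v g y|)); last by rewrite ltrDl.
    exact: cvg_norm (Cg.2 v).
  exists ((`|g y0| + 1) + (`|'D_v g y0| + 1)).
  have hg' := nbhs_interior hg.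
  near=> y => pEy.
  have hy : \forall z \near y, C1at g z /\ (polygon E z -> cdom c (G z) /\ Y z = g z) by near: y.
  have [_ /(_ pEy)[_ ->]] := nbhs_singleton hy.
  split=> [|r].
    apply: (@le_trans _ _ (`|g y0| + 1)); first by apply: ltW; near: y.
    by rewrite lerDl addr_ge0.
  have [_ ->] := derive_at_reg EP pEy r hy.
  apply: (@le_trans _ _ (`|'D_v g y0| + 1)); first by apply: ltW; near: y.
  by rewrite lerDr addr_ge0.
exists B; by apply: filterS hB => y h1 /Pcov[E EP pE]; exact: h1 pE.
Unshelve. all: by end_near. Qed.

End Local.

Lemma derive_chart_change (c c0 : chart R M (mdim M)) v y : matlas c -> matlas c0 ->
  sq y -> cdom c (G y) -> cdom c0 (G y) -> regv cs v y ->
  'D_v (cmap c0 \o G) y =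
  'D_('D_v (cmap c \o G) y) (cmap c0 \o cinv c) (cmap c (G y)).
Proof.
move=> cA c0A sy hc hc0 r; have [E EP pE] := Pcov sy.
have idC z : cimg c z -> C1at (@idfun vec) z.
  move=> _; split; first by apply: (@nearW _ (nbhs z) _ (nbhs_filter z)).
  move=> w; rewrite (_ : (fun z => _) = cst w); first exact: cst_continuous.
  by apply/funext => z'; rewrite derive_id.
have [g hg] := local_extension cA idC EP pE hc.
have [_ e1] := derive_at_reg (c := c) (f := @idfun vec) EP pE r hg.
have e1' : 'D_v (cmap c \o G) y = 'D_v g y := e1.
have [Cg /(_ pE)[_ eg]] := nbhs_singleton hg.
have eg' : cmap c (G y) = g y := eg.
pose tau := cmap c0 \o cinv c.
have dtau : differentiable tau (g y).
  by apply: (mcompat cA c0A [::]); rewrite -eg'; exists (G y).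
have dg : differentiable g y := nbhs_singleton Cg.1.
rewrite e1' eg' -deriv_comp//.
have [] // := @derive_line R _ _ (cmap c0 \o G) (tau \o g) y v.
  have n' := near_line v hg; have st := regv_stay (subcs EP) r pE.
  apply: filterS2 n' st => h /= [_ h1] h2; have [h3 h4] := h1 h2.
  by rewrite /tau /= -(h4 : cmap c (G (h *: v + y)) = _) cmapK.
by apply: diff_derivable; exact: differentiable_comp.
Qed.

(** Compactness of the square in near-covering form, with the filter at +oo for the parameter, turns
    local bounds into a global one. *)
Lemma square_bound (Q : R * R -> Prop) (c : R * R -> R) :
  (forall y0, sq y0 -> exists B : R, \forall y \near y0, sq y -> Q y -> `|c y| <= B) ->
  exists B : R, 0 <= B /\ forall y, sq y -> Q y -> `|c y| <= B.
Proof.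
move=> h.
have cpt : compact sq by apply: compact_setX; exact: segment_compact.
have nc : near_covering sq by exact/compact_near_coveringP.
have FF : Filter (+oo : set_system R) by exact: filter_filter.
have [|b [_ hb]] := nc R (+oo : set_system R) (fun B y => sq y -> Q y -> `|c y| <= B) FF.
  move=> y0 sy; have [B hB] := h y0 sy.
  have hB' : \forall b \near +oo, B <= b by exact: nbhs_pinfty_ge (num_real _).
  exists ([set y | sq y -> Q y -> `|c y| <= B], [set b | B <= b]) => // -[y b] /= [h1 h2] s q.
  exact: le_trans (h1 s q) h2.
exists (Num.max 0 (b + 1)); split; first by rewrite le_max lexx.
move=> y sy qy; apply: (@le_trans _ _ (b + 1)); last by rewrite le_max lexx orbT.
by apply: (hb (b + 1)) => //; rewrite ltrDl.
Qed.

Section LocallyRegular.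
Variable Q : R * R -> Prop.
Hypothesis Qopen : forall y, Q y -> \forall z \near y, Q z.
Implicit Types (c : R * R -> R) (y : R * R).

(** The bound is asked near every point, regular or not, since the compactness argument needs it
    there; continuity is asked only at points of [Q]. *)
Definition lreg c y0 := (exists B, \forall y \near y0, sq y -> Q y -> `|c y| <= B) /\
  (sq y0 -> Q y0 -> c y @[y --> within sq (nbhs y0)] --> c y0).

Lemma lreg_cst k y0 : lreg (fun=> k) y0.
Proof.
by split=> [|_ _]; [exists `|k|; apply: near_all|exact: cvg_cst].
Qed.

Lemma lregD c c' y0 : lreg c y0 -> lreg c' y0 -> lreg (fun y => c y + c' y) y0.
Proof.
move=> [[B h1] h2] [[B' h3] h4]; split=> [|s q]; last by apply: cvgD; [exact: h2|exact: h4].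
exists (B + B'); apply: filterS2 h1 h3 => y k1 k2 s q.
by apply: (le_trans (ler_normD _ _)); apply: lerD; [exact: k1|exact: k2].
Qed.

Lemma lregM c c' y0 : lreg c y0 -> lreg c' y0 -> lreg (fun y => c y * c' y) y0.
Proof.
move=> [[B h1] h2] [[B' h3] h4]; split=> [|s q]; last by apply: cvgM; [exact: h2|exact: h4].
exists (B * B'); apply: filterS2 h1 h3 => y k1 k2 s q.
by rewrite normrM; apply: ler_pM => //; [exact: k1|exact: k2].
Qed.

Lemma lreg_sum (I : finType) (c : I -> R * R -> R) y0 :
  (forall i, lreg (c i) y0) -> lreg (fun y => \sum_i c i y) y0.
Proof.
move=> h; have : forall r : seq I, lreg (fun y => \sum_(i <- r) c i y) y0.
  elim=> [|i r ih].
    by rewrite (_ : (fun y => _) = fun=> 0); [exact: lreg_cst|apply/funext => y; rewrite big_nil].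
  rewrite (_ : (fun y => _) = fun y => c i y + \sum_(i <- r) c i y); first exact: lregD.
  by apply/funext => y; rewrite big_cons.
exact.
Qed.

Lemma lreg_eq c c' y0 : (\forall y \near y0, sq y -> Q y -> c y = c' y) ->
  lreg c y0 -> lreg c' y0.
Proof.
move=> e [[B h1] h2]; split.
  by exists B; apply: filterS2 e h1 => y e1 h s q; rewrite -e1//; exact: h.
move=> s q; have := h2 s q; rewrite -(nbhs_singleton e s q).
apply: cvg_trans; apply: near_eq_cvg.
change (nbhs y0 [set y | sq y -> c y = c' y]).
by apply: filterS2 e (Qopen q) => y h3 h4 s'; exact: h3.
Qed.

Lemma lreg_global c : (forall y0, sq y0 -> lreg c y0) ->
  exists B, 0 <= B /\ forall y, sq y -> Q y ->
    `|c y| <= B /\ c z @[z --> within sq (nbhs y)] --> c y.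
Proof.
move=> h; have [|B [B0 hB]] := @square_bound Q c; first by move=> y /h[].
exists B; split=> // y s q; split; first exact: hB.
by have [_] := h y s; apply.
Qed.

End LocallyRegular.

Lemma lreg_weak (Q Q' : R * R -> Prop) c y0 : (forall y, Q' y -> Q y) ->
  lreg Q c y0 -> lreg Q' c y0.
Proof.
move=> qq [[B h1] h2]; split=> [|s q]; last by apply: h2 => //; exact: qq.
by exists B; apply: filterS h1 => y h s q; apply: h => //; exact: qq.
Qed.

Lemma lreg_chart c (f : vec -> R) Q y0 : matlas c -> (forall z, cimg c z -> C1at f z) ->
  sq y0 -> cdom c (G y0) -> lreg Q (fun y => f (cmap c (G y))) y0.
Proof.
move=> cA fC s hc; split=> [|_ _]; last exact: Y_continuous.
have [B hB] := dY_bound cA fC (1, 0) s hc.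
by exists B; apply: filterS hB => y h sy _; have [] := h sy.
Qed.

Lemma lreg_chart_derive c (f : vec -> R) v y0 : matlas c -> (forall z, cimg c z -> C1at f z) ->
  sq y0 -> cdom c (G y0) -> lreg (regv cs v) ('D_v (fun y => f (cmap c (G y)))) y0.
Proof.
move=> cA fC s hc; split=> [|_ r]; last exact: dY_continuous.
have [B hB] := dY_bound cA fC v s hc.
by exists B; apply: filterS hB => y h sy r; have [_] := h sy; apply.
Qed.

Lemma idC (c : chart R M (mdim M)) z : cimg c z -> C1at (@idfun vec) z.
Proof.
move=> _; split; first exact: near_all.
move=> w; rewrite (_ : (fun z => _) = cst w); first exact: cst_continuous.
by apply/funext => z'; rewrite derive_id.
Qed.

Lemma derive_coord c v y j : matlas c -> sq y -> cdom c (G y) -> regv cs v y ->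
  'D_v (cmap c \o G) y ord0 j = 'D_v (fun y => cmap c (G y) ord0 j) y.
Proof.
move=> cA sy hc r.
have d : derivable (cmap c \o G) y v := derivable_reg cA (@idC c) sy hc r.
by rewrite derive_mx// mxE.
Qed.

(** * Pullbacks of forms along the map *)

Section FormPullback.
Variable V : lmodType R[i].

(** The chart picked at [G y] may jump with [y]. At regular points [pullv_chart] replaces it by a
    fixed chart, and continuity is read there. *)
Definition pullv (w : form1 M V) v y : V :=
  let c := chart_at (G y) in w c (cmap c (G y)) ('D_v (cmap c \o G) y).

Definition pullm (m : form2 M V) v v' y : V :=
  let c := chart_at (G y) in
  m c (cmap c (G y)) ('D_v (cmap c \o G) y) ('D_v' (cmap c \o G) y).

Lemma chart_atP (p : M) : matlas (chart_at p) /\ cdom (chart_at p) p.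
Proof. by rewrite /chart_at; case: cid2. Qed.

Lemma pullv_chart w c v y : matlas c -> sq y -> cdom c (G y) -> regv cs v y ->
  pullv w v y = w c (cmap c (G y)) ('D_v (cmap c \o G) y).
Proof.
move=> cA sy hc r; have [c0A hc0] := chart_atP (G y).
by rewrite (f1_compat w _ cA c0A hc hc0) -derive_chart_change.
Qed.

Lemma pullm_chart m c v v' y : matlas c -> sq y -> cdom c (G y) -> regv cs v y ->
  regv cs v' y ->
  pullm m v v' y = m c (cmap c (G y)) ('D_v (cmap c \o G) y) ('D_v' (cmap c \o G) y).
Proof.
move=> cA sy hc r r'; have [c0A hc0] := chart_atP (G y).
by rewrite (f2_compat m _ _ cA c0A hc hc0) -!derive_chart_change.
Qed.

Lemma lin_row (F : vec -> V) : (forall (a : R) v w, F (a *: v + w) = a%:C%C *: F v + F w) ->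
  forall v, F v = \sum_j (v ord0 j)%:C%C *: F (delta_mx ord0 j).
Proof.
move=> h v.
have F0 : F 0 = 0.
  have := h 0 0 0; rewrite scaler0 addr0 scale0r add0r => e.
  by have := h (-1) 0 0; rewrite scaler0 addr0 rmorphN1 scaleN1r addNr.
have FD x y : F (x + y) = F x + F y by have := h 1 x y; rewrite !scale1r.
have FZ a x : F (a *: x) = a%:C%C *: F x by have := h a x 0; rewrite !addr0 F0 addr0.
rewrite [in LHS](row_sum_delta v) (big_morph F FD F0).
by apply: eq_bigr => j _; rewrite FZ.
Qed.

Lemma form1_coord (w : form1 M V) : exists n (e : 'I_n -> V), forall c, matlas c ->
  exists phi : 'I_n -> 'I_(mdim M) -> vec -> R,
    (forall i j z, cimg c z -> C1at (phi i j) z) /\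
    forall x v, cimg c x -> w c x v = \sum_j (v ord0 j)%:C%C *: lincomb e (fun i => phi i j x).
Proof.
have [n [e he]] := f1_smooth w; exists n, e => c cA; have [a [h1 h2]] := he c cA.
exists (fun i j => a i ^~ (delta_mx ord0 j)); split.
  by move=> i j z hz; apply: smooth_C1at (h1 i _) hz; exact: cimg_open.
move=> x v hx; rewrite (lin_row (F := w c x)); last first.
  by move=> k v1 v2; exact: f1_linear.
by apply: eq_bigr => j _; rewrite h2.
Qed.

Lemma form2_coord (m : form2 M V) : exists n (e : 'I_n -> V), forall c, matlas c ->
  exists phi : 'I_n -> 'I_(mdim M) -> 'I_(mdim M) -> vec -> R,
    (forall i j k z, cimg c z -> C1at (phi i j k) z) /\
    forall x v w, cimg c x -> m c x v w =
      \sum_j \sum_k (v ord0 j * w ord0 k)%:C%C *: lincomb e (fun i => phi i j k x).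
Proof.
have [n [e he]] := f2_smooth m; exists n, e => c cA; have [a [h1 h2]] := he c cA.
exists (fun i j k x => a i x (delta_mx ord0 j) (delta_mx ord0 k)); split.
  by move=> i j k z hz; apply: smooth_C1at (h1 i _ _) hz; exact: cimg_open.
move=> x v w hx; rewrite (lin_row (F := fun v => m c x v w)); last first.
  by move=> k v1 v2; exact: f2_linearl.
apply: eq_bigr => j _; rewrite (lin_row (F := m c x _)); last first.
  by move=> k v1 v2; exact: f2_linearr.
by rewrite scaler_sumr; apply: eq_bigr => k _; rewrite scalerA -rmorphM h2.
Qed.

Lemma regv_open v y : regv cs v y -> \forall z \near y, regv cs v z.
Proof. exact: regv_near. Qed.

Lemma pullv_lreg w v l y0 : rlin l -> sq y0 -> lreg (regv cs v) (fun y => l (pullv w v y)) y0.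
Proof.
move=> hl sy; have [cA hc] := chart_atP (G y0); set c := chart_at (G y0) in cA hc.
have [n [e he]] := form1_coord w; have [phi [h1 h2]] := he c cA.
apply: (lreg_eq (@regv_open v) (c := fun y => \sum_j 'D_v (fun y => cmap c (G y) ord0 j) y *
    \sum_i phi i j (cmap c (G y)) * l (e i))).
  apply: filterS (chart_domain_near sy hc) => y hy s r.
  rewrite (pullv_chart w cA s (hy s) r) h2; last by exists (G y) => //; exact: hy.
  rewrite rlin_sum//; apply: eq_bigr => j _.
  by rewrite hl.2 rlin_lincomb// derive_coord//; exact: hy.
apply: lreg_sum => j; apply: lregM.
  by apply: (lreg_chart_derive (f := fun z => z ord0 j)) => // z _; exact: C1at_coord.
apply: lreg_sum => i; apply: lregM; last exact: lreg_cst.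
by apply: lreg_chart => // z; exact: h1.
Qed.

Let Q12 y := regv cs (1, 0) y /\ regv cs (0, 1) y.
Lemma Q12_open y : Q12 y -> \forall z \near y, Q12 z.
Proof. by move=> [/regv_open h1 /regv_open h2]; apply: filterS2 h1 h2. Qed.

Lemma pullm_lreg m l y0 : rlin l -> sq y0 -> lreg Q12 (fun y => l (pullm m (0, 1) (1, 0) y)) y0.
Proof.
move=> hl sy; have [cA hc] := chart_atP (G y0); set c := chart_at (G y0) in cA hc.
have [n [e he]] := form2_coord m; have [phi [h1 h2]] := he c cA.
apply: (lreg_eq Q12_open (c := fun y => \sum_j \sum_k
    ('D_((0, 1) : R * R) (fun y => cmap c (G y) ord0 j) y *
     'D_((1, 0) : R * R) (fun y => cmap c (G y) ord0 k) y) *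
    \sum_i phi i j k (cmap c (G y)) * l (e i))).
  apply: filterS (chart_domain_near sy hc) => y hy s [r r'].
  rewrite (pullm_chart m cA s (hy s) r' r) h2; last by exists (G y) => //; exact: hy.
  rewrite rlin_sum//; apply: eq_bigr => j _.
  rewrite rlin_sum//; apply: eq_bigr => k _.
  by rewrite hl.2 rlin_lincomb// !derive_coord//; exact: hy.
apply: lreg_sum => j; apply: lreg_sum => k; apply: lregM.
  apply: lregM.
    apply: (lreg_weak (Q := regv cs (0, 1))); first by move=> y [].
    by apply: (lreg_chart_derive (f := fun z => z ord0 j)) => // z _; exact: C1at_coord.
  apply: (lreg_weak (Q := regv cs (1, 0))); first by move=> y [].
  by apply: (lreg_chart_derive (f := fun z => z ord0 k)) => // z _; exact: C1at_coord.
apply: lreg_sum => i; apply: lregM; last exact: lreg_cst.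
by apply: lreg_chart => // z; exact: h1.
Qed.

Lemma pull1_slice w u s : pull1 w (slice G s) u = pullv w (1, 0) (u, s).
Proof. by rewrite /pullv /pull1 /= (slice1_line _ u s).2. Qed.

Lemma sq_in u s : 0 < u < 1 -> `[0, 1]%classic s -> sq (u, s).
Proof. by move=> /andP[h1 h2] hs; split => //; rewrite /= in_itv/= !ltW. Qed.

Lemma pull1_regc w l : rlin l -> exists B, 0 <= B /\
  regc `[0, 1] (bad1 cs) B (fun y => l (pullv w (1, 0) y)).
Proof.
move=> hl; have [|B [B0 hB]] := @lreg_global (regv cs (1, 0)) (fun y => l (pullv w (1, 0) y)).
  by move=> y; exact: pullv_lreg.
exists B; split => // u s Ts hu hb; apply: hB; first exact: sq_in.
exact/reg1_regv/reg1P.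
Qed.

Definition regular_levels := `[0, 1] `&` [set s | s \notin levels cs].

Lemma pullv2_regc w l : rlin l -> exists B, 0 <= B /\
  regc regular_levels (bad1 cs) B (fun y => l (pullv w (0, 1) y)).
Proof.
move=> hl; have [|B [B0 hB]] := @lreg_global (regv cs (0, 1)) (fun y => l (pullv w (0, 1) y)).
  by move=> y; exact: pullv_lreg.
exists B; split => // u s [Ts sl] hu hb; apply: hB; first exact: sq_in.
exact/reg2_regv/reg2_level.
Qed.

Lemma pull2_regc (m : form2 M V) (l : V -> R) : rlin l -> exists B, 0 <= B /\
  regc regular_levels (bad1 cs) B (fun y => l (pull2 m G y.1 y.2)).
Proof.
move=> hl; rewrite (_ : (fun y => _) = fun y => l (pullm m (0, 1) (1, 0) y)); last first.
  by apply/funext => -[].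
have [|B [B0 hB]] := @lreg_global Q12 (fun y => l (pullm m (0, 1) (1, 0) y)).
  by move=> y; exact: pullm_lreg.
exists B; split => // u s [Ts sl] hu hb; apply: hB; first exact: sq_in.
by split; [exact/reg1_regv/reg1P|exact/reg2_regv/reg2_level].
Qed.

End FormPullback.

Lemma derive_chart_comp (c : chart R M (mdim M)) (W : normedModType R) (f : vec -> W) v y :
  matlas c -> (forall z, cimg c z -> C1at f z) ->
  sq y -> cdom c (G y) -> regv cs v y ->
  'D_v (fun y => f (cmap c (G y))) y = 'D_('D_v (cmap c \o G) y) f (cmap c (G y)).
Proof.
move=> cA fC sy hc r; have [E EP pE] := Pcov sy.
have [g hg] := local_extension cA (@idC c) EP pE hc.
have [_ e1] := derive_at_reg (c := c) (f := @idfun vec) EP pE r hg.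
have e1' : 'D_v (cmap c \o G) y = 'D_v g y := e1.
have [Cg /(_ pE)[_ eg]] := nbhs_singleton hg.
have eg' : cmap c (G y) = g y := eg.
have df : differentiable f (g y).
  by apply: nbhs_singleton (fC _ _).1; rewrite -eg'; exists (G y).
have dg : differentiable g y := nbhs_singleton Cg.1.
rewrite e1' eg' -deriv_comp//.
have [] // := @derive_line R _ _ (fun y => f (cmap c (G y))) (f \o g) y v.
  have n' := near_line v hg; have st := regv_stay (subcs EP) r pE.
  apply: filterS2 n' st => h /= [_ h1] h2; have [_ h4] := h1 h2.
  by rewrite -(h4 : cmap c (G (h *: v + y)) = _).
by apply: diff_derivable; exact: differentiable_comp.
Qed.

(** [W s u] will be the product of a transport coefficient on the row [s] and one on the row [s0],
    hence the two lists of bad abscissae. *)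
Definition weight (s0 B : R) (W W1 : R -> R -> R) :=
  [/\ \forall s \near s0, {within `[0, 1], continuous (W s)},
      \forall s \near s0, forall u, 0 <= u <= 1 -> `|W s u| <= B,
      \forall s \near s0, forall u, 0 < u < 1 -> u \notin bad1 cs s ++ bad1 cs s0 ->
        is_derive u 1 (W s) (W1 s u),
      \forall s \near s0, pcw 0 1 (bad1 cs s ++ bad1 cs s0) B (W1 s)
    & (forall u, 0 <= u <= 1 -> W s u @[s --> s0] --> W s0 u) /\
      (forall u, 0 < u < 1 -> u \notin bad1 cs s0 -> W1 s u @[s --> s0] --> W1 s0 u)].

Lemma nice_chart (c : chart R M (mdim M)) (f : vec -> R) (N : set (R * R)) B :
  matlas c -> (forall z, cimg c z -> C1at f z) ->
  (forall y, N y -> sq y -> [/\ cdom c (G y), `|f (cmap c (G y))| <= B,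
     regv cs (1, 0) y -> `|'D_((1, 0) : R * R) (fun y => f (cmap c (G y))) y| <= B
   & regv cs (0, 1) y -> `|'D_((0, 1) : R * R) (fun y => f (cmap c (G y))) y| <= B]) ->
  nice cs N B (fun y => f (cmap c (G y)))
    ('D_((1, 0) : R * R) (fun y => f (cmap c (G y))))
    ('D_((0, 1) : R * R) (fun y => f (cmap c (G y)))).
Proof.
set Y := (fun y => f (cmap c (G y))) => cA fC h; split=> y Ny sy; have [hc h1 h2 h3] := h y Ny sy.
- by split => //; exact: (Y_continuous cA fC sy hc).
- move=> /reg1_regv r _; have [d1 d2] := slice1_line Y y.1 y.2.
  rewrite -surjective_pairing in d1 d2; split; [|exact: h2|exact: (dY_continuous cA fC sy hc r)].
  exact: DeriveDef (iffLR d1 (derivable_reg cA fC sy hc r)) (esym d2).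
- move=> /reg2_regv r _; have [d1 d2] := slice2_line Y y.1 y.2.
  rewrite -surjective_pairing in d1 d2; split; [|exact: h3|exact: (dY_continuous cA fC sy hc r)].
  exact: DeriveDef (iffLR d1 (derivable_reg cA fC sy hc r)) (esym d2).
Qed.

(** * Stokes for a form pulled back to a thin horizontal strip *)

Section Stokes.
Variables (V : lmodType R[i]) (w : form1 M V) (l : V -> R) (hl : rlin l).
Variable F : R * R -> R.
Hypothesis hF : forall c y, matlas c -> sq y -> cdom c (G y) ->
  regv cs (1, 0) y -> regv cs (0, 1) y ->
  F y = 'D_('D_((0, 1) : R * R) (cmap c \o G) y)
          (fun z => l (w c z ('D_((1, 0) : R * R) (cmap c \o G) y))) (cmap c (G y)) -
        'D_('D_((1, 0) : R * R) (cmap c \o G) y)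
          (fun z => l (w c z ('D_((0, 1) : R * R) (cmap c \o G) y))) (cmap c (G y)).
Variables (s0 BW : R) (W W1 : R -> R -> R).
Hypotheses (s01 : 0 < s0 < 1) (s0l : s0 \notin levels cs) (hW : weight s0 BW W W1).
Hypotheses (side0 : forall s, 0 <= s <= 1 -> G (0, s) = G (0, 0))
  (side1 : forall s, 0 <= s <= 1 -> G (1, s) = G (1, 0)).
Variables (BF : R) (hFr : pcw 0 1 (bad1 cs s0) BF (fun u => F (u, s0))).

Let a y := l (pullv w (1, 0) y).
Let b y := l (pullv w (0, 1) y).
(** Admissible cut points: off [bad1 cs s0] the coordinates have vertical derivatives, and at 0 and
    1 their difference quotients vanish because Γ is constant on the sides. *)
Let good (p : R) := 0 <= p <= 1 /\ (p \notin bad1 cs s0 \/ p = 0 \/ p = 1).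
Let stokes (p q : R) :=
  \int[lebesgue_measure]_(u in `[p, q]) (W s u * ((a (u, s) - a (u, s0)) / (s - s0)))
    @[s --> s0^'] -->
  W s0 q * b (q, s0) - W s0 p * b (p, s0) +
  \int[lebesgue_measure]_(u in `[p, q]) (W s0 u * F (u, s0) - W1 s0 u * b (u, s0)).

Let in01 (u : R) : 0 < u < 1 -> 0 <= u <= 1. Proof. by move=> /andP[h1 h2]; rewrite !ltW. Qed.

Let T01 : regular_levels `<=` `[0, 1]. Proof. by move=> s []. Qed.
Let s0T : regular_levels s0.
Proof. by split => //=; rewrite in_itv/=; exact: in01. Qed.

Let near01 : \forall s \near s0, 0 < s < 1.
Proof.
have /andP[h1 h2] := s01.
by near=> s; apply/andP; split; near: s; [exact: lt_nbhsr|exact: lt_nbhsl].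
Unshelve. all: by end_near. Qed.

Let lhs_pcw : \forall s \near s0^', exists E B',
  pcw 0 1 E B' (fun u => W s u * ((a (u, s) - a (u, s0)) / (s - s0))).
Proof.
have [h1 h2 _ _ _] := hW; have [B [B0 hB]] := pull1_regc w hl.
near=> s.
have c1 : {within `[0, 1], continuous (W s)} by near: s; exact: nbhs_dnbhs.
have c2 : forall u, 0 <= u <= 1 -> `|W s u| <= BW by near: s; exact: nbhs_dnbhs.
have s1 : 0 < s < 1 by near: s; exact: nbhs_dnbhs.
have p1 : pcw 0 1 (bad1 cs s) B (fun u => a (u, s)).
  by apply: (regc_pcw _ _ hB) => //=; rewrite in_itv/=; exact: in01.
have p2 : pcw 0 1 (bad1 cs s0) B (fun u => a (u, s0)).
  by apply: (regc_pcw _ _ hB) => //=; rewrite in_itv/=; exact: in01.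
have p3 := W_pcw (lexx 0) (lexx 1) c1 c2.
do 2 eexists; apply: pcwM; first exact: p3.
apply: pcwM; last exact: pcw_cst.
by apply: pcwD; [exact: p1|apply: pcwN; exact: p2].
Unshelve. all: by end_near. Qed.

Let rhs_pcw : exists E B', pcw 0 1 E B' (fun u => W s0 u * F (u, s0) - W1 s0 u * b (u, s0)).
Proof.
have [h1 h2 _ h4 _] := hW; have [B [B0 hB]] := pullv2_regc w hl.
have p1 : pcw 0 1 (bad1 cs s0) B (fun u => b (u, s0)) by apply: (regc_pcw T01 s0T hB).
have p3 := W_pcw (lexx 0) (lexx 1) (nbhs_singleton h1) (nbhs_singleton h2).
have p4 := nbhs_singleton h4.
do 2 eexists; apply: pcwD; first exact: (pcwM p3 hFr).
by apply: pcwN; exact: (pcwM p4 p1).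
Qed.

(** The boundary terms at the common end point [q] cancel. *)
Let stokes_add (p q r : R) : 0 <= p -> p <= q -> q <= r -> r <= 1 ->
  stokes p q -> stokes q r -> stokes p r.
Proof.
move=> p0 pq qr r1 h1 h2.
have [E [B' hp]] := rhs_pcw.
have hp' := pcwS p0 r1 hp.
rewrite /stokes (Rint_split pq qr hp').
have -> : W s0 r * b (r, s0) - W s0 p * b (p, s0) +
   (\int[lebesgue_measure]_(u in `[p, q]) (W s0 u * F (u, s0) - W1 s0 u * b (u, s0)) +
    \int[lebesgue_measure]_(u in `[q, r]) (W s0 u * F (u, s0) - W1 s0 u * b (u, s0))) =
   (W s0 q * b (q, s0) - W s0 p * b (p, s0) +
    \int[lebesgue_measure]_(u in `[p, q]) (W s0 u * F (u, s0) - W1 s0 u * b (u, s0))) +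
   (W s0 r * b (r, s0) - W s0 q * b (q, s0) +
    \int[lebesgue_measure]_(u in `[q, r]) (W s0 u * F (u, s0) - W1 s0 u * b (u, s0))).
  have alg (x y z k m : R) : x - y + (k + m) = (z - y + k) + (x - z + m) by ring.
  exact: alg.
apply: cvg_trans (cvgD h1 h2); apply: near_eq_cvg.
apply: filterS lhs_pcw => s [E1 [B1 h3]].
by have h4 := pcwS p0 r1 h3; rewrite (Rint_split pq qr h4).
Qed.

Let side_b (p s : R) : p = 0 \/ p = 1 -> 0 < s < 1 ->
  (forall c, \forall z \near s, cmap c (G (p, z)) = cmap c (G (p, s)) :> vec).
Proof.
move=> hp hs c; have /andP[h1 h2] := hs; near=> z.
have hz : 0 <= z <= 1.
  by apply/andP; split; apply: ltW; near: z; [exact: lt_nbhsr|exact: lt_nbhsl].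
by case: hp => ->; rewrite ?(side0 hz) ?(side1 hz) ?(side0 (in01 hs)) ?(side1 (in01 hs)).
Unshelve. all: by end_near. Qed.

Let b_side (p : R) : p = 0 \/ p = 1 -> b (p, s0) = 0.
Proof.
move=> hp; rewrite /b /pullv; have [cA hc] := chart_atP (G (p, s0)).
set c := chart_at _ in cA hc *.
have -> : 'D_((0, 1) : R * R) (cmap c \o G) (p, s0) = 0.
  rewrite (slice2_line _ _ _).2.
  rewrite (near_eq_derive (g := cst (cmap c (G (p, s0))))) ?derive_cst//.
  by apply: filterS (side_b hp s01 c) => z /= ->.
have := f1_linear w (c := c) (x := cmap c (G (p, s0))) cA _ 0 0 0.
rewrite scaler0 addr0 scale0r add0r => h.
have x_in : cimg c (cmap c (G (p, s0))) by exists (G (p, s0)).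
have := f1_linear w cA x_in (-1) 0 0.
by rewrite scaler0 addr0 rmorphN1 scaleN1r addNr => ->; exact: rlin0.
Qed.

(** Near [(u0, s0)] a single chart suffices, and [stokes_local] is summed over the coordinates. *)
Let stokes_near (u0 : R) : 0 <= u0 <= 1 -> exists2 e, 0 < e & forall p q, p < q ->
  good p -> good q -> `|p - u0| < e -> `|q - u0| < e -> stokes p q.
Proof.
move=> hu0; pose y0 : R * R := (u0, s0).
have sy0 : sq y0 by split; rewrite /= in_itv/=; [|exact: in01].
have [cA hc0] := chart_atP (G y0); set c := chart_at (G y0) in cA hc0.
have [n [e he]] := form1_coord w; have [phi [phiC hphi]] := he c cA.
(* In the chart, [l] composed with [w] is the sum of [psi j] times the differential of the j-th
   coordinate. *)
pose psi j z := \sum_i phi i j z * l (e i).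
have psiC j z : cimg c z -> C1at (psi j) z.
  by move=> hz; apply: C1at_sum => i; exact: phiC.
have lw z v : cimg c z -> l (w c z v) = \sum_j v ord0 j * psi j z.
  move=> hz; rewrite hphi// rlin_sum//; apply: eq_bigr => j _.
  by rewrite hl.2 rlin_lincomb.
pose X j y := cmap c (G y) ord0 j.
pose Psi j y := psi j (cmap c (G y)).
have coC j z : cimg c z -> C1at (fun z : vec => z ord0 j) z by move=> _; exact: C1at_coord.
(* One bound for all coordinates, all coefficients and their partial derivatives, as [stokes_local]
   works with a single constant. *)
pose ok (j : 'I_(mdim M)) (B : R) y := sq y ->
  [/\ `|X j y| <= B, `|Psi j y| <= B,
   regv cs (1, 0) y -> `|'D_((1, 0) : R * R) (X j) y| <= B /\ `|'D_((1, 0) : R * R) (Psi j) y| <= B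
   & regv cs (0, 1) y -> `|'D_((0, 1) : R * R) (X j) y| <= B /\ `|'D_((0, 1) : R * R) (Psi j) y| <= B].
have [B0 hB0] : exists B, \forall y \near y0, forall j, j \in enum 'I_(mdim M) -> ok j B y.
  apply: near_seq_bound => [j B B' y BB h sy|j _].
    have [h1 h2 h3 h4] := h sy.
    by split=> [||/h3[h5 h6]|/h4[h5 h6]]; rewrite ?(le_trans _ BB).
  have [B1 h1] := dY_bound cA (coC j) (1, 0) sy0 hc0.
  have [B2 h2] := dY_bound cA (coC j) (0, 1) sy0 hc0.
  have [B3 h3] := dY_bound cA (psiC j) (1, 0) sy0 hc0.
  have [B4 h4] := dY_bound cA (psiC j) (0, 1) sy0 hc0.
  exists (Num.max (Num.max B1 B2) (Num.max B3 B4)).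
  near=> y => sy.
  have [k1 k2] : `|X j y| <= B1 /\ (regv cs (1, 0) y -> `|'D_((1, 0) : R * R) (X j) y| <= B1).
    by move: sy; near: y.
  have [k3 k4] : `|X j y| <= B2 /\ (regv cs (0, 1) y -> `|'D_((0, 1) : R * R) (X j) y| <= B2).
    by move: sy; near: y.
  have [k5 k6] : `|Psi j y| <= B3 /\ (regv cs (1, 0) y -> `|'D_((1, 0) : R * R) (Psi j) y| <= B3).
    by move: sy; near: y.
  have [k7 k8] : `|Psi j y| <= B4 /\ (regv cs (0, 1) y -> `|'D_((0, 1) : R * R) (Psi j) y| <= B4).
    by move: sy; near: y.
  split=> [||r|r]; rewrite !le_max.
  - by rewrite k1.
  - by rewrite k5 !orbT.
  - by rewrite (k2 r) (k6 r) !orbT.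
  - by rewrite (k4 r) (k8 r) !orbT.
have hdom := chart_domain_near sy0 hc0.
have /nbhs_ballP[eps /= eps0 hball] : \forall y \near y0,
    (sq y -> cdom c (G y)) /\ forall j, ok j B0 y.
  apply: filterS2 hdom hB0 => y h1 h2; split => // j; apply: h2; exact: mem_enum.
exists eps => // p q pq gp gq hp hq.
have [/andP[p0 p1] gp'] := gp; have [/andP[q0 q1] gq'] := gq.
pose B := Num.max B0 BW.
pose N := [set y : R * R | p <= y.1 <= q /\ `|y.2 - s0| < eps].
have Nball y : N y -> (sq y -> cdom c (G y)) /\ forall j, ok j B0 y.
  move=> [/andP[h1 h2] h3]; apply: hball; split => /=.
    rewrite /ball/= distrC; move: hp hq; rewrite !ltr_norml => /andP[? ?] /andP[? ?].
    by apply/andP; split; lra.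
  by rewrite /ball/= distrC.
have BB : B0 <= B by rewrite le_max lexx.
have niceX j : nice cs N B (X j) ('D_((1, 0) : R * R) (X j)) ('D_((0, 1) : R * R) (X j)).
  apply: (nice_chart cA (coC j)) => y Ny sy.
  have [/(_ sy) hc /(_ j sy)[h1 h2 h3 h4]] := Nball y Ny.
  by split=> // [|/h3[h5 _]|/h4[h5 _]]; exact: le_trans BB.
have nicePsi j : nice cs N B (Psi j) ('D_((1, 0) : R * R) (Psi j)) ('D_((0, 1) : R * R) (Psi j)).
  apply: (nice_chart cA (psiC j)) => y Ny sy.
  have [/(_ sy) hc /(_ j sy)[h1 h2 h3 h4]] := Nball y Ny.
  by split=> // [|/h3[_ h5]|/h4[_ h5]]; exact: le_trans BB.
have pullE v y : N y -> sq y -> regv cs v y ->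
    l (pullv w v y) = \sum_j 'D_v (X j) y * Psi j y.
  move=> Ny sy r; have [/(_ sy) hc _] := Nball y Ny.
  rewrite (pullv_chart w cA sy hc r) lw; last by exists (G y).
  by apply: eq_bigr => j _; rewrite derive_coord.
have s0eps : `|s0 - s0| < eps by rewrite subrr normr0.
have sqs r s : p <= r <= q -> 0 < s < 1 -> sq (r, s).
  move=> /andP[h1 h2] hs; split; rewrite /= in_itv/=; last exact: in01.
  by rewrite (le_trans p0 h1) (le_trans h2 q1).
(* difference quotients at an end point; on a side of the square they vanish *)
pose bp r j := if (r == 0) || (r == 1) then 0 else 'D_((0, 1) : R * R) (X j) (r, s0).
have hbp r j : p <= r <= q -> good r ->
    (X j (r, s) - X j (r, s0)) / (s - s0) @[s --> s0^'] --> bp r j.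
  move=> hr [_ gr]; rewrite /bp; case: ifPn => [/orP hr'|].
    have hr2 : r = 0 \/ r = 1 by case: hr' => /eqP; [left|right].
    apply: (@cvg_trans _ ((fun=> 0 : R) @ s0^')); last exact: cvg_cst.
    apply: near_eq_cvg; apply: nbhs_dnbhs; apply: filterS (side_b hr2 s01 c) => z hz.
    by rewrite /X hz subrr mul0r.
  rewrite negb_or => /andP[/eqP r0 /eqP r1]; case: gr => [gr|[]//].
  have r2 : reg2 cs (r, s0) by exact: reg2_level.
  have [d _ _] := (niceX j).(nice2) (conj hr s0eps : N (r, s0)) (sqs _ _ hr s01) r2 s01.
  exact: derive_quotient d.
have bE r : p <= r <= q -> good r -> b (r, s0) = \sum_j bp r j * Psi j (r, s0).
  move=> hr [_ gr]; rewrite /bp; case: (boolP ((r == 0) || (r == 1))) => [/orP hr'|].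
    have hr2 : r = 0 \/ r = 1 by case: hr' => /eqP; [left|right].
    by rewrite b_side// big1// => j _; rewrite mul0r.
  rewrite negb_or => /andP[/eqP r0 /eqP r1]; case: gr => [gr|[]//].
  apply: pullE => //; first exact: sqs.
  exact/reg2_regv/reg2_level.
have [W_c W_B W_d W1_c [W_l W1_l]] := hW.
have B_W : BW <= B by rewrite le_max lexx orbT.
have pp : p <= p <= q by rewrite lexx ltW.
have qq : p <= q <= q by rewrite lexx ltW.
have W_B' : \forall s \near s0, forall u, 0 <= u <= 1 -> `|W s u| <= B.
  by apply: filterS W_B => s h u hu; exact: le_trans (h u hu) B_W.
have W1_c' : \forall s \near s0, pcw 0 1 (bad1 cs s ++ bad1 cs s0) B (W1 s).
  by apply: filterS W1_c => s; exact: pcw_sub.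
have main j := stokes_local pq p0 q1 s01 eps0 s0l (nicePsi j) (niceX j) W_c W_B' W_d W1_c'
  W_l W1_l (hbp p j pp gp) (hbp q j qq gq).
have FF : Filter s0^' by exact: _.
have {main} := cvg_fsumR main.
have Wpcw := W_pcw p0 q1 (nbhs_singleton W_c) (nbhs_singleton W_B').
have W1pcw := pcwS p0 q1 (nbhs_singleton W1_c').
set rhs := (X in _ --> X).
have -> : rhs = W s0 q * b (q, s0) - W s0 p * b (p, s0) +
  \int[lebesgue_measure]_(u in `[p, q]) (W s0 u * F (u, s0) - W1 s0 u * b (u, s0)).
  rewrite /rhs big_split sumrB/= (bE p pp gp) (bE q qq gq) !mulr_sumr; congr (_ - _ + _).
  - by apply: eq_bigr => j _; rewrite mulrA mulrAC.
  - by apply: eq_bigr => j _; rewrite mulrA mulrAC.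
  have n1 j := nice1_pcw p0 q1 (niceX j) s01 s0eps.
  have n2 j := nice2_pcw p0 q1 s01 eps0 s0l (niceX j).
  have n3 j := nice1_pcw p0 q1 (nicePsi j) s01 s0eps.
  have n4 j := nice2_pcw p0 q1 s01 eps0 s0l (nicePsi j).
  have n5 j := nice_pcw p0 q1 (nicePsi j) s01 s0eps.
  have pj : exists E K, forall j, pcw p q E K (fun u =>
     W s0 u * ('D_((0, 1) : R * R) (Psi j) (u, s0) * 'D_((1, 0) : R * R) (X j) (u, s0) -
      'D_((1, 0) : R * R) (Psi j) (u, s0) * 'D_((0, 1) : R * R) (X j) (u, s0)) -
     W1 s0 u * (Psi j (u, s0) * 'D_((0, 1) : R * R) (X j) (u, s0))).
    eexists; eexists => j; apply: pcwD.
      apply: (pcwM Wpcw); apply: pcwD; first exact: pcwM (n4 j) (n1 j).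
      by apply: pcwN; exact: pcwM (n3 j) (n2 j).
    by apply: pcwN; apply: (pcwM W1pcw); exact: pcwM (n5 j) (n2 j).
  have [E [K hj]] := pj.
  have [hs <-] := pcw_sum hj.
  apply: (Rint_congr (pcw_sub (E' := bad1 cs s0 ++ E) _ (lexx _) hs)).
    by move=> z hz; rewrite mem_cat hz orbT.
  move=> u hu; rewrite mem_cat negb_or => /andP[ub _].
  have hu' : p <= u <= q by case/andP: hu => *; rewrite !ltW.
  have Nu : N (u, s0) by [].
  have su := sqs _ _ hu' s01.
  have r1 := reg1_regv (reg1P ub); have r2 := reg2_regv (reg2_level s0l ub).
  have [/(_ su) hc _] := Nball _ Nu.
  have x_in : cimg c (cmap c (G (u, s0))) by exists (G (u, s0)).
  rewrite sumrB -!mulr_sumr; congr (_ * _ - _ * _); last first.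
    by rewrite /b pullE//; apply: eq_bigr => j _; rewrite mulrC.
  (* With the tangent vector frozen, only the coefficients [psi j] are differentiated.
     Antisymmetrising then gives the integrand of [stokes_local], in which Γ is differentiated
     once. *)
  have Dlw z v : cimg c z -> forall v', 'D_v' (fun z => l (w c z v)) z = \sum_j v ord0 j * 'D_v' (psi j) z.
    move=> hz v'.
    rewrite (near_eq_derive (g := \sum_j (v ord0 j *: psi j))); last first.
      have : nbhs z (cimg c) by apply: open_nbhs_nbhs; split => //; exact: cimg_open.
      by apply: filterS => z' hz'; rewrite lw// fct_sumE.
    have dpsi j : derivable (psi j) z v'.
      by apply: diff_derivable; exact: nbhs_singleton (psiC j z hz).1.
    rewrite derive_sum; last by move=> j; exact: derivableZ.
    by apply: eq_bigr => j _; rewrite deriveZ.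
  rewrite (hF cA su hc r1 r2) !Dlw// sumrB; congr (_ - _); apply: eq_bigr => j _.
    by rewrite -(derive_chart_comp cA (psiC j) su hc r2) (derive_coord j cA su hc r1) mulrC.
  by rewrite -(derive_chart_comp cA (psiC j) su hc r1) (derive_coord j cA su hc r2) mulrC.
move=> h; rewrite /stokes; apply: (cvg_near_eq _ (h FF)).
have neps : \forall s \near s0, `|s - s0| < eps.
  by near=> s; rewrite distrC; near: s; apply: nbhsx_ballx.
near=> s.
have c1 : {within `[0, 1], continuous (W s)} by near: s; exact: nbhs_dnbhs.
have c2 : forall u, 0 <= u <= 1 -> `|W s u| <= B by near: s; exact: nbhs_dnbhs.
have s1 : 0 < s < 1 by near: s; exact: nbhs_dnbhs.
have s2 : `|s - s0| < eps by near: s; exact: nbhs_dnbhs.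
have w_s := W_pcw p0 q1 c1 c2.
have n1 j := nice1_pcw p0 q1 (niceX j) s1 s2.
have n2 j := nice_pcw p0 q1 (nicePsi j) s1 s2.
have n3 j := nice1_pcw p0 q1 (niceX j) s01 s0eps.
have n4 j := nice_pcw p0 q1 (nicePsi j) s01 s0eps.
have [E [K hj]] : exists E K, forall j, pcw p q E K (fun u => W s u *
   ((Psi j (u, s) * 'D_((1, 0) : R * R) (X j) (u, s) -
     Psi j (u, s0) * 'D_((1, 0) : R * R) (X j) (u, s0)) / (s - s0))).
  eexists; eexists => j; apply: (pcwM w_s); apply: pcwM; last exact: pcw_cst.
  by apply: pcwD; [exact: pcwM (n2 j) (n1 j)|apply: pcwN; exact: pcwM (n4 j) (n3 j)].
have [E1 [K1 hlhs]] : exists E B', pcw 0 1 E B' (fun u => W s u * ((a (u, s) - a (u, s0)) / (s - s0))).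
  by near: s; exact: lhs_pcw.
have [_ <-] := pcw_sum hj; apply/esym.
apply: (Rint_congr (pcw_sub (E' := (bad1 cs s ++ bad1 cs s0) ++ E1) _ (lexx _) (pcwS p0 q1 hlhs))).
  by move=> z hz; rewrite mem_cat hz orbT.
move=> u hu; rewrite !mem_cat !negb_or => /andP[/andP[ub ub0] _].
have hu' : p <= u <= q by case/andP: hu => *; rewrite !ltW.
rewrite /a (pullE (1, 0) (u, s)) ?(pullE (1, 0) (u, s0))//; try exact: sqs; try exact/reg1_regv/reg1P.
rewrite -sumrB mulr_suml mulr_sumr; apply: eq_bigr => j _.
by rewrite ![_ * Psi j _]mulrC.
Unshelve. all: by end_near. Qed.

Let exists_notin (E : seq R) (x y : R) : x < y -> exists2 z, x < z < y & z \notin E.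
Proof.
elim: E x y => [|e E ih] x y xy.
  by exists ((x + y) / 2) => //; apply/andP; split; lra.
have [/andP[xe ey]|he] := boolP (x < e < y).
  have [z /andP[z1 z2] z3] := ih _ _ xe; exists z; first by rewrite z1 (lt_trans z2).
  by rewrite inE negb_or z3 lt_eqF.
have [z z1 z3] := ih _ _ xy; exists z => //.
by rewrite inE negb_or z3 andbT; apply: contraNneq he => <-.
Qed.

(* The interval of validity is extended past its supremum, through regular cut points. *)
Lemma stokes_square :
  \int[lebesgue_measure]_(u in `[0, 1]) (W s u * ((a (u, s) - a (u, s0)) / (s - s0)))
    @[s --> s0^'] -->
  \int[lebesgue_measure]_(u in `[0, 1]) (W s0 u * F (u, s0) - W1 s0 u * b (u, s0)).
Proof.
have g0 : good 0 by split; [rewrite lexx ler01|right; left].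
have g1 : good 1 by split; [rewrite lexx ler01|right; right].
suff : stokes 0 1.
  by rewrite /stokes !b_side ?mulr0 ?subr0 ?add0r//; [left|right].
pose T := [set t : R | 0 <= t <= 1 /\ forall q, good q -> 0 < q <= t -> stokes 0 q].
have T0 : T 0.
  by split=> [|q _ /andP[h1 h2]]; rewrite ?lexx ?ler01//; move: (lt_le_trans h1 h2); rewrite ltxx.
have Tsup : has_sup T by split; [exists 0|exists 1 => t [/andP[]]].
set tau := sup T.
have tau0 : 0 <= tau by apply: ub_le_sup => //; case: Tsup.
have tau1 : tau <= 1 by apply: ge_sup; [exists 0|move=> t [/andP[]]].
have [e e0 he] := @stokes_near tau (introT andP (conj tau0 tau1)).
have key q : good q -> 0 < q -> q < tau + e -> stokes 0 q.
  move=> gq q0 qe; have /andP[_ q1] := gq.1.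
  have [te|te] := ltP tau e.
    have [qt|qt] := ltP (tau - e) q; last by exfalso; lra.
    by apply: (he 0 q) => //; rewrite ltr_norml; apply/andP; split; lra.
  have h1 : Num.max 0 (tau - e) < tau.
    by rewrite gt_max; apply/andP; split; lra.
  have [t Tt lt] := sup_adherent (ltac:(rewrite subr_gt0; exact: h1) : 0 < tau - Num.max 0 (tau - e)) Tsup.
  have {}lt : Num.max 0 (tau - e) < t by move: lt; rewrite -/tau; lra.
  have [t01 ht] := Tt; have ttau : t <= tau by apply: ub_le_sup => //; case: Tsup.
  have [qt|tq] := leP q t; first by apply: ht; rewrite ?q0.
  have [p /andP[p1 p2] pE] := exists_notin (bad1 cs s0) lt.
  have [p3 p4] : 0 < p /\ tau - e < p by move: p1; rewrite gt_max => /andP[].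
  have gp : good p.
    by split; [have /andP[? ?] := t01; apply/andP; split; lra|left].
  have pq : p < q by lra.
  apply: (@stokes_add 0 p q); rewrite ?(ltW p3) ?(ltW pq)//.
    by apply: ht => //; rewrite p3 ltW.
  by apply: he => //; rewrite ltr_norml; apply/andP; split; lra.
have [tau1'|tau1'] := ltP tau 1; last by apply: key => //; lra.
have : T (Num.min 1 (tau + e / 2)).
  split.
    by rewrite le_min ler01 ge_min lexx /= andbT; lra.
  move=> q gq /andP[q0]; rewrite le_min => /andP[_ qe]; apply: key => //; lra.
move=> hT; have : Num.min 1 (tau + e / 2) <= tau by apply: ub_le_sup => //; case: Tsup.
by rewrite ge_min => /orP[|]; lra.
Qed.

End Stokes.
End PiecewiseSmoothMap.

(** * Formal series with coefficients in an algebra *)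

(* all_analysis has another [cauchy], on filters. *)
Local Notation cauchy := Pilot.Defs.cauchy.

Section Cauchy.
Variable C : fieldType.

(** Triples of total degree [n], grouped by the sum of the first two degrees on the left and by the
    first one on the right. *)
Lemma triangle_sum (V : nmodType) (T : nat -> nat -> nat -> V) n :
  \sum_(i < n.+1) \sum_(j < i.+1) T j (i - j)%N (n - i)%N =
  \sum_(j < n.+1) \sum_(k < (n - j).+1) T j k (n - j - k)%N.
Proof.
transitivity (\sum_(i < n.+1) \sum_(j < n.+1 | (j <= i)%N) T j (i - j)%N (n - i)%N).
  by apply: eq_bigr => i _; rewrite (big_ord_narrow_leq (ltn_ord i : (i <= n)%N)).
rewrite (exchange_big_dep predT)//=; apply: eq_bigr => j _.
have hj : (j <= n)%N by rewrite -ltnS ltn_ord.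
rewrite -(big_mkord (fun i => (j <= i)%N) (fun i => T j (i - j)%N (n - i)%N)).
rewrite -(big_mkord xpredT (fun k => T j k (n - j - k)%N)).
transitivity (\sum_(j <= i < n.+1) T j (i - j)%N (n - i)%N).
  by rewrite (big_nat_widenl j 0).
rewrite -{1}(add0n (nat_of_ord j)) big_addn subSn//.
by apply: eq_bigr => k _; rewrite addnK -subnDA [(j + k)%N]addnC.
Qed.

(** Four operations are allowed to differ, to cover products, actions, coproducts and Peiffer
    relations. The identity is asked only of the coefficients that occur, because the Peiffer
    relation is applied to coefficients in the kernel of the counit. *)
Lemma cauchyA (A B D E F G : lmodType C) (op1 : A -> B -> E) (op2 : E -> D -> G)
    (op3 : A -> F -> G) (op4 : B -> D -> F)
    (x : fps A) (y : fps B) (z : fps D) : bilin op2 -> bilin op3 ->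
  (forall i j k, op2 (op1 (x i) (y j)) (z k) = op3 (x i) (op4 (y j) (z k))) ->
  cauchy op2 (cauchy op1 x y) z = cauchy op3 x (cauchy op4 y z).
Proof.
move=> b2 b3 h; apply/funext => n; rewrite /cauchy.
under eq_bigr => i _ do rewrite (lin_sum (b2.1 _)).
under [RHS]eq_bigr => i _ do rewrite (lin_sum (b3.2 _)).
rewrite (triangle_sum (fun j k l => op2 (op1 (x j) (y k)) (z l))).
by apply: eq_bigr => j _; apply: eq_bigr => k _; exact: h.
Qed.

Lemma cauchyC (A B : Type) (D : lmodType C) (op : A -> B -> D) (x : fps A) (y : fps B) :
  cauchy op x y = cauchy (fun b a => op a b) y x.
Proof.
apply/funext => n; rewrite /cauchy (reindex_inj rev_ord_inj)/=.
by apply: eq_bigr => i _; rewrite !subSS subKn// -ltnS.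
Qed.

Lemma eq_cauchy (A B : Type) (D : lmodType C) (op op' : A -> B -> D) (x : fps A) (y : fps B) :
  (forall i j, op (x i) (y j) = op' (x i) (y j)) -> cauchy op x y = cauchy op' x y.
Proof. by move=> h; apply/funext => n; apply: eq_bigr. Qed.

Lemma lin_cauchy (A B : Type) (D E : lmodType C) (f : D -> E) (op : A -> B -> D) (x : fps A) (y : fps B) :
  linear f -> f \o cauchy op x y = cauchy (fun a b => f (op a b)) x y.
Proof. by move=> fl; apply/funext => n; rewrite /= (lin_sum fl). Qed.

Lemma cauchy_comp (A B A' B' : Type) (D : lmodType C) (op : A -> B -> D)
    (f : A' -> A) (g : B' -> B) (x : fps A') (y : fps B') :
  cauchy op (f \o x) (g \o y) = cauchy (fun a b => op (f a) (g b)) x y.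
Proof. by []. Qed.

Lemma bilin_flip (A B D : lmodType C) (op : A -> B -> D) : bilin op ->
  bilin (fun b a => op a b).
Proof. by move=> [h1 h2]. Qed.

Lemma cauchyDl (A B D : lmodType C) (op : A -> B -> D) (x x' : fps A) (y : fps B) : bilin op ->
  cauchy op (x + x') y = cauchy op x y + cauchy op x' y.
Proof.
move=> ob; apply/funext => n.
rewrite [RHS](_ : _ = cauchy op x y n + cauchy op x' y n)// /cauchy -big_split.
by apply: eq_bigr => i _; exact: (linD (ob.1 _)).
Qed.

Lemma cauchyNl (A B D : lmodType C) (op : A -> B -> D) (x : fps A) (y : fps B) : bilin op ->
  cauchy op (- x) y = - cauchy op x y.
Proof.
move=> ob; apply/funext => n; rewrite [RHS](_ : _ = - cauchy op x y n)// /cauchy -sumrN.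
apply: eq_bigr => i _; rewrite [LHS](_ : _ = op (-1 *: x i) (y (n - i)%N)); last by rewrite scaleN1r.
by rewrite (linZ (ob.1 _)) scaleN1r.
Qed.

Lemma cauchyDr (A B D : lmodType C) (op : A -> B -> D) (x : fps A) (y y' : fps B) : bilin op ->
  cauchy op x (y + y') = cauchy op x y + cauchy op x y'.
Proof.
move=> ob; apply/funext => n.
rewrite [RHS](_ : _ = cauchy op x y n + cauchy op x y' n)// /cauchy -big_split.
by apply: eq_bigr => i _; exact: (linD (ob.2 _)).
Qed.

Lemma cauchyNr (A B D : lmodType C) (op : A -> B -> D) (x : fps A) (y : fps B) : bilin op ->
  cauchy op x (- y) = - cauchy op x y.
Proof. by move=> /bilin_flip ob; rewrite cauchyC (cauchyNl _ _ ob) [in RHS]cauchyC. Qed.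

Lemma cauchy_monoml (A B D : lmodType C) (op : A -> B -> D) k a (y : fps B) n : bilin op ->
  cauchy op (monom k a) y n = if (k <= n)%N then op a (y (n - k)%N) else 0.
Proof.
move=> ob; rewrite /cauchy /monom; case: leqP => h.
  rewrite (bigD1 (Ordinal (h : (k < n.+1)%N)))//= eqxx big1 ?addr0// => i hi.
  by rewrite ifF ?(lin0 (ob.1 _))//; apply: contra_neqF hi => /eqP e; exact: val_inj.
rewrite big1// => i _; rewrite ifF ?(lin0 (ob.1 _))//.
by apply/eqP => e; have := ltn_ord i; rewrite e ltnS leqNgt h.
Qed.

Lemma cauchy_monom0 (A B D : lmodType C) (op : A -> B -> D) a (y : fps B) : bilin op ->
  cauchy op (monom 0 a) y = op a \o y.
Proof. by move=> ob; apply/funext => n; rewrite cauchy_monoml// subn0. Qed.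

Lemma cauchy_monom0r (A B D : lmodType C) (op : A -> B -> D) (x : fps A) b : bilin op ->
  cauchy op x (monom 0 b) = op^~ b \o x.
Proof. by move=> /bilin_flip ob; rewrite cauchyC cauchy_monom0. Qed.

Lemma lin_monom (A B : lmodType C) (f : A -> B) k a : linear f ->
  f \o monom k a = monom k (f a).
Proof. by move=> fl; apply/funext => n; rewrite /monom /=; case: eqP => // _; rewrite lin0. Qed.

(* This is why linear equations Y' = a Y with a_0 = 0 are solved degree by degree. *)
Lemma cauchy_low (A B D : lmodType C) (op : A -> B -> D) (x : fps A) (y : fps B) n : bilin op -> x 0%N = 0 ->
  cauchy op x y n = \sum_(i < n) op (x i.+1) (y (n - i.+1)%N).
Proof. by move=> ob x0; rewrite /cauchy big_ord_recl x0 (lin0 (ob.1 _)) add0r. Qed.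

Section Inverse.
Variables (A : lmodType C) (mul : A -> A -> A) (one : A).
Hypotheses (mulb : bilin mul) (mulA : associative mul)
  (mul1 : left_id one mul) (mulr1 : right_id one mul).

Lemma fps_inv_unique x y : is_fps_inv mul one x y -> fps_inv mul one x = y.
Proof.
move=> hy; have hz : is_fps_inv mul one x (fps_inv mul one x).
  by rewrite /fps_inv; case: xgetP => [z _ //|/(_ y)]; case.
set z := fps_inv mul one x in hz *.
have -> : z = cauchy mul z (cauchy mul x y).
  by rewrite hy.1 cauchy_monom0r//; apply/funext => n /=; rewrite mulr1.
rewrite -(cauchyA (op1 := mul) (op2 := mul))// ?hz.2.
by rewrite cauchy_monom0//; apply/funext => n /=; rewrite mul1.
Qed.

End Inverse.

Lemma acauchyA (H : algType C) (x y z : fps H) :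
  cauchy *%R (cauchy *%R x y) z = cauchy *%R x (cauchy *%R y z).
Proof. by apply: cauchyA; [exact: mulr_bilin|exact: mulr_bilin|move=> *; rewrite mulrA]. Qed.

End Cauchy.

(** * Group-like series and primitive elements *)

Section HopfSeries.
Variables (C : fieldType) (H : hopfAlg C).
Implicit Types (x y : fps H).

Lemma hmul_inv_unique x y : is_fps_inv *%R 1 x y -> fps_inv *%R 1 x = y.
Proof. exact: (fps_inv_unique (mulr_bilin H) (@mulrA H) (@mul1r H) (@mulr1 H)). Qed.

Lemma is_fps_invC x y : is_fps_inv *%R 1 x y -> is_fps_inv *%R 1 y x.
Proof. by move=> [h1 h2]. Qed.

Lemma hcauchy1l x : cauchy *%R (monom 0 1) x = x.
Proof. by rewrite cauchy_monom0; [apply/funext => n /=; rewrite mul1r|exact: mulr_bilin]. Qed.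

Lemma hcauchy1r x : cauchy *%R x (monom 0 1) = x.
Proof. by rewrite cauchy_monom0r; [apply/funext => n /=; rewrite mulr1|exact: mulr_bilin]. Qed.

Definition grouplike_series x :=
  x 0%N = 1 /\ forall n, comul H (x n) = cauchy (@pure C H H) x x n.

(** Applying the counit to the left factors of the coproduct returns [x] together with
    [counit H x *: 1], which must therefore vanish. *)
Lemma primitive_counit (x : H) : primitive x -> counit H x = 0.
Proof.
move=> px; have := counitl x; rewrite px.
have b : bilin (fun x' x'' : H => counit H x' *: x'').
  split=> [v|u] a s t /=; first by rewrite linearP scalerDl -scalerA.
  by rewrite scalerDr !scalerA mulrC.
rewrite (linD (tlift_linear b)) !tlift_pure// rmorph1 scale1r => /eqP.
rewrite -subr_eq0 addrK => /eqP/(congr1 (counit H)).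
by rewrite linearZ/= rmorph1 linear0 => <-; rewrite /GRing.scale/= mulr1.
Qed.

(** Primitive elements are the kernel of this linear map, so sums and integrals of primitive
    elements are primitive. *)
Definition primitive_defect (x : H) := comul H x - (x ⊗ 1 + 1 ⊗ x).

Lemma primitive_defect_lin : linear primitive_defect.
Proof.
move=> a x y; rewrite /primitive_defect linearP pureDl pureDr pureZl pureZr.
rewrite scalerBr scalerDr [in RHS]addrACA -opprD; congr (_ - _).
by rewrite addrACA.
Qed.

Lemma primitiveP (x : H) : primitive x <-> primitive_defect x = 0.
Proof. rewrite /primitive /primitive_defect; split=> [->|/eqP]; first exact: subrr.
by rewrite subr_eq0 => /eqP. Qed.

(** Induction on the degree. Under the counit on left factors, the intermediate terms of the
    coproduct of [x n] vanish, and the outer ones give [x n] plus [counit H (x n) *: 1]; the counit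
    axiom says that the sum is [x n]. *)
Lemma grouplike_counit x : grouplike_series x -> forall n, (0 < n)%N -> counit H (x n) = 0.
Proof.
move=> [x0 gx]; elim/ltn_ind => -[//|n] ih _.
have := counitl (x n.+1); rewrite gx.
have b : bilin (fun x' x'' : H => counit H x' *: x'').
  split=> [v|u] a s t /=; first by rewrite linearP scalerDl -scalerA.
  by rewrite scalerDr !scalerA mulrC.
rewrite /cauchy (lin_sum (tlift_linear b)) big_ord_recl tlift_pure// subn0 x0 rmorph1 scale1r.
rewrite big_ord_recr/= tlift_pure// subnn x0 big1 ?add0r.
  move/eqP; rewrite -subr_eq0 [_ + _ - _]addrC addrA addNr add0r => /eqP/(congr1 (counit H)).
  rewrite linearZ/= rmorph1 linear0 /GRing.scale/= mulr1 => <-.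
  by [].
move=> i _; by rewrite tlift_pure// ih ?scale0r//= /bump ltnS ltn_ord.
Qed.

(** On a group-like series the convolution identities of the antipode become Cauchy products. *)
Lemma grouplike_antipode x : grouplike_series x ->
  cauchy *%R x (antipode H \o x) = monom 0 1 /\ cauchy *%R (antipode H \o x) x = monom 0 1.
Proof.
move=> gx; have ec n : counit H (x n) *: 1 = monom 0 1 n :> H.
  rewrite /monom; case: n => [|n]; first by rewrite gx.1 rmorph1 scale1r.
  by rewrite (grouplike_counit gx)// scale0r.
have b1 : bilin (fun x' x'' : H => x' * antipode H x'').
  by split=> [v|u] a s t /=; rewrite ?linearP mulrDl scalerAl || rewrite linearP mulrDr scalerAr.
have b2 : bilin (fun x' x'' : H => antipode H x' * x'').
  split=> [v|u] a s t /=; first by rewrite linearP mulrDl scalerAl.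
  by rewrite mulrDr scalerAr.
split; apply/funext => n; rewrite -ec.
  rewrite -antipoder gx.2 /cauchy (lin_sum (tlift_linear b1)).
  by apply: eq_bigr => i _; rewrite tlift_pure.
rewrite -antipodel gx.2 /cauchy (lin_sum (tlift_linear b2)).
by apply: eq_bigr => i _; rewrite tlift_pure.
Qed.

End HopfSeries.

(** * Crossed module relations on series *)

Section XmodSeries.
Variables (C : fieldType) (X : hopfXmod C).
Local Notation H := (hH X).
Local Notation I := (hI X).

Lemma hd_lin : linear (hd X).
Proof. by move=> a x y; rewrite linearP. Qed.

(** In the coproduct of [hact x v] every term contains an action on 1, which is a scalar given by
    the counit; the counit axiom then collapses each Sweedler sum. *)
Lemma primitive_act (x : H) (v : I) : primitive v -> primitive (hact x v).
Proof.
have [l1 l2] := @hact_bilin _ X.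
move=> pv; rewrite /primitive hact_comul pv.
have b x' x'' : bilin (fun v' v'' : I => hact x' v' ⊗ hact x'' v'').
  split=> [w|w] a s t; cbv beta; rewrite l2 ?pureDl ?pureZl// pureDr pureZr.
  by [].
rewrite (eq_tlift (g := fun x' x'' : H => hact (counit H x'' *: x') v ⊗ (1 : I) +
    (1 : I) ⊗ hact (counit H x' *: x'') v)); last first.
  move=> x' x''; rewrite (linD (tlift_linear (b x' x''))) !tlift_pure// !hact_one.
  by rewrite !(linZ (l1 _)) pureZr pureZl !pureZl !pureZr.
have e (U V W : lmodType C) (f g : U -> V -> W) t :
    tlift (fun u v => f u v + g u v) t = tlift f t + tlift g t.
  by rewrite /tlift /sum2 big_split.
rewrite e; congr (_ + _).
  have fl : linear (fun y : H => hact y v ⊗ (1 : I)) by move=> a s t; rewrite l1 pureDl pureZl.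
  by rewrite -[in RHS](counitr x) (tlift_comp _ _ fl).
have fl : linear (fun y : H => (1 : I) ⊗ hact y v) by move=> a s t; rewrite l1 pureDr pureZr.
by rewrite -[in RHS](counitl x) (tlift_comp _ _ fl).
Qed.

(** The first Peiffer relation becomes conjugation, because a group-like series [p] has coproduct
    [p ⊗ p] and its inverse is its antipode. *)
Lemma hd_act_series (p q : fps H) (m : fps I) :
  grouplike_series p -> is_fps_inv *%R 1 p q ->
  hd X \o cauchy (@hact _ X) p m = cauchy *%R (cauchy *%R p (hd X \o m)) q.
Proof.
move=> gp pq; have [s1 s2] := grouplike_antipode gp.
have -> : q = antipode H \o p.
  by rewrite -(hmul_inv_unique pq); apply: hmul_inv_unique.
rewrite lin_cauchy; last exact: hd_lin.
(* Taking a whole coproduct as one argument makes the right side of [hpeiffer1] bilinear, as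
   [cauchyA] requires. *)
pose op2 (t : tens H H) (v : I) := tlift (fun x' x'' => x' * hd X v * antipode H x'') t.
have b1 v : bilin (fun x' x'' : H => x' * hd X v * antipode H x'').
  split=> [z|z] a s t; cbv beta; first by rewrite !mulrDl !scalerAl.
  by rewrite linearP mulrDr scalerAr.
have b2 : bilin op2.
  split=> [v|t]; first exact: tlift_linear.
  apply: tlift_param => x y a s s'; rewrite linearP mulrDr mulrDl -scalerAr.
  by rewrite -scalerAl.
transitivity (cauchy op2 (cauchy (@pure C H H) p p) m).
  by apply/funext => n; apply: eq_bigr => i _; rewrite hpeiffer1 -gp.2.
rewrite (cauchyA (op3 := *%R) (op4 := fun s v => hd X v * antipode H s)) //.
- by rewrite acauchyA; congr (cauchy _ _ _); rewrite cauchyC.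
- exact: mulr_bilin.
- by move=> a c d; rewrite /op2 tlift_pure// mulrA.
Qed.

End XmodSeries.

(** * Series in the crossed module of bare algebras *)

Section BASeries.
Variables (C : fieldType) (X : hopfXmod C).
Local Notation H := (hH X).
Local Notation I := (hI X).

Lemma aug_part_subproof (v : I) : v - counit I v *: 1 \in @aug_pred C I.
Proof. by rewrite unfold_in linearB linearZ/= rmorph1 /GRing.scale/= mulr1 subrr. Qed.
Definition aug_part v := Aug (aug_part_subproof v).

Lemma aug_part_lin : linear aug_part.
Proof.
move=> a u v; apply: aug_inj; rewrite aug_val_lin /= linearP.
by rewrite scalerBr scalerDl -scalerA opprD addrACA.
Qed.

Lemma aug_partE (v : aug I) : aug_part (aug_val v) = v.
Proof. by apply: aug_inj; rewrite /= aug0 scale0r subr0. Qed.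

(* Extends ba_pure bilinearly from ker ε to I by killing 1. *)
Definition ba_ext (v : I) (x : H) : xA (BA X) :=
  peiffer_proj (aug_part v ⊗ x : xA (semidirect X)).

Lemma peiffer_proj_lin (A : prexmod C) : linear (@peiffer_proj _ A).
Proof. exact: qpi_lin. Qed.

Lemma ba_ext_bilin : bilin ba_ext.
Proof.
split=> [x|v] a s t; rewrite /ba_ext.
  by rewrite aug_part_lin ((@pure_bilin _ _ _).1 x) peiffer_proj_lin.
by rewrite ((@pure_bilin _ _ _).2 _) peiffer_proj_lin.
Qed.

Lemma ba_pureE v x : counit I v = 0 -> ba_pure v x = ba_ext v x.
Proof.
move=> v0; rewrite /ba_pure /ba_ext; congr (peiffer_proj (pure _ _ : xA (semidirect X))).
have hv : v \in @aug_pred C I by rewrite unfold_in v0.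
by apply: aug_inj; rewrite [LHS](insubdK 0 hv)/= v0 scale0r subr0.
Qed.

Lemma ba_ext1 x : ba_ext 1 x = 0.
Proof.
rewrite /ba_ext (_ : aug_part 1 = 0) ?(lin0 ((@pure_bilin _ _ _).1 x)) ?(lin0 (@peiffer_proj_lin _))//.
by apply: aug_inj; rewrite (lin0 (@aug_val_lin _ _))/= rmorph1 scale1r subrr.
Qed.

Lemma ract_ba_ext v x y : ract (ba_ext v x) y = ba_ext v (x * y).
Proof.
rewrite /ba_ext -(sract_pure (X := X)); exact: qractE.
Qed.

Lemma xmul_ba_ext (v w : aug I) y :
  xmul (ba_ext (aug_val v) 1) (ba_ext (aug_val w) y) = ba_ext (aug_val v * aug_val w) y.
Proof.
rewrite /ba_ext !aug_partE.
transitivity (peiffer_proj (smul (X := X) (v ⊗ 1) (w ⊗ y) : xA (semidirect X))).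
  exact: qmulE.
congr (peiffer_proj _); rewrite smul_pure slact1 lmul_pure; congr (_ ⊗ _).
by rewrite -[LHS]aug_partE.
Qed.

Lemma ba_ext_decomp (v : I) : v = aug_val (aug_part v) + counit I v *: 1.
Proof. by rewrite /= subrK. Qed.

Lemma xd_ba_ext (w : aug I) y : xd (ba_ext (aug_val w) y) = hd X (aug_val w) * y.
Proof. by rewrite /ba_ext aug_partE -(sd_pure w y); exact: (qdE (A := semidirect X)). Qed.

(* The second Peiffer relation, w ⊗ x having boundary hd w * x. *)
Lemma ba_ext_peiffer (v w : I) x : counit I v = 0 ->
  ba_ext (v * w) x = ba_ext v (hd X w * x).
Proof.
move=> v0; have [b1 b2] := ba_ext_bilin.
have -> : v = aug_val (aug_part v) by rewrite {1}(ba_ext_decomp v) v0 scale0r addr0.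
rewrite (ba_ext_decomp w); move: (aug_part v) (aug_part w) (counit I w) => {v0} v' w' a.
rewrite mulrDr (linD (b1 x)) -xmul_ba_ext -peifferr xd_ba_ext ract_ba_ext mul1r.
have -> : hd X (aug_val w' + a *: 1) = hd X (aug_val w') + a *: 1.
  by rewrite raddfD/= [X in _ + X]linearZ/= rmorph1.
rewrite mulrDl (linD (b2 _)); congr (_ + _).
by rewrite -scalerAr mulr1 -scalerAl mul1r (linZ (b1 _)) (linZ (b2 _)).
Qed.

(** The unital algebra map that [inc_I] applies termwise on group-like series. It allows inverses in
    the algebra with adjoined identity to be computed in I. *)
Definition adj_incl (v : I) : adj (BA X) := (counit I v, ba_ext v 1).

Lemma adj_incl_lin : linear adj_incl.
Proof.
by move=> a u v; rewrite /adj_incl (ba_ext_bilin.1 1) linearP.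
Qed.

Lemma adj_inclM v w : adj_incl (v * w) = adj_mul (adj_incl v) (adj_incl w).
Proof.
have [b1 b2] := ba_ext_bilin.
rewrite /adj_incl /adj_mul/= counitM; congr (_, _).
rewrite {1}(ba_ext_decomp v) mulrDl (linD (b1 _)) -scalerAl mul1r (linZ (b1 _)).
rewrite {1}(ba_ext_decomp w) mulrDr (linD (b1 _)) -xmul_ba_ext -scalerAr mulr1 (linZ (b1 _)).
have e u : ba_ext (aug_val (aug_part u)) 1 = ba_ext u 1 by rewrite /ba_ext aug_partE.
by rewrite !e addrAC [RHS]addrC addrA addrAC.
Qed.

Lemma adj_incl1 : adj_incl 1 = adj_one (BA X).
Proof. by rewrite /adj_incl rmorph1 ba_ext1. Qed.

Lemma adj_mul_bilin (A : xmod C) : bilin (@adj_mul _ A).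
Proof.
have [b1 b2] := @xmul_bilin _ A.
split=> [[l v]|[l v]] a [s x] [t y]; rewrite /adj_mul/=; congr (_, _).
- by rewrite mulrDl -scalerAl.
- rewrite /= b1 !scalerDr !scalerDl !scalerA [l * a]mulrC /GRing.scale/=.
  by rewrite !addrA (ACl (1*3*5*2*4*6)).
- by rewrite mulrDr -scalerAr.
- rewrite /= b2 !scalerDr !scalerDl !scalerA [l * a]mulrC /GRing.scale/=.
  by rewrite !addrA (ACl (1*3*5*2*4*6)).
Qed.

Lemma adj_mulA (A : xmod C) : associative (@adj_mul _ A).
Proof.
have [b1 b2] := @xmul_bilin _ A.
move=> [a x] [b y] [c z]; rewrite /adj_mul/= mulrA; congr (_, _).
rewrite !(linD (b1 _)) !(linD (b2 _)) !(linZ (b1 _)) !(linZ (b2 _)) !scalerDr !scalerA xmulA.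
by rewrite [c * a]mulrC [c * b]mulrC !addrA (ACl (1*2*4*6*3*5*7)).
Qed.

Lemma adj_mul1 (A : xmod C) : left_id (adj_one A) (@adj_mul _ A).
Proof.
move=> [a x]; rewrite /adj_mul/= mul1r scale1r scaler0 addr0.
by rewrite (lin0 ((@xmul_bilin _ A).1 x)) addr0.
Qed.

Lemma adj_mulr1 (A : xmod C) : right_id (adj_one A) (@adj_mul _ A).
Proof.
move=> [a x]; rewrite /adj_mul/= mulr1 scale1r scaler0 add0r.
by rewrite (lin0 ((@xmul_bilin _ A).2 x)) addr0.
Qed.

(** Positive-degree coefficients of a group-like series lie in the kernel of the counit, so [inc_I]
    is [adj_incl] termwise and the inverse of the image is the image of [q]. *)
Lemma TA_inc (g : gl H) (e : gl I) (q : fps I) : is_fps_inv *%R 1 e q -> grouplike_series q ->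
  (map2 (TA (BA X)) (map2 (Inc X) (g, e))) =
  (gl_val g, cauchy ba_ext (q - monom 0 1) g).
Proof.
move=> eq gq; have [b1 b2] := ba_ext_bilin.
congr (_, _); rewrite /=.
have -> : inc_I_val e = adj_incl \o e.
  apply/funext => n; rewrite /inc_I_val /=; case: eqP => [->|/eqP n0].
    by rewrite gl_one adj_incl1.
  have ce : counit I (e n) = 0.
    apply: (@grouplike_counit _ _ (gl_val e)); last by rewrite lt0n.
    by split; [exact: gl_one|exact: gl_comul].
  by rewrite ba_pureE// /adj_incl ce.
have -> : fps_inv (@adj_mul _ _) (adj_one _) (adj_incl \o e) = adj_incl \o q.
  apply: (fps_inv_unique (@adj_mul_bilin _) (@adj_mulA _) (@adj_mul1 _) (@adj_mulr1 _)).
  have ml x y : cauchy (@adj_mul _ _) (adj_incl \o x) (adj_incl \o y) =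
      adj_incl \o cauchy *%R x y.
    rewrite (lin_cauchy _ _ _ adj_incl_lin) cauchy_comp.
    by apply: eq_cauchy => i j; rewrite adj_inclM.
  by split; rewrite ml (eq.1, eq.2) (lin_monom _ _ adj_incl_lin) adj_incl1.
apply/funext => n; apply: eq_bigr => i _ /=.
rewrite [LHS]ract_ba_ext mul1r.
transitivity (ba_ext (q i - monom 0 1 (i : nat)) (g (n - i)%N)); last by [].
rewrite (linB (b1 _)) /monom; case: eqP => _.
  by rewrite ba_ext1 subr0.
by rewrite (lin0 (b1 _)) subr0.
Qed.

End BASeries.

(** * Formal linear differential equations *)

Section FormalODE.
Variables (R : realType).

Lemma pcV_cauchy (U V W : lmodType R[i]) (op : U -> V -> W) (a : R -> fps U) (Y : R -> fps V) :
  bilin op -> (forall n, pcV (a ^~ n)) -> (forall n, pcV (Y ^~ n)) ->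
  forall n, pcV (fun t => cauchy op (a t) (Y t) n).
Proof.
move=> ob pa pY n; apply: (pcV_sum (index_enum 'I_n.+1)
  (g := fun (i : 'I_n.+1) t => op (a t i) (Y t (n - i)%N))) => i.
exact: (pcV_bilin (g := a ^~ i) (g' := Y ^~ (n - i)%N)).
Qed.

Lemma prim01_cauchy (U V W : lmodType R[i]) (op : U -> V -> W)
    (f f1 : R -> fps U) (g g1 : R -> fps V) : bilin op ->
  is_primitive01_fps f f1 -> is_primitive01_fps g g1 ->
  is_primitive01_fps (fun t => cauchy op (f t) (g t))
    (fun t => cauchy op (f1 t) (g t) + cauchy op (f t) (g1 t)).
Proof.
move=> ob hf hg n.
have := @prim01_sum R W 'I_n.+1 (index_enum _) (fun i t => op (f t i) (g t (n - i)%N))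
  (fun i t => op (f1 t i) (g t (n - i)%N) + op (f t i) (g1 t (n - i)%N))
  (fun i => prim01_bilin ob (hf i) (hg (n - i)%N)).
move=> h; apply: (prim01_eq (E := [::]) h) => // t _ _.
by rewrite big_split.
Qed.

Lemma prim01_fps_lin (V W : lmodType R[i]) (phi : V -> W) (f g : R -> fps V) :
  linear phi -> is_primitive01_fps f g ->
  is_primitive01_fps (fun t => phi \o f t) (fun t => phi \o g t).
Proof. by move=> pl h n; exact: (prim01_lin pl (h n)). Qed.

Lemma prim01_fps_cst (V : lmodType R[i]) (v : fps V) :
  is_primitive01_fps (fun=> v) (fun=> 0).
Proof. by move=> n; exact: prim01_cst. Qed.

Lemma prim01_fps_eq (V : lmodType R[i]) (f f' g g' : R -> fps V) :
  is_primitive01_fps f g -> (forall t, 0 <= t <= 1 -> f t = f' t) ->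
  (forall t, 0 < t < 1 -> g t = g' t) -> is_primitive01_fps f' g'.
Proof.
move=> h e1 e2 n; apply: (prim01_eq (E := [::]) (h n)) => t ht; first by rewrite e1.
by rewrite e2.
Qed.

Section Solutions.
Variables (U V : lmodType R[i]) (op : U -> V -> V) (a : R -> fps U).
Hypotheses (ob : bilin op) (a0 : forall t, a t 0%N = 0) .

(** [op] is left free: the equation occurs with left and right multiplication, commutators, the zero
    product and coderivations of a tensor square. *)
Definition solves (Y : R -> fps V) :=
  is_primitive01_fps Y (fun t => cauchy op (a t) (Y t)).

Lemma solves_unique Y Z t0 : 0 <= t0 <= 1 -> solves Y -> solves Z -> Y t0 = Z t0 ->
  forall t, 0 <= t <= 1 -> Y t = Z t.
Proof.
move=> ht0 hY hZ e t ht; apply/funext => n; elim/ltn_ind: n t ht => n ih t ht.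
apply: (prim01_unique (E := [::]) (hY n) (hZ n) _ ht0) => //; last by rewrite e.
move=> x /andP[x0 x1] _; rewrite !cauchy_low//; apply: eq_bigr => i _.
rewrite ih//; last by rewrite !ltW.
by rewrite ltn_subrL/= (leq_ltn_trans _ (ltn_ord i)).
Qed.

Hypothesis ap : forall n, pcV (a ^~ n).
Variables (t0 : R) (v0 : fps V).
Hypothesis ht0 : 0 <= t0 <= 1.

(** The coefficient of degree [n], chosen as a primitive of terms of lower degree. [approx n] stores
    the coefficients of degree below [n] and 0 elsewhere. *)
Let step (G : nat -> R -> V) n : R -> V := xget 0 [set f | f t0 = v0 n /\
  is_primitive01 f (fun t => \sum_(i < n) op (a t i.+1) (G (n - i.+1)%N t))].

Let approx := fix F n : nat -> R -> V :=
  if n is n'.+1 then fun k => if k == n' then step (F n') n' else F n' k else fun _ _ => 0.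

Lemma solves_exists : exists Y, Y t0 = v0 /\ solves Y.
Proof.
have FE n k : (k < n)%N -> approx n k = approx k.+1 k.
  elim: n => // n ih; rewrite ltnS leq_eqVlt => /orP[/eqP ->//|kn] /=.
  by rewrite (ltn_eqF kn) eqxx ih//= eqxx.
have spec n : approx n.+1 n t0 = v0 n /\ is_primitive01 (approx n.+1 n)
    (fun t => \sum_(i < n) op (a t i.+1) (approx n (n - i.+1)%N t)).
  elim/ltn_ind: n => n ih; rewrite /= eqxx /step; case: xgetP => [f _ //|h]; exfalso.
  have [|f [h1 h2]] := @prim01_exists _ _ (fun t =>
      \sum_(i < n) op (a t i.+1) (approx n (n - i.+1)%N t)) t0 (v0 n) _ ht0.
    apply: (pcV_sum (index_enum 'I_n)
      (g := fun (i : 'I_n) t => op (a t i.+1) (approx n (n - i.+1)%N t))) => i.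
    apply: (pcV_bilin (g := a ^~ i.+1) (g' := approx n (n - i.+1)%N)) => //.
    have hi : (n - i.+1 < n)%N by rewrite ltn_subrL/= (leq_ltn_trans _ (ltn_ord i)).
    by rewrite FE//; have [_ /pcV_prim] := ih _ hi.
  by apply: (h f).
exists (fun t n => approx n.+1 n t); split; first by apply/funext => n; have [] := spec n.
move=> n; have [_ h] := spec n; apply: (prim01_eq (E := [::]) h) => // t _ _.
rewrite cauchy_low//; apply: eq_bigr => i _; rewrite FE//.
by rewrite ltn_subrL/= (leq_ltn_trans _ (ltn_ord i)).
Qed.

End Solutions.

Lemma solves_lin (U V U' V' : lmodType R[i]) (op : U -> V -> V) (op' : U' -> V' -> V')
    (a : R -> fps U) (a' : R -> fps U') (phi : V -> V') Y : linear phi ->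
  (forall t y, 0 < t < 1 -> phi \o cauchy op (a t) y = cauchy op' (a' t) (phi \o y)) ->
  solves op a Y -> solves op' a' (fun t => phi \o Y t).
Proof.
move=> pl h hY; apply: (prim01_fps_eq (prim01_fps_lin pl hY)) => // t ht.
exact: h.
Qed.

Section InversePair.
Variable H : algType R[i].
Implicit Types (a p q : R -> fps H).

Lemma flip_bilin : bilin (fun x y : H => y * x).
Proof. exact: (bilin_flip (mulr_bilin H)). Qed.

(** The product [p q] has zero derivative. The product [q p] solves the commutator equation
    [Y' = a Y - Y a], which the constant 1 also solves; uniqueness concludes in both cases. *)
Lemma inverse_pair a p q t0 : 0 <= t0 <= 1 -> (forall t, a t 0%N = 0) ->
  solves *%R a q -> solves (fun x y : H => y * x) (fun t => - a t) p ->
  q t0 = monom 0 1 -> p t0 = monom 0 1 ->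
  forall t, 0 <= t <= 1 -> is_fps_inv *%R 1 (p t) (q t).
Proof.
move=> ht0 a0 hq hp q0 p0 t ht; have mb := mulr_bilin H.
have one2 : cauchy *%R (monom 0 1) (monom 0 1) = monom 0 (1 : H).
  by rewrite cauchy_monom0//; apply/funext => n /=; rewrite mul1r.
have pE s : cauchy (fun x y : H => y * x) (- a s) (p s) = - cauchy *%R (p s) (a s).
  by rewrite (cauchyNl _ _ flip_bilin) [in RHS]cauchyC.
split.
  (* The zero product presents a constant as a solution of a linear equation, so that
     [solves_unique] applies. *)
  pose zop (x y : H) : H := 0.
  have zb : bilin zop by split=> ? ? ? ?; rewrite /zop scaler0 addr0.
  have z0 (x y : fps H) : cauchy zop x y = 0 by apply/funext => n; rewrite /cauchy big1.
  have h1 : solves zop a (fun t => cauchy *%R (p t) (q t)).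
    apply: (prim01_fps_eq (prim01_cauchy mb hp hq)) => // s hs.
    by rewrite z0 pE (cauchyNl _ _ mb) acauchyA addNr.
  have h2 : solves zop a (fun=> monom 0 1).
    by apply: (prim01_fps_eq (prim01_fps_cst (monom 0 1))) => // s hs; rewrite z0.
  by apply: (solves_unique zb a0 ht0 h1 h2 _ ht); rewrite p0 q0.
pose cop (x y : H) : H := x * y - y * x.
have cb : bilin cop.
  split=> [y|x] c s s'; rewrite /cop; cbv beta.
    by rewrite mb.1 mb.2 scalerBr opprD addrACA.
  by rewrite mb.1 mb.2 scalerBr opprD addrACA.
have cE x y : cauchy cop x y = cauchy *%R x y - cauchy *%R y x.
  rewrite [in X in _ - X]cauchyC; apply/funext => n.
  rewrite [RHS](_ : _ = cauchy *%R x y n - cauchy (fun u v => v * u) x y n)// /cauchy -sumrB.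
  by [].
have h1 : solves cop a (fun t => cauchy *%R (q t) (p t)).
  apply: (prim01_fps_eq (prim01_cauchy mb hq hp)) => // s hs.
  rewrite cE pE !acauchyA; congr (_ + _).
  by rewrite (cauchyNr _ _ mb).
have h2 : solves cop a (fun=> monom 0 1).
  apply: (prim01_fps_eq (prim01_fps_cst (monom 0 1))) => // s hs; rewrite cE.
  have -> : cauchy *%R (a s) (monom 0 1) = a s.
    by rewrite cauchy_monom0r//; apply/funext => n /=; rewrite mulr1.
  have -> : cauchy *%R (monom 0 1) (a s) = a s.
    by rewrite cauchy_monom0//; apply/funext => n /=; rewrite mul1r.
  by rewrite subrr.
by apply: (solves_unique cb a0 ht0 h1 h2 _ ht); rewrite p0 q0.
Qed.

End InversePair.

Section GroupLikeSolution.
Variables (H : hopfAlg R[i]) (op : H -> H -> H) (a : R -> fps H).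

(** The Leibniz extension of [op x] to the tensor square; for multiplication by a primitive [x] it
    is multiplication by the coproduct of [x]. *)
Definition coderiv (x : H) (t : tens H H) : tens H H :=
  tlift (fun y z => op x y ⊗ z + y ⊗ op x z) t.

Hypotheses (ob : bilin op) (a0 : forall t, a t 0%N = 0)
  (aprim : forall t n, primitive (a t n))
  (opC : forall x y, primitive x -> comul H (op x y) = coderiv x (comul H y)).

Lemma coderiv_bi x : bilin (fun y z => op x y ⊗ z + y ⊗ op x z).
Proof.
split=> [z|y] c s t; cbv beta.
  by rewrite ob.2 !pureDl !pureZl scalerDr addrACA.
by rewrite ob.2 !pureDr !pureZr scalerDr addrACA.
Qed.

Lemma coderiv_bilin : bilin coderiv.
Proof.
split=> [t|x]; last exact: tlift_linear (coderiv_bi x).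
apply: tlift_param => y z c s s'.
by rewrite !ob.1 pureDl pureDr pureZl pureZr scalerDr addrACA.
Qed.

(** The coproduct of [Y] and [Y ⊗ Y] solve the same equation, driven by [coderiv], with the same
    initial value. *)
Lemma solves_grouplike Y t0 : 0 <= t0 <= 1 -> solves op a Y -> Y t0 = monom 0 1 ->
  forall t, 0 <= t <= 1 -> grouplike_series (Y t).
Proof.
move=> ht0 hY Y0 t ht; split.
  have := hY 0%N; set f := (fun t => Y t _) => hf.
  have -> : 1 = monom 0 1 0%N :> H by [].
  apply: (prim01_unique (E := [::]) hf (prim01_cst _) _ ht0) => //; last by rewrite /f Y0.
  by move=> x hx _; rewrite cauchy_low// big_ord0.
suff e : comul H \o Y t = cauchy (@pure _ H H) (Y t) (Y t) by move=> n; rewrite -e.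
have h1 : solves coderiv a (fun t => comul H \o Y t).
  apply: (solves_lin _ _ hY) => [c x y|s y hs]; first by rewrite linearP.
  apply/funext => m; rewrite /= /cauchy linear_sum.
  by apply: eq_bigr => i _; rewrite opC.
have h2 : solves coderiv a (fun t => cauchy (@pure _ H H) (Y t) (Y t)).
  apply: (prim01_fps_eq (prim01_cauchy (@pure_bilin _ _ _) hY hY)) => // s hs.
  have pb := @pure_bilin _ H H.
  pose L1 x t := tlift (fun y z : H => op x y ⊗ z) t.
  pose L2 x t := tlift (fun y z : H => y ⊗ op x z) t.
  have b1 x : bilin (fun y z : H => op x y ⊗ z).
    by split=> [z|y] c u v; cbv beta; rewrite ?ob.2 ?(pb.1 _)// (pb.2 _).
  have b2 x : bilin (fun y z : H => y ⊗ op x z).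
    by split=> [z|y] c u v; cbv beta; rewrite ?ob.2 ?(pb.1 _)// (pb.2 _).
  have L1b : bilin L1.
    split=> [u|x]; last exact: tlift_linear.
    by apply: tlift_param => y z c v v'; rewrite ob.1 (pb.1 _).
  have L2b : bilin L2.
    split=> [u|x]; last exact: tlift_linear.
    by apply: tlift_param => y z c v v'; rewrite ob.1 (pb.2 _).
  have -> : cauchy coderiv (a s) (cauchy (@pure _ H H) (Y s) (Y s)) =
      cauchy L1 (a s) (cauchy (@pure _ H H) (Y s) (Y s)) +
      cauchy L2 (a s) (cauchy (@pure _ H H) (Y s) (Y s)).
    apply/funext => n; rewrite [RHS](_ : _ = cauchy L1 (a s) (cauchy (@pure _ H H) (Y s) (Y s)) n +
      cauchy L2 (a s) (cauchy (@pure _ H H) (Y s) (Y s)) n)// /cauchy -big_split.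
    by apply: eq_bigr => i _; rewrite /coderiv /tlift /sum2 big_split.
  congr (_ + _).
    by apply: cauchyA => // x y z; rewrite /L1 tlift_pure.
  rewrite [LHS]cauchyC [in RHS](cauchyC (@pure _ H H)).
  apply: cauchyA => //; first exact: bilin_flip.
  by move=> x y z; rewrite /L2 tlift_pure.
apply: (solves_unique coderiv_bilin a0 ht0 h1 h2 _ ht).
rewrite Y0 cauchy_monom0; last exact: pure_bilin.
have cl : linear (comul H) by move=> c x y; rewrite linearP.
by rewrite (lin_monom _ _ cl) comul1 (lin_monom _ _ ((@pure_bilin _ H H).2 1)).
Qed.

End GroupLikeSolution.

Section GroupLikeProduct.
Variable H : hopfAlg R[i].
Implicit Types x y : H.

Lemma comulM_primitivel x y : primitive x -> comul H (x * y) = coderiv *%R x (comul H y).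
Proof.
move=> px; rewrite comulM px.
have b : bilin (fun x' x'' : H => tlift (fun y' y'' => (x' * y') ⊗ (x'' * y'')) (comul H y)).
  split=> [u|u]; apply: tlift_param => y' y'' c v v'; rewrite mulrDl -scalerAl.
    by rewrite pureDl pureZl.
  by rewrite pureDr pureZr.
rewrite (linD (tlift_linear b)) !tlift_pure// /coderiv /tlift /sum2 -big_split.
by apply: eq_bigr => z _; rewrite /= !mul1r.
Qed.

Lemma comulM_primitiver x y : primitive x ->
  comul H (y * x) = coderiv (fun x y => y * x) x (comul H y).
Proof.
move=> px; rewrite comulM px; apply: eq_tlift => y' y''.
have b : bilin (fun x' x'' : H => (y' * x') ⊗ (y'' * x'')).
  by split=> [u|u] c v v'; cbv beta; rewrite mulrDr -scalerAr ?pureDl ?pureZl// pureDr pureZr.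
by rewrite (linD (tlift_linear b)) !tlift_pure// !mulr1.
Qed.

Lemma solves_grouplike_l (a Y : R -> fps H) t0 : (forall t, a t 0%N = 0) ->
  (forall t n, primitive (a t n)) -> 0 <= t0 <= 1 -> solves *%R a Y -> Y t0 = monom 0 1 ->
  forall t, 0 <= t <= 1 -> grouplike_series (Y t).
Proof.
by move=> a0 pa; apply: solves_grouplike => //; [exact: mulr_bilin|exact: comulM_primitivel].
Qed.

Lemma solves_grouplike_r (a Y : R -> fps H) t0 : (forall t, a t 0%N = 0) ->
  (forall t n, primitive (a t n)) -> 0 <= t0 <= 1 -> solves (fun x y : H => y * x) a Y ->
  Y t0 = monom 0 1 -> forall t, 0 <= t <= 1 -> grouplike_series (Y t).
Proof.
by move=> a0 pa; apply: solves_grouplike => //; [exact: flip_bilin|exact: comulM_primitiver].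
Qed.

Lemma primitiveN x : primitive x -> primitive (- x).
Proof.
move=> /primitiveP h; apply/primitiveP.
by rewrite -scaleN1r (linZ (@primitive_defect_lin _ H)) h scaler0.
Qed.

Lemma primitive0 : primitive (0 : H).
Proof. by apply/primitiveP; exact: lin0 (@primitive_defect_lin _ H). Qed.

Lemma primitive_monom k x n : primitive x -> primitive (monom k x n).
Proof. by rewrite /monom; case: eqP => // _ _; exact: primitive0. Qed.

Lemma transport_pair (a : R -> fps H) t0 : 0 <= t0 <= 1 -> (forall t, a t 0%N = 0) ->
  (forall n, pcV (a ^~ n)) -> (forall t n, primitive (a t n)) ->
  exists p q : R -> fps H,
    [/\ solves *%R a q, solves (fun x y : H => y * x) (fun t => - a t) p,
        q t0 = monom 0 1, p t0 = monom 0 1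
      & forall t, 0 <= t <= 1 -> [/\ is_fps_inv *%R 1 (p t) (q t),
          grouplike_series (p t) & grouplike_series (q t)]].
Proof.
move=> ht0 a0 ap aprim; have mb := mulr_bilin H.
have Na0 t : (- a t) 0%N = 0 by rewrite [LHS](_ : _ = - a t 0%N)// a0 oppr0.
have oppl : linear (-%R : H -> H) by move=> c x y; rewrite opprD scalerN.
have Nap n : pcV (fun t => (- a t) n) by exact: (pcV_lin oppl (ap n)).
have [q [q0 hq]] := solves_exists mb a0 ap (monom 0 1) ht0.
have [p [p0 hp]] := solves_exists (flip_bilin H) Na0 Nap (monom 0 1) ht0.
exists p, q; split=> // t ht; split.
- exact: (inverse_pair ht0 a0 hq hp q0 p0 ht).
- by apply: (solves_grouplike_r Na0 _ ht0 hp p0 ht) => s n; exact: primitiveN.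
- exact: (solves_grouplike_l a0 aprim ht0 hq q0 ht).
Qed.

End GroupLikeProduct.
End FormalODE.

(** * Families of functions over the square *)

Section SquareFamilies.
Variables (R : realType) (cs : seq (R * R * R)).
Local Notation mu := (@lebesgue_measure R).
Local Notation sq := (@square R).
Implicit Types T : set R.

Let in01E (s : R) : `[0, 1]%classic s = (0 <= s <= 1 :> bool).
Proof. by rewrite /= in_itv. Qed.

Let open01 (s : R) : `[0, 1]%classic s -> \forall x \near within `[0, 1] (nbhs s), `[0, 1]%classic x.
Proof. by move=> _; rewrite near_withinE; apply: nearW. Qed.

Lemma levels_open (s : R) : (`[0, 1] `&` [set s | s \notin levels cs]) s ->
  \forall x \near within `[0, 1] (nbhs s), (`[0, 1] `&` [set s | s \notin levels cs]) x.
Proof.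
move=> [_ h]; rewrite near_withinE.
have : nbhs s [set s | s \notin levels cs] by apply: open_nbhs_nbhs; split=> //; exact: open_notin.
by apply: filterS => x h1 h2.
Qed.

Section Classes.
Variable V : lmodType R[i].
Implicit Types (g Y : R * R -> V).

(** One finite presentation serves all admissible rows at once, which piecewise continuity of each
    row separately would not give. *)
Definition regV T g := exists (I : finType) (e : I -> V) (c : I -> R * R -> R) B,
  [/\ 0 <= B, forall i, regc T (bad1 cs) B (c i)
    & forall u s, T s -> 0 < u < 1 -> u \notin bad1 cs s -> g (u, s) = fcomb e (c ^~ (u, s))].

(** Continuity holds on the whole closed square, and the coefficients have derivatives in u: these
    are the properties required of the weights in Stokes. *)
Definition sqrep Y := exists (I : finType) (e : I -> V) (c d : I -> R * R -> R) B,
  [/\ 0 <= B, forall y, sq y -> Y y = fcomb e (c ^~ y),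
      forall i y, sq y -> `|c i y| <= B /\ c i x @[x --> within sq (nbhs y)] --> c i y,
      forall i, regc `[0, 1] (bad1 cs) B (d i)
    & forall i u s, 0 <= s <= 1 -> 0 < u < 1 -> u \notin bad1 cs s ->
        is_derive u 1 (fun u => c i (u, s)) (d i (u, s))].

Lemma regV_weak T T' g : T' `<=` T -> regV T g -> regV T' g.
Proof.
move=> TT [I [e [c [B [B0 h1 h2]]]]]; exists I, e, c, B; split=> //.
  by move=> i; exact: regcS (h1 i).
by move=> u s /TT; exact: h2.
Qed.

Lemma regV_eq T g g' : (forall u s, T s -> 0 < u < 1 -> u \notin bad1 cs s -> g (u, s) = g' (u, s)) ->
  regV T g -> regV T g'.
Proof.
move=> e' [I [e [c [B [B0 h1 h2]]]]]; exists I, e, c, B; split=> //.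
by move=> u s Ts hu hb; rewrite -e'// h2.
Qed.

Lemma regV_cst T (v : V) : regV T (fun=> v).
Proof.
exists unit, (fun=> v), (fun _ _ => 1), `|1|; split=> //.
  by move=> _; exact: regc_cst.
by move=> u s _ _ _; rewrite /fcomb (big_pred1 tt)/= ?scale1r// => -[].
Qed.

Lemma regc_bound T B B' c : B <= B' -> regc T (bad1 cs) B c -> regc T (bad1 cs) B' c.
Proof.
move=> BB h u s Ts hu hb; have [h1 h2] := h u s Ts hu hb.
by split=> //; exact: le_trans BB.
Qed.

Lemma regVD T g g' : regV T g -> regV T g' -> regV T (fun y => g y + g' y).
Proof.
move=> [I [e [c [B [B0 h1 h2]]]]] [J [e' [c' [B' [B'0 h1' h2']]]]].
exists (I + J)%type, (fun x => match x with inl i => e i | inr j => e' j end),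
  (fun x => match x with inl i => c i | inr j => c' j end), (B + B'); split.
- by rewrite addr_ge0.
- case=> i; first by apply: regc_bound (h1 i); rewrite lerDl.
  by apply: regc_bound (h1' i); rewrite lerDr.
- move=> u s Ts hu hb; rewrite h2// h2'// fcombD.
  by apply: eq_bigr => -[].
Qed.

Lemma regV_sum T (J : Type) (r : seq J) (g : J -> R * R -> V) :
  (forall j, regV T (g j)) -> regV T (fun y => \sum_(j <- r) g j y).
Proof.
move=> h; elim: r => [|j r ih].
  by apply: (regV_eq _ (regV_cst T 0)) => u s _ _ _; rewrite big_nil.
by apply: (regV_eq _ (regVD (h j) ih)) => u s _ _ _; rewrite big_cons.
Qed.

(** When the coefficients have the form [l k (g y)], regularity of the family reduces to that of its
    functionals. *)
Lemma regV_dual T g m (b : 'I_m -> V) (l : 'I_m -> V -> R) :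
  (forall k, exists B, 0 <= B /\ regc T (bad1 cs) B (fun y => l k (g y))) ->
  (forall y, g y = lincomb b (fun k => l k (g y))) -> regV T g.
Proof.
move=> h e; have [B hB] := choice h.
exists 'I_m, b, (fun k y => l k (g y)), (\sum_k B k); split=> //.
  by apply: sumr_ge0 => k _; have [] := hB k.
move=> k; have [_ h2] := hB k; apply: regc_bound h2.
by rewrite (bigD1 k)//= lerDl; apply: sumr_ge0 => j _; have [] := hB j.
Qed.

Lemma regV_pcV T g s : T `<=` `[0, 1] -> T s -> regV T g -> pcV (fun u => g (u, s)).
Proof.
move=> T01 Ts [I [e [c [B [B0 h1 h2]]]]].
exists (bad1 cs s), B, I, e, (fun i u => c i (u, s)); split.
  by move=> i; exact: (regc_pcw T01 Ts (h1 i)).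
by move=> u hu hb; rewrite h2.
Qed.

Lemma regV_vint01 g : regV (`[0, 1] `&` [set s | s \notin levels cs]) g ->
  pcV (fun s => vint01 (fun u => g (u, s))).
Proof.
set T := _ `&` _; have T01 : T `<=` `[0, 1] by move=> s [].
move=> [I [e [c [B [B0 h1 h2]]]]].
exists (levels cs), B, I, e, (fun i s => \int[mu]_(u in `[0, 1]) c i (u, s)); split.
  move=> i s hs hl.
  have hs' : 0 <= s <= 1 by have /andP[? ?] := hs; rewrite !ltW.
  have Ts : T s by split => //=; rewrite in_itv.
  split.
    apply: (param_prim_bound T01 (h1 i) B0 (y := (1, s))) => //.
    by split; rewrite /= in_itv/=; [exact: in01_1|].
  have := param_int_cvg T01 levels_open (h1 i) (in01_1 R) Ts.
  apply: cvg_trans => A; rewrite /nbhs/= /within/=.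
  by apply: filterS2 (near_open01 hs) => x hx; apply; rewrite in_itv.
move=> s hs hl.
have hs' : 0 <= s <= 1 by have /andP[? ?] := hs; rewrite !ltW.
have Ts : T s by split => //=; rewrite in_itv.
apply: (pcV_vint01 (E := bad1 cs s) (B := B)).
  by move=> i; exact: (regc_pcw T01 Ts (h1 i)).
by move=> u hu hb; rewrite h2.
Qed.

Lemma sqrep_regV Y : sqrep Y -> regV `[0, 1] Y.
Proof.
move=> [I [e [c [d [B [B0 h1 h2 h3 h4]]]]]]; exists I, e, c, B; split=> //.
  move=> i; apply: regc_continuous => // y hy; first by have [] := h2 i y hy.
  by move=> _; have [_] := h2 i y hy.
move=> u s Ts /andP[u0 u1] hb; apply: h1; split=> //.
by rewrite /= in_itv/= !ltW.
Qed.

Lemma sqrep_eq Y Y' : (forall y, sq y -> Y y = Y' y) -> sqrep Y -> sqrep Y'.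
Proof.
move=> e' [I [e [c [d [B [B0 h1 h2 h3 h4]]]]]]; exists I, e, c, d, B; split=> //.
by move=> y hy; rewrite -e'// h1.
Qed.

Lemma sqrep_slice Y u : 0 <= u <= 1 -> sqrep Y -> exists (I : finType) (e : I -> V) (c : I -> R -> R),
  (forall s, 0 <= s <= 1 -> Y (u, s) = fcomb e (c ^~ s)) /\
  forall i, {within `[0, 1], continuous (c i)}.
Proof.
move=> hu [I [e [c [d [B [B0 h1 h2 h3 h4]]]]]].
exists I, e, (fun i s => c i (u, s)); split.
  by move=> s hs; rewrite h1//; split; rewrite /= in_itv.
move=> i; apply/subspace_continuousP => s Ts.
have hy : sq (u, s) by split; rewrite //= in_itv.
have [_ h] := h2 i _ hy.
exact: (cvg_comp _ _ (@cvg_slice2 R `[0, 1]%classic u s hu (@subset_refl _ _)) h).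
Qed.

Lemma regV_prim g (v0 : V) : regV `[0, 1] g -> exists Y, sqrep Y /\
  forall s, 0 <= s <= 1 -> Y (0, s) = v0 /\ is_primitive01 (fun u => Y (u, s)) (fun u => g (u, s)).
Proof.
move=> [I [e [c [B [B0 h1 h2]]]]].
have T01 : `[0, 1]%classic `<=` (`[0, 1]%classic : set R) by [].
(* The index [None] carries the initial value, with constant coefficient 1. *)
pose e' (x : option I) := if x is Some i then e i else v0.
pose C (x : option I) (y : R * R) : R :=
  if x is Some i then \int[mu]_(v in `[0, y.1]) c i (v, y.2) else 1.
pose D (x : option I) (y : R * R) : R := if x is Some i then c i y else 0.
have hsq y : sq y -> `[0, 1]%classic y.2 by case.
have hD x : regc `[0, 1] (bad1 cs) (B + 1) (D x).
  case: x => [i|]; first by apply: regc_bound (h1 i); rewrite lerDl.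
  apply: (@regc_bound _ `|0|); first by rewrite normr0 addr_ge0.
  exact: regc_cst.
have hder x u s : 0 <= s <= 1 -> 0 < u < 1 -> u \notin bad1 cs s ->
    is_derive u 1 (fun u => C x (u, s)) (D x (u, s)).
  move=> hs hu hb; case: x => [i|]; last exact: is_derive_cst.
  have Ts : `[0, 1]%classic s by rewrite in01E.
  exact: (param_prim_derive T01 (h1 i) Ts hu hb).
have hC x y : sq y -> `|C x y| <= B + 1 /\ C x z @[z --> within sq (nbhs y)] --> C x y.
  move=> hy; case: x => [i|] /=.
    split; first by apply: (le_trans (param_prim_bound T01 (h1 i) B0 hy (hsq _ hy))); rewrite lerDl.
    exact: (param_prim_cvg T01 open01 (h1 i) B0 hy (hsq _ hy)).
  by split; [rewrite normr1 lerDr|exact: cvg_cst].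
exists (fun y => fcomb e' (C ^~ y)); split.
  exists (option I), e', C, D, (B + 1); split=> //.
  by rewrite addr_ge0.
move=> s hs; split.
  rewrite /fcomb (bigD1 None)//= scale1r big1 ?addr0// => -[i|]//= _.
  by rewrite set_itv1 Rintegral_set1 scale0r.
apply/prim01P; exists (bad1 cs s), (option I), e', (fun x u => C x (u, s)), (fun x u => D x (u, s)).
split=> //.
  move=> x; apply/subspace_continuousP => u Tu.
  have hy : sq (u, s) by split; rewrite //= in_itv.
  have [_ h] := hC x _ hy.
  apply: (cvg_comp _ _ _ h).
  move=> A; rewrite /within /= => hA.
  have : (z, s) @[z --> u] --> (u, s).
    by apply: (@cvg_pair _ _ _ (nbhs u) (nbhs u) (nbhs s)); [exact: cvg_id|exact: cvg_cst].
  move=> /(_ _ hA) /= hA'.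
  change (nbhs u [set z | `[0, 1]%classic z -> A (z, s)]).
  change (nbhs u [set z | sq (z, s) -> A (z, s)]) in hA'.
  by apply: filterS hA' => z hz Tz; apply: hz; split; rewrite //= in_itv.
move=> u hu hb; split=> [x|]; first exact: hder.
rewrite /fcomb (bigD1 None)//= scale0r add0r h2 ?in01E//.
rewrite /fcomb (reindex_omap Some id) => [|[i|]]//=.
by apply: eq_bigl => i; rewrite eqxx.
Qed.

End Classes.

Lemma regV_bilin (U V W : lmodType R[i]) (op : U -> V -> W) T g g' : bilin op ->
  regV T g -> regV T g' -> regV T (fun y => op (g y) (g' y)).
Proof.
move=> ob [I [e [c [B [B0 h1 h2]]]]] [J [e' [c' [B' [B'0 h1' h2']]]]].
exists (I * J)%type, (fun p => op (e p.1) (e' p.2)), (fun p y => c p.1 y * c' p.2 y), (B * B'); split.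
- by rewrite mulr_ge0.
- by move=> p; exact: regcM.
- by move=> u s Ts hu hb; rewrite h2// h2'// fcomb_bilin.
Qed.

Lemma regV_lin (V W : lmodType R[i]) (phi : V -> W) T g : linear phi ->
  regV T g -> regV T (fun y => phi (g y)).
Proof.
move=> pl [I [e [c [B [B0 h1 h2]]]]]; exists I, (phi \o e), c, B; split=> //.
by move=> u s Ts hu hb; rewrite h2// lin_fcomb.
Qed.

Lemma regV_cauchy (U V W : lmodType R[i]) (op : U -> V -> W) T
    (a : R * R -> fps U) (Y : R * R -> fps V) : bilin op ->
  (forall n, regV T (fun y => a y n)) -> (forall n, regV T (fun y => Y y n)) ->
  forall n, regV T (fun y => cauchy op (a y) (Y y) n).
Proof.
move=> ob ha hY n; apply: (regV_sum (index_enum 'I_n.+1)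
  (g := fun (i : 'I_n.+1) y => op (a y i) (Y y (n - i)%N))) => i.
exact: regV_bilin (ha i) (hY _).
Qed.

(** The solutions are given row by row, with no relation between rows. By induction on the degree,
    [regV_prim] builds a jointly continuous primitive, and uniqueness on each row identifies it with
    the given coefficient. *)
Lemma sqrep_solution (U V : lmodType R[i]) (op : U -> V -> V) (a : R * R -> fps U)
    (Y : R * R -> fps V) (v0 : fps V) : bilin op -> (forall y, a y 0%N = 0) ->
  (forall n, regV `[0, 1] (fun y => a y n)) ->
  (forall s, 0 <= s <= 1 -> Y (0, s) = v0 /\
    solves op (fun u => a (u, s)) (fun u => Y (u, s))) ->
  forall n, sqrep (fun y => Y y n).
Proof.
move=> ob a0 ha hY; elim/ltn_ind => n ih.
have hn (i : 'I_n) : (n - i.+1 < n)%N by rewrite ltn_subrL/= (leq_ltn_trans _ (ltn_ord i)).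
have [Z [hZ hZ']] : exists Z, sqrep Z /\ forall s, 0 <= s <= 1 -> Z (0, s) = v0 n /\
    is_primitive01 (fun u => Z (u, s))
      (fun u => \sum_(i < n) op (a (u, s) i.+1) (Y (u, s) (n - i.+1)%N)).
  apply: (@regV_prim V (fun y => \sum_(i < n) op (a y i.+1) (Y y (n - i.+1)%N)) (v0 n)).
  apply: (regV_sum (index_enum 'I_n)
    (g := fun (i : 'I_n) y => op (a y i.+1) (Y y (n - i.+1)%N))) => i.
  by apply: regV_bilin => //; apply: sqrep_regV; exact: ih.
apply: (sqrep_eq _ hZ) => -[u s] [/= hu hs]; rewrite !in_itv/= in hu hs.
have [z0 pz] := hZ' s hs; have [y0 py] := hY s hs.
have := @prim01_unique R V [::] _ _ _ _ 0 pz (py n).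
apply => //; last by rewrite z0 y0.
- by move=> t _ _; rewrite cauchy_low.
- exact: in01_0.
Qed.

End SquareFamilies.

Section DualSystems.
Variables (R : realType) (V : lmodType R[i]).

Definition dual m (b : 'I_m -> V) (lam : 'I_m -> V -> R) v := v = lincomb b (fun k => lam k v).

Lemma dual_lincomb m (b : 'I_m -> V) lam n (e : 'I_n -> V) (c : 'I_n -> R) :
  (forall k, rlin (lam k)) -> (forall i, dual b lam (e i)) -> dual b lam (lincomb e c).
Proof.
move=> hl he; rewrite /dual {2}/lincomb.
under eq_bigr => k _ do rewrite (rlin_lincomb _ _ (hl k)) rmorph_sum scaler_suml.
rewrite exchange_big; apply: eq_bigr => i _ /=.
rewrite {1}(he i) scaler_sumr; apply: eq_bigr => k _.
by rewrite scalerA -rmorphM.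
Qed.

(** The pulled back connection and the image of [m_1] meet in one integral and must be expanded in a
    common system. *)
Lemma dual_system2 n (e : 'I_n -> V) n' (e' : 'I_n' -> V) :
  exists m (b : 'I_m -> V) (lam : 'I_m -> V -> R),
    [/\ forall k, rlin (lam k), forall i, dual b lam (e i) & forall i, dual b lam (e' i)].
Proof.
have [m [b [lam [hl h]]]] := dual_system (fun i : 'I_(n + n') =>
  match fintype.split i with inl j => e j | inr j => e' j end).
exists m, b, lam; split=> // i.
  by have := h (lshift n' i); rewrite (unsplitK (inl _ i)).
by have := h (rshift n i); rewrite (unsplitK (inr _ i)).
Qed.

Lemma rlin_vderive (U : normedModType R) (f : U -> V) (x v : U) w l : rlin l ->
  is_vderive f x v w -> l w = 'D_v (l \o f) x.
Proof.
move=> hl [n [e [c [h1 h2 ->]]]]; rewrite (rlin_lincomb _ _ hl).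
have hs : is_derive x v (\sum_i (l (e i) \*: c i)) (\sum_i l (e i) *: 'D_v (c i) x).
  by apply: is_derive_sum => i; apply: is_deriveZ; apply/derivableP.
have : is_derive x v (l \o f) (\sum_i l (e i) *: 'D_v (c i) x).
  apply: near_eq_is_derive hs; apply: filterS h1 => y hy.
  by rewrite /= hy (rlin_lincomb _ _ hl) fct_sumE; apply: eq_bigr => i _; rewrite /= mulrC.
by move=> h; rewrite derive_val; apply: eq_bigr => i _; rewrite mulrC.
Qed.

End DualSystems.

Section QuotientDerive.
Variable R : realType.

Lemma quotient_derive (f : R -> R) (a d : R) :
  (f s - f a) / (s - a) @[s --> a^'] --> d -> is_derive a 1 f d.
Proof.
move=> h; have h' : t^-1 *: (f (t *: 1 + a) - f a) @[t --> 0^'] --> d.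
  have sh : t + a @[t --> 0^'] --> a^'.
    move=> A [r /= r0 hA]; exists r => //= z hz z0; apply: hA.
      by move: hz; rewrite /= sub0r normrN opprD addrCA subrr addr0 normrN.
    by rewrite -subr_eq0 addrK.
  have := cvg_comp _ _ sh h; apply: cvg_trans; apply: near_eq_cvg.
  by near=> t; rewrite /= /GRing.scale/= mulr1 addrK mulrC.
by apply: DeriveDef; [apply/cvg_ex; exists d|exact: cvg_lim].
Unshelve. all: by end_near. Qed.

Lemma prim01_derive_unique (V : lmodType R[i]) (f g g' : R -> V) :
  is_primitive01 f g -> is_primitive01 f g' ->
  exists E : seq R, forall t, 0 < t < 1 -> t \notin E -> g t = g' t.
Proof.
move=> /prim01_rlin[E h] /prim01_rlin[E' h']; exists (E ++ E') => t ht.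
rewrite mem_cat negb_or => /andP[tE tE']; apply: rlin_ext => l hl.
have [_ /(_ t ht tE) d1] := h l hl; have [_ /(_ t ht tE') d2] := h' l hl.
by rewrite -(@derive_val _ _ _ _ _ _ _ d1) -(@derive_val _ _ _ _ _ _ _ d2).
Qed.

Lemma vint01_sum (V : lmodType R[i]) (J : Type) (r : seq J) (g : J -> R -> V) :
  (forall j, pcV (g j)) ->
  vint01 (fun t => \sum_(j <- r) g j t) = \sum_(j <- r) vint01 (g j).
Proof.
move=> h; elim: r => [|j r ih].
  rewrite big_nil (_ : (fun t => _) = fun=> 0); last by apply/funext => t; rewrite big_nil.
  by rewrite (vint01_prim (prim01_cst (0 : V)) (pcV_cst 0)) subrr.
rewrite big_cons -ih -vint01D//; last exact: pcV_sum.
by congr (vint01 _); apply/funext => t; rewrite big_cons.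
Qed.

End QuotientDerive.

(** * Pullback of a form along a 1-path *)

Section Curves.
Variables (R : realType) (M : manifold R).

Lemma cimg_chart (c : chart R M (mdim M)) (p : M) : cdom c p -> cimg c (cmap c p).
Proof. by move=> h; exists p. Qed.

Lemma form1_span (V : lmodType R[i]) (w : form1 M V) : exists n (e : 'I_n -> V),
  forall c x v, matlas c -> cimg c x -> exists k, w c x v = lincomb e k.
Proof.
have [n [e he]] := f1_smooth w; exists n, e => c x v cA hx.
by have [a [_ h2]] := he c cA; exists (fun i => a i x v); exact: h2.
Qed.

Lemma form2_span (V : lmodType R[i]) (m : form2 M V) : exists n (e : 'I_n -> V),
  forall c x v v', matlas c -> cimg c x -> exists k, m c x v v' = lincomb e k.
Proof.
have [n [e he]] := f2_smooth m; exists n, e => c x v v' cA hx.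
by have [a [_ h2]] := he c cA; exists (fun i => a i x v v'); exact: h2.
Qed.

Lemma iterD_fst (W : normedModType R) (vs : seq (R * R)) (f : R -> W) :
  Pilot.Defs.iterD vs (f \o fst) = Pilot.Defs.iterD (map fst vs) f \o fst.
Proof.
by elim: vs => //= v vs ->.
Qed.

Lemma smooth_on_fst (W : normedModType R) (N : set R) (f : R -> W) :
  smooth_on N f -> smooth_on (fst @^-1` N) (f \o fst : R * R -> W).
Proof.
move=> h vs x Nx; rewrite iterD_fst; apply: differentiable_comp; last exact: h.
by apply: (@linear_differentiable _ _ _ (@fst R R : {linear _ -> _})) => z; exact: cvg_fst.
Qed.

(* A curve is viewed as the family (u, s) |-> g u. *)
Lemma path1_pcV (V : lmodType R[i]) (w : form1 M V) (g : path1 M) : pcV (pull1 w g).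
Proof.
have [k [t [t0 tk ht]]] := p1_pw g.
(* Four half-planes cut out the strip of the square over the i-th smooth piece of the path, so that
   the results on polygons apply. *)
pose E i : seq (R * R * R) := [:: (-1, 0, - t i); (1, 0, t i.+1); (0, -1, 0); (0, 1, 1)].
have pE i y : polygon (E i) y <-> t i <= y.1 <= t i.+1 /\ 0 <= y.2 <= 1.
  split=> [h|[/andP[h1 h2] /andP[h3 h4]]].
    have h1 := h (-1, 0, - t i); have h2 := h (1, 0, t i.+1).
    have h3 := h (0, -1, 0); have h4 := h (0, 1, 1).
    rewrite !inE !eqxx ?orbT /= in h1 h2 h3 h4.
    have {}h1 := h1 isT; have {}h2 := h2 isT; have {}h3 := h3 isT; have {}h4 := h4 isT.
    by split; apply/andP; split; lra.
  by move=> e; rewrite !inE => /or4P[] /eqP -> /=; lra.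
pose G (y : R * R) := g y.1; pose P := [seq E i | i <- iota 0 k].
have Gc : {within @square R, continuous G}.
  apply/subspace_continuousP => y [hy _].
  have /subspace_continuousP/(_ _ hy) h := @p1_cont _ _ g.
  apply: (cvg_comp _ _ _ h) => N; rewrite /within /= => hN.
  have : nbhs y (fst @^-1` [set x | `[0, 1]%classic x -> N x]) by exact: (cvg_fst hN).
  by apply: filterS => z hz [z1 _]; exact: hz.
have Pcov y : square y -> exists2 F, F \in P & polygon F y.
  move=> [/= hy1 hy2]; rewrite !in_itv/= in hy1 hy2; have /andP[y0 y1] := hy1.
  suff [i ik hi] : exists2 i, (i < k)%N & t i <= y.1 <= t i.+1.
    by exists (E i); [apply: map_f; rewrite mem_iota|exact/pE].
  have ex : exists j, (j <= k)%N && (y.1 <= t j) by exists k; rewrite leqnn tk.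
  case: (ex_minnP ex) => -[|i] /andP[ik yi] imin.
    have k0 : (0 < k)%N.
      by case: (k) tk => [/eqP|//]; rewrite t0 eq_sym oner_eq0.
    by exists 0%N => //; have [] := ht 0%N k0; rewrite t0 in yi *; lra.
  exists i => //; rewrite yi andbT leNgt; apply/negP => /ltW yi'.
  by have := imin i; rewrite yi' (ltnW ik) ltnn => /(_ isT).
have Psm F : F \in P -> smooth_into (polygon F) G.
  move=> FP; have [i iP ->] := seq.mapP FP; move: iP; rewrite mem_iota => /andP[_ ik].
  move=> y /pE[hy1 hy2].
  have [_ /(_ y.1)] := ht i ik; rewrite /= in_itv/= => /(_ hy1)[c [N [f [cA oN Ny fN h]]]].
  exists c, (fst @^-1` N), (f \o fst); split=> //.
  - by apply: open_comp => // z _; exact: cvg_fst.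
  - exact: smooth_on_fst.
  - by move=> z Nz /pE[hz _]; apply: h; rewrite //= in_itv.
have [n [e he]] := form1_span w.
have [m [b [lam [hl hd]]]] := dual_system e.
have h1 k' := pull1_regc Gc Pcov Psm w (hl k').
have := @regV_dual R (flatten P) V `[0, 1]%classic (fun y => pullv G w (1, 0) y) m b lam h1.
case=> [y|I [f [c [B [B0 h2 h3]]]]].
  have [cA hc] := chart_atP (G y).
  rewrite /pullv; have [k' ->] := he _ _ ('D_(1, 0) (cmap (chart_at (G y)) \o G) y) cA (cimg_chart hc).
  exact: dual_lincomb.
have T0 : `[0, 1]%classic (0 : R) by rewrite /= in_itv/= lexx ler01.
have := regV_pcV (@subset_refl _ _) T0 (ex_intro _ I (ex_intro _ f (ex_intro _ c (ex_intro _ B (And3 B0 h2 h3))))).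
by congr pcV; apply/funext => u.
Qed.

End Curves.

(** * Transport along a curve *)

Section Transport.
Variables (R : realType) (X : hopfXmod R[i]) (M : manifold R).
Variable A : hopf2conn X M.
Hypothesis hA : fully_primitive A.
Local Notation H := (hH X).
Local Notation I := (hI X).

Lemma pull1_primitive (g : R -> M) t : primitive (pull1 (omega A) g t).
Proof.
have [cA hc] := chart_atP (g t); exact: (hA cA (cimg_chart hc)).1.
Qed.

Lemma pull2_primitive G u s :
  primitive (pull2 (conn_m1 A) G u s) /\ primitive (pull2 (conn_m2 A) G u s).
Proof.
have [cA hc] := chart_atP (G (u, s)); exact: (hA cA (cimg_chart hc)).2.
Qed.

Definition rate (g : R -> M) t : fps H := monom 1 (pull1 (omega A) g t).

Lemma rate0 g t : rate g t 0%N = 0. Proof. by []. Qed.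

Lemma pcV_monom (V : lmodType R[i]) k (f : R -> V) : pcV f ->
  forall n, pcV (fun t => monom k (f t) n).
Proof.
move=> pf n; rewrite /monom; case: (n == k); first exact: pf.
exact: pcV_cst.
Qed.

Section Curve.
Variable g : R -> M.
Hypothesis pg : pcV (pull1 (omega A) g).

Lemma holP_sol_spec t0 : 0 <= t0 <= 1 ->
  holP_sol A g t0 t0 = monom 0 1 /\ solves *%R (rate g) (holP_sol A g t0).
Proof.
move=> ht0; rewrite /holP_sol; case: xgetP => [P _ //|h].
have [P [P0 hP]] := solves_exists (mulr_bilin H) (rate0 g) (pcV_monom 1 pg) (monom 0 1) ht0.
by have := h P; case.
Qed.

Lemma solves_eq (U V : lmodType R[i]) (op : U -> V -> V) a Y Y' :
  (forall t, 0 <= t <= 1 -> Y t = Y' t) -> solves op a Y -> solves op a Y'.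
Proof.
move=> e h; apply: (prim01_fps_eq h e) => t /andP[t0 t1].
by rewrite e// !ltW.
Qed.

Lemma solves_mulr (B : algType R[i]) (a Y : R -> fps B) c : solves *%R a Y ->
  solves *%R a (fun t => cauchy *%R (Y t) c).
Proof.
move=> h; have mb := mulr_bilin B.
apply: (prim01_fps_eq (prim01_cauchy mb h (prim01_fps_cst c))) => // t ht.
rewrite acauchyA [X in _ + X](_ : _ = 0) ?addr0//.
by apply/funext => n; apply: big1 => i _; rewrite mulr0.
Qed.

(** As t varies, [holP A g 0 t] takes one value from each of the solutions based at t, so no
    equation in t comes with it. Multiplied on the right by [q t], the solution based at t takes the
    value [q t] there, hence coincides with [q]; at 0 this makes [holP A g 0 t] a left inverse of
    [q t], that is [p t]. *)
Lemma holP_pair :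
  [/\ solves *%R (rate g) (fun t => holP A g t 0),
      solves (fun x y : H => y * x) (fun t => - rate g t) (fun t => holP A g 0 t),
      holP A g 0 0 = monom 0 1
    & forall t, 0 <= t <= 1 -> [/\ is_fps_inv *%R 1 (holP A g 0 t) (holP A g t 0),
        grouplike_series (holP A g 0 t) & grouplike_series (holP A g t 0)]].
Proof.
have h0 := in01_0 R; have mb := mulr_bilin H.
have prate t n : primitive (rate g t n) by apply: primitive_monom; exact: pull1_primitive.
have [p [q [hq hp q0 p0 hpq]]] :=
  transport_pair h0 (rate0 g) (pcV_monom 1 pg) prate.
have qE t : 0 <= t <= 1 -> q t = holP A g t 0.
  have [e0 hs] := holP_sol_spec h0.
  by apply: (solves_unique mb (rate0 g) h0 hq hs); rewrite q0 e0.
have pE t : 0 <= t <= 1 -> p t = holP A g 0 t.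
  move=> ht; have [et hs] := holP_sol_spec ht; have [[_ qp] _ _] := hpq t ht.
  have := solves_unique mb (rate0 g) ht hq (solves_mulr (q t) hs).
  rewrite et hcauchy1l => /(_ erefl 0 h0); rewrite q0 => e.
  by rewrite -[RHS]hcauchy1r -qp -acauchyA -/(holP A g 0 t) -e hcauchy1l.
split.
- exact: solves_eq qE hq.
- exact: solves_eq pE hp.
- by rewrite -qE.
- by move=> t ht; rewrite -qE// -pE//; exact: hpq.
Qed.

Lemma finv_holP : Pilot.Defs.finv (holP A g 1 0) = holP A g 0 1.
Proof.
have [_ _ _ /(_ 1 (in01_1 R))[h _ _]] := holP_pair.
by apply: hmul_inv_unique; exact: is_fps_invC.
Qed.

End Curve.
End Transport.

(** * Variation of the transport *)

Section SeriesIdentities.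
Variables (R : realType) (B : algType R[i]).
Implicit Types (p q al be ph : fps B).

(** The middle factor sits in degree 1, whence the shift from [m.+1] to [m]. *)
Lemma cauchy_mid (x y : fps B) v m :
  cauchy *%R (cauchy *%R x (monom 1 v)) y m.+1 = \sum_(i < m.+1) x i * v * y (m - i)%N.
Proof.
have e j : cauchy *%R x (monom 1 v) j = if (0 < j)%N then x j.-1 * v else 0.
  rewrite cauchyC (cauchy_monoml _ _ _ _ (flip_bilin B)).
  by case: j => //= j; rewrite subn1.
rewrite /Defs.cauchy big_ord_recl -[X in X * _]/(cauchy *%R x (monom 1 v) 0%N) e mul0r add0r.
apply: eq_bigr => i _; rewrite -[X in X * _]/(cauchy *%R x (monom 1 v) i.+1) e /=.
by rewrite /bump /= add1n subSS.
Qed.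

Lemma cauchy_mid0 (x y : fps B) v : cauchy *%R (cauchy *%R x (monom 1 v)) y 0%N = 0.
Proof.
rewrite /Defs.cauchy big_ord_recl big_ord0 addr0 [X in X * _]big_ord_recl big_ord0 addr0.
by rewrite /monom mulr0 mul0r.
Qed.

Lemma cauchy_monom11 (x y : B) : cauchy *%R (monom 1 x) (monom 1 y) = monom 2 (x * y).
Proof.
apply/funext => n; rewrite (cauchy_monoml _ _ _ _ (mulr_bilin B)).
by case: n => [|[|[|n]]] //=; rewrite /monom //= mulr0.
Qed.

Lemma monomB (V : lmodType R[i]) k (x y : V) : monom k (x - y) = monom k x - monom k y.
Proof.
apply/funext => n; rewrite [RHS](_ : _ = monom k x n - monom k y n)//.
by rewrite /monom; case: eqP => // _; rewrite subr0.
Qed.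

Lemma series_raddf (V W : lmodType R[i]) (f : V -> W) (x y : fps V) : linear f ->
  f \o (x + y) = (f \o x) + (f \o y).
Proof. by move=> fl; apply/funext => n; exact: (linD fl). Qed.

Lemma commutator_monom (x y : B) :
  cauchy *%R (monom 1 x) (monom 1 y) - cauchy *%R (monom 1 y) (monom 1 x) =
  monom 2 (x * y - y * x).
Proof. by rewrite !cauchy_monom11 monomB. Qed.

(** [ph] stands for the pulled back dω, [al] and [be] for ω on the u- and s-derivatives of Γ. The
    subtracted sum is the u-derivative of [p be q] with [be] held fixed, and the bracket on the
    right is supplied by ∂(m_2). *)
Lemma curvature_terms p q al be ph :
  cauchy *%R (cauchy *%R p ph) q -
  (cauchy *%R (cauchy *%R (cauchy (fun x y => y * x) (- al) p) be) q +
   cauchy *%R (cauchy *%R p be) (cauchy *%R al q)) =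
  cauchy *%R (cauchy *%R p (ph + (cauchy *%R al be - cauchy *%R be al))) q.
Proof.
have mb := mulr_bilin B.
rewrite (cauchyC (fun x y => y * x)) (cauchyNr _ _ mb) !(cauchyNl _ _ mb).
rewrite !(cauchyDr _ _ _ mb) !(cauchyNr _ _ mb) !(cauchyDl _ _ _ mb) !(cauchyNl _ _ mb).
by rewrite !acauchyA opprD opprK.
Qed.

Lemma difference_terms p q al al' :
  cauchy *%R (cauchy (fun x y => y * x) (- al) p) q + cauchy *%R p (cauchy *%R al' q) =
  - cauchy *%R (cauchy *%R p (al - al')) q.
Proof.
have mb := mulr_bilin B.
rewrite (cauchyC (fun x y => y * x)) (cauchyNr _ _ mb) !(cauchyNl _ _ mb).
rewrite !(cauchyDr _ _ _ mb) !(cauchyNr _ _ mb) !(cauchyDl _ _ _ mb) !(cauchyNl _ _ mb).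
by rewrite opprD opprK !acauchyA.
Qed.

End SeriesIdentities.

(** When [f] has no integral, [vint01] takes the default 0, which lies in the kernel too.
    Primitivity of integrals thus holds on every row, exceptional ones included. *)
Lemma vint01_ker (R : realType) (V W : lmodType R[i]) (phi : V -> W) f : linear phi ->
  (forall t, phi (f t) = 0) -> phi (vint01 f) = 0.
Proof.
move=> pl h; rewrite /vint01; case: xgetP => [v _ hv|_]; last exact: lin0.
apply: (@is_vint01_unique _ _ (phi \o f)).
  have [n [e [c [h1 h2 h3]]]] := hv; exists n, (phi \o e), c; split=> //.
    apply: (filterS (F := almost_everywhere (@lebesgue_measure R))) h1 => t ht /ht /= ->.
    by rewrite /lincomb (lin_sum pl); apply: eq_bigr => i _; rewrite (linZ pl).
  by rewrite h3 /lincomb (lin_sum pl); apply: eq_bigr => i _; rewrite (linZ pl).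
exists 0%N, (fun=> 0), (fun _ _ => 0); split=> [||] //.
- by apply: nearW => t _; rewrite /= h /lincomb big_ord0.
- by case.
- by rewrite /lincomb big_ord0.
Qed.

Lemma primitive_sum (R : realType) (B : hopfAlg R[i]) (J : Type) (r : seq J) (f : J -> B) :
  (forall j, primitive (f j)) -> primitive (\sum_(j <- r) f j).
Proof.
move=> h; apply/primitiveP; rewrite (lin_sum (@primitive_defect_lin _ B)) big1// => j _.
exact/primitiveP.
Qed.

Section Slices.
Variable R : realType.
Local Notation sq := (@square R).

Lemma in_square (u s : R) : 0 <= u <= 1 -> 0 <= s <= 1 -> sq (u, s).
Proof. by move=> hu hs; split; rewrite /= in_itv. Qed.

Lemma in01W (u : R) : 0 < u < 1 -> 0 <= u <= 1.
Proof. by move=> /andP[h1 h2]; rewrite !ltW. Qed.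

Lemma slice_within (f : R * R -> R) s : 0 <= s <= 1 ->
  (forall y, sq y -> f x @[x --> within sq (nbhs y)] --> f y) ->
  {within `[0, 1], continuous (fun u => f (u, s))}.
Proof.
move=> hs hf; apply/subspace_continuousP => u Tu.
have hy : sq (u, s) by split; rewrite //= in_itv.
apply: (cvg_comp _ _ _ (hf _ hy)) => N; rewrite /within /= => hN.
have : (z, s) @[z --> u] --> (u, s).
  by apply: (@cvg_pair _ _ _ (nbhs u) (nbhs u) (nbhs s)); [exact: cvg_id|exact: cvg_cst].
move=> /(_ _ hN) /= hN'.
change (nbhs u [set z | `[0, 1]%classic z -> N (z, s)]).
change (nbhs u [set z | sq (z, s) -> N (z, s)]) in hN'.
by apply: filterS hN' => z hz Tz; apply: hz; split; rewrite //= in_itv.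
Qed.

Lemma slice_pcw (J : finType) (f : J -> R * R -> R) D i s :
  (forall i y, sq y -> `|f i y| <= D /\ f i x @[x --> within sq (nbhs y)] --> f i y) ->
  0 <= s <= 1 -> pcw 0 1 [::] D (fun u => f i (u, s)).
Proof.
move=> hf hs u hu _; have [h1 h2] := hf i _ (in_square (in01W hu) hs); split=> //.
exact: (cvg_comp _ _ (cvg_slice1 hu hs) h2).
Qed.

Lemma slice_prim (V : lmodType R[i]) (J : finType) (e : J -> V) (c d : J -> R * R -> R) B cs s
    (Y : R * R -> V) : 0 <= s <= 1 -> (forall y, sq y -> Y y = fcomb e (c ^~ y)) ->
  (forall i y, sq y -> `|c i y| <= B /\ c i x @[x --> within sq (nbhs y)] --> c i y) ->
  (forall i u s, 0 <= s <= 1 -> 0 < u < 1 -> u \notin bad1 cs s ->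
     is_derive u 1 (fun u => c i (u, s)) (d i (u, s))) ->
  is_primitive01 (fun u => Y (u, s)) (fun u => fcomb e (d ^~ (u, s))).
Proof.
move=> hs hY hc hcd; apply/prim01P.
exists (bad1 cs s), J, e, (fun i u => c i (u, s)), (fun i u => d i (u, s)); split.
- by move=> u hu; rewrite hY//; exact: in_square.
- by move=> i; apply: slice_within => // y hy; have [] := hc i y hy.
- by move=> u hu hb; split=> // i; exact: hcd.
Qed.

Lemma le_sum_norm (J : finType) (f : J -> R) j : f j <= \sum_i `|f i|.
Proof.
apply: (le_trans (ler_norm _)); rewrite (bigD1 j)//= lerDl.
by apply: sumr_ge0.
Qed.

End Slices.

Section Variation.
Variables (R : realType) (X : hopfXmod R[i]) (M : manifold R).
Variable A : hopf2conn X M.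
Variables (G : R * R -> M) (P : seq (seq (R * R * R))).
Hypotheses (Gc : {within @square R, continuous G})
  (Pcov : forall y, square y -> exists2 E, E \in P & polygon E y)
  (Psm : forall E, E \in P -> smooth_into (polygon E) G)
  (side0 : forall s, 0 <= s <= 1 -> G (0, s) = G (0, 0))
  (side1 : forall s, 0 <= s <= 1 -> G (1, s) = G (1, 0)).
Local Notation H := (hH X).
Local Notation I := (hI X).
Local Notation w := (omega A).
Local Notation cs := (flatten P).
Local Notation sq := (@square R).
Local Notation mu := (@lebesgue_measure R).
Local Notation T := (regular_levels P).

Let a y := pullv G w (1, 0) y.
Let b y := pullv G w (0, 1) y.
Let F y : H := hd X (pull2 (conn_m1 A) G y.1 y.2).

Lemma smooth_on_cst (U W : normedModType R) (D : set U) (v : W) : smooth_on D (cst v : U -> W).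
Proof.
move=> vs x _; suff [k ->] : exists k, Pilot.Defs.iterD vs (cst v : U -> W) = cst k by exact: differentiable_cst.
elim: vs => [|u vs [k ih]]; first by exists v.
by exists 0; apply/funext => z; rewrite /= ih derive_cst.
Qed.

Lemma vderive_form (V : lmodType R[i]) (om : form1 M V) c x v u l : matlas c -> cimg c x ->
  rlin l -> l (vderive (fun y => om c y v) x u) = 'D_u (fun y => l (om c y v)) x.
Proof.
move=> cA hx hl; have [n [e he]] := f1_smooth om; have [al [h1 h2]] := he c cA.
suff : is_vderive (fun y => om c y v) x u (vderive (fun y => om c y v) x u).
  by move=> /(rlin_vderive hl).
have hv : is_vderive (fun y => om c y v) x u (lincomb e (fun i => 'D_u (al i ^~ v) x)).
  exists n, e, (fun i y => al i y v); split=> //.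
    have : \forall y \near x, cimg c y by apply: open_nbhs_nbhs; split=> //; exact: cimg_open.
    by apply: filterS => y hy; rewrite h2.
  by move=> i; apply: diff_derivable; exact: (h1 i v [::] x hx).
by rewrite /vderive; case: xgetP => // /(_ (lincomb e (fun i => 'D_u (al i ^~ v) x))).
Qed.

(** Constant fields have zero bracket, so the exterior derivative reduces to two directional
    derivatives. *)
Lemma ext_d_cst (V : lmodType R[i]) (om : form1 M V) c (v v' x : 'rV[R]_(mdim M)) :
  matlas c -> cimg c x ->
  ext_d om c (cst v) (cst v') x =
  vderive (fun y => om c y v') x v - vderive (fun y => om c y v) x v'.
Proof.
move=> cA hx; rewrite /ext_d.
have -> : lie_bracket (cst v) (cst v') x = 0.
  have d0 (u u' : 'rV[R]_(mdim M)) : 'D_u' (cst u : 'rV[R]_(mdim M) -> 'rV[R]_(mdim M)) x = 0.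
    exact: derive_cst.
  transitivity (0 - 0 : 'rV[R]_(mdim M)); last exact: subr0.
  exact: (f_equal2 (fun p q : 'rV[R]_(mdim M) => p - q) (d0 _ _) (d0 _ _)).
have -> : om c x 0 = 0.
  have := f1_linear om cA hx (-1) 0 0; rewrite scaler0 addr0 => ->.
  by rewrite rmorphN1 scaleN1r addNr.
by rewrite subr0.
Qed.

(** The two tangent vectors of Γ are extended by constant fields of the chart, which turns ∂(m_1) =
    dω into the hypothesis [hF] of the scalar Stokes formula. *)
Lemma curvature_pullback c y (l : H -> R) : rlin l -> matlas c -> sq y -> cdom c (G y) ->
  regv cs (1, 0) y -> regv cs (0, 1) y ->
  l (F y) = 'D_('D_((0, 1) : R * R) (cmap c \o G) y)
          (fun z => l (w c z ('D_((1, 0) : R * R) (cmap c \o G) y))) (cmap c (G y)) -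
        'D_('D_((1, 0) : R * R) (cmap c \o G) y)
          (fun z => l (w c z ('D_((0, 1) : R * R) (cmap c \o G) y))) (cmap c (G y)).
Proof.
move=> hl cA sy hc r1 r2; have hx := cimg_chart hc.
rewrite /F (_ : pull2 _ _ _ _ = pullm G (conn_m1 A) (0, 1) (1, 0) y); last by case: y {sy hc r1 r2 hx}.
rewrite (pullm_chart Pcov Psm _ cA sy hc r2 r1).
set ds := 'D_((0, 1) : R * R) _ _; set du := 'D_((1, 0) : R * R) _ _.
rewrite (@conn_m1_d _ _ _ A c cA (cst ds) (cst du) (smooth_on_cst _) (smooth_on_cst _) _ hx).
rewrite ext_d_cst// (rlinB _ _ hl).
by congr (_ - _); exact: vderive_form.
Qed.

(** [B * B'] bounds the product; its derivative has two terms with that bound, whence the sum. *)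
Lemma weight_product (I1 I2 : finType) (s0 : R) (c d : I1 -> R * R -> R) (c' d' : I2 -> R * R -> R)
    (B B' : R) x y :
  0 < s0 < 1 -> 0 <= B -> 0 <= B' ->
  (forall i y, sq y -> `|c i y| <= B /\ c i x @[x --> within sq (nbhs y)] --> c i y) ->
  (forall i, regc `[0, 1] (bad1 cs) B (d i)) ->
  (forall i u s, 0 <= s <= 1 -> 0 < u < 1 -> u \notin bad1 cs s ->
        is_derive u 1 (fun u => c i (u, s)) (d i (u, s))) ->
  (forall i y, sq y -> `|c' i y| <= B' /\ c' i x @[x --> within sq (nbhs y)] --> c' i y) ->
  (forall i, regc `[0, 1] (bad1 cs) B' (d' i)) ->
  (forall i u s, 0 <= s <= 1 -> 0 < u < 1 -> u \notin bad1 cs s ->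
        is_derive u 1 (fun u => c' i (u, s)) (d' i (u, s))) ->
  weight P s0 (B * B' + B * B') (fun s u => c x (u, s) * c' y (u, s0))
    (fun s u => d x (u, s) * c' y (u, s0) + c x (u, s) * d' y (u, s0)).
Proof.
move=> hs0 B0 B'0 hc hd' hcd hc' hd'' hcd'.
have T01 : `[0, 1]%classic `<=` (`[0, 1]%classic : set R) by [].
have e0 : 0 <= s0 <= 1 by have /andP[h1 h2] := hs0; rewrite !ltW.
have near01 : \forall s \near s0, 0 <= s <= 1 := near_open01 hs0.
have sqE (u s : R) : 0 <= u <= 1 -> 0 <= s <= 1 -> sq (u, s) by move=> hu hs; split; rewrite /= in_itv.
have in01 (u : R) : 0 < u < 1 -> 0 <= u <= 1 by move=> /andP[h1 h2]; rewrite !ltW.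
have lim (f : R * R -> R) (u : R) : 0 <= u <= 1 ->
    f x @[x --> within sq (nbhs (u, s0))] --> f (u, s0) -> f (u, s) @[s --> s0] --> f (u, s0).
  move=> hu hf; have hf' := cvg_comp _ _ (@cvg_slice2 R `[0, 1]%classic u s0 hu T01) hf.
  apply: cvg_trans hf' => N; rewrite /nbhs/= /within/=.
  by apply: filterS2 near01 => z hz; apply; rewrite in_itv.
have BB : 0 <= B * B' by rewrite mulr_ge0.
split.
- near=> s; have hs : 0 <= s <= 1 by near: s.
  apply: within_mul; apply: slice_within => // z hz; first by have [] := hc x z hz.
  by have [] := hc' y z hz.
- near=> s; have hs : 0 <= s <= 1 by near: s.
  move=> u hu; rewrite normrM -[leLHS]addr0; apply: lerD => //.
  by apply: ler_pM => //; [have [] := hc x _ (sqE _ _ hu hs)|have [] := hc' y _ (sqE _ _ hu e0)].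
- near=> s; have hs : 0 <= s <= 1 by near: s.
  move=> u hu; rewrite mem_cat negb_or => /andP[b1 b2].
  by apply: is_derive_mul; [exact: hcd|exact: hcd'].
- near=> s; have hs : 0 <= s <= 1 by near: s.
  have Ts : `[0, 1]%classic s by rewrite /= in_itv.
  have T0 : `[0, 1]%classic s0 by rewrite /= in_itv.
  apply: (pcw_sub (E := (bad1 cs s ++ [::]) ++ ([::] ++ bad1 cs s0)) (B := B * B' + B * B')) => //.
    by move=> z; rewrite cats0.
  apply: pcwD; apply: pcwM; [exact: (regc_pcw T01 Ts (hd' x))|exact: slice_pcw hc' e0|exact: slice_pcw hc hs|].
  exact: (regc_pcw T01 T0 (hd'' y)).
- split=> [u hu|u hu hb].
    apply: cvgM; last exact: cvg_cst.
    by apply: lim => //; have [] := hc x _ (sqE _ _ hu e0).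
  have hu' := in01 _ hu; have T0 : `[0, 1]%classic s0 by rewrite /= in_itv.
  apply: cvgD; apply: cvgM; [|exact: cvg_cst| |exact: cvg_cst].
    by apply: lim => //; have [] := hd' x u s0 T0 hu hb.
  by apply: lim => //; have [] := hc x _ (sqE _ _ hu' e0).
Unshelve. all: by end_near. Qed.

Lemma regc_bad_pcw (V : lmodType R[i]) (om : form1 M V) (l : V -> R) v0 :
  rlin l -> 0 <= v0 <= 1 -> exists B,
  pcw 0 1 (bad1 cs v0) B (fun u => l (pullv G om (1, 0) (u, v0))).
Proof.
move=> hl h0; have [B [B0 hB]] := pull1_regc Gc Pcov Psm om hl; exists B.
have T0 : `[0, 1]%classic v0 by rewrite /= in_itv.
exact: (regc_pcw (@subset_refl _ _) T0 hB).
Qed.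

Lemma fcombB (V : lmodType R[i]) (J : finType) (e : J -> V) (c c' : J -> R) :
  fcomb e c - fcomb e c' = fcomb e (fun i => c i - c' i).
Proof.
rewrite /fcomb -sumrB; apply: eq_bigr => i _.
by rewrite rmorphB scalerBl.
Qed.

Lemma fcomb_triple (I1 I2 : finType) m (e : I1 -> H) (e' : I2 -> H) (bb : 'I_m -> H) c k c' :
  fcomb e c * lincomb bb k * fcomb e' c' =
  fcomb (fun p : I1 * 'I_m * I2 => e p.1.1 * bb p.1.2 * e' p.2)
        (fun p => c p.1.1 * k p.1.2 * c' p.2).
Proof.
rewrite (_ : lincomb bb k = fcomb bb k)// (fcomb_bilin e c bb k (mulr_bilin H)).
by rewrite (fcomb_bilin _ _ e' c' (mulr_bilin H)).
Qed.

Lemma Rint_scale (p q : R) E B (c : R -> R) (k : R) : pcw p q E B c ->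
  \int[mu]_(t in `[p, q]) (c t * k) = (\int[mu]_(t in `[p, q]) c t) * k.
Proof. by move=> h; rewrite RintegralZr//; exact: (pcw_integrable h). Qed.

Lemma dual_connection : exists m (bb : 'I_m -> H) (lam : 'I_m -> H -> R),
  [/\ forall k, rlin (lam k), forall y, dual bb lam (a y), forall y, dual bb lam (b y)
    & forall y, dual bb lam (F y)].
Proof.
have [n [e he]] := form1_span w; have [n' [e' he']] := form2_span (conn_m1 A).
have [m [bb [lam [hl h1 h2]]]] := dual_system2 e (fun i => hd X (e' i)).
exists m, bb, lam; split=> // [y|y|[u s]].
- have [cA hc] := chart_atP (G y).
  rewrite /a /pullv; have [k ->] := he _ _ ('D_((1, 0) : R * R) (cmap (chart_at (G y)) \o G) y) cA (cimg_chart hc).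
  exact: dual_lincomb.
- have [cA hc] := chart_atP (G y).
  rewrite /b /pullv; have [k ->] := he _ _ ('D_((0, 1) : R * R) (cmap (chart_at (G y)) \o G) y) cA (cimg_chart hc).
  exact: dual_lincomb.
- have [cA hc] := chart_atP (G (u, s)).
  rewrite /F /pull2 /=.
  have [k ->] := he' _ _ ('D_((0, 1) : R * R) (cmap (chart_at (G (u, s))) \o G) (u, s))
    ('D_((1, 0) : R * R) (cmap (chart_at (G (u, s))) \o G) (u, s)) cA (cimg_chart hc).
  rewrite (_ : hd X (lincomb e' k) = lincomb (fun i => hd X (e' i)) k); first exact: dual_lincomb.
  by rewrite /lincomb (lin_sum (@hd_lin _ X)); apply: eq_bigr => i _; rewrite (linZ (@hd_lin _ X)).
Qed.

(** [Y] will be a coefficient of the transport on the row s, and [Z] one of the inverse transport on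
    the row s0. Expanding every factor over fixed vectors reduces to scalar Stokes, weighted by the
    product of a coefficient of [Y] and one of [Z]; the derivative of that weight yields the terms
    in [Y1] and [Z1]. *)
Lemma stokes_vector (Y Z : R * R -> H) (Y1 Z1 : R -> H) s0 (l : H -> R) :
  sqrep cs Y -> sqrep cs Z -> 0 < s0 < 1 -> s0 \notin levels cs ->
  is_primitive01 (fun u => Y (u, s0)) Y1 -> is_primitive01 (fun u => Z (u, s0)) Z1 -> rlin l ->
  l (vint01 (fun u => Y (u, s) * (a (u, s) - a (u, s0)) * Z (u, s0))) / (s - s0)
    @[s --> s0^'] -->
  l (vint01 (fun u => Y (u, s0) * F (u, s0) * Z (u, s0) -
    (Y1 u * b (u, s0) * Z (u, s0) + Y (u, s0) * b (u, s0) * Z1 u))).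
Proof.
move=> [I1 [e [c [d [B [B0 hY hc hd' hcd]]]]]] [I2 [e' [c' [d' [B' [B'0 hZ hc' hd'' hcd']]]]]].
move=> hs0 hl0 pY pZ hl.
have e0 : 0 <= s0 <= 1 by have /andP[h1 h2] := hs0; rewrite !ltW.
have T0 : `[0, 1]%classic s0 by rewrite /= in_itv.
have TT0 : T s0 by [].
have T01 : T `<=` `[0, 1] by move=> s [].
have [m [bb [lam [hlam da db dF]]]] := dual_connection.
pose vec (p : I1 * 'I_m * I2) := e p.1.1 * bb p.1.2 * e' p.2.
pose W (p : I1 * 'I_m * I2) s u := c p.1.1 (u, s) * c' p.2 (u, s0).
pose W1 (p : I1 * 'I_m * I2) s u :=
  d p.1.1 (u, s) * c' p.2 (u, s0) + c p.1.1 (u, s) * d' p.2 (u, s0).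
pose q (p : I1 * 'I_m * I2) s u := lam p.1.2 (a (u, s)) - lam p.1.2 (a (u, s0)).
have hW p : weight P s0 (B * B' + B * B') (W p) (W1 p).
  exact: (weight_product p.1.1 p.2 hs0 B0 B'0 hc hd' hcd hc' hd'' hcd').
have rlF k : rlin (lam k \o hd X).
  have [k1 k2] := hlam k; split=> [v v'|r v] /=; first by rewrite raddfD k1.
  by rewrite (linZ (@hd_lin _ X)) k2.
have pF k : exists BF, pcw 0 1 (bad1 cs s0) BF (fun u => lam k (F (u, s0))).
  have [BF [_ hBF]] := pull2_regc Gc Pcov Psm (conn_m1 A) (rlF k); exists BF; exact: (regc_pcw T01 TT0 hBF).
have pb k : exists Bb, pcw 0 1 (bad1 cs s0) Bb (fun u => lam k (b (u, s0))).
  have [Bb [_ hBb]] := pullv2_regc Gc Pcov Psm w (hlam k); exists Bb; exact: (regc_pcw T01 TT0 hBb).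
have lhs : \forall s \near s0^',
    l (vint01 (fun u => Y (u, s) * (a (u, s) - a (u, s0)) * Z (u, s0))) / (s - s0) =
    \sum_p (\int[mu]_(u in `[0, 1]) (W p s u *
       ((lam p.1.2 (a (u, s)) - lam p.1.2 (a (u, s0))) / (s - s0)))) * l (vec p).
  near=> s.
  have hs : 0 <= s <= 1 by near: s; apply: nbhs_dnbhs; exact: near_open01.
  have pq k : exists D, pcw 0 1 (bad1 cs s ++ bad1 cs s0) D
      (fun u => lam k (a (u, s)) - lam k (a (u, s0))).
    have [D1 h1] := regc_bad_pcw w (hlam k) hs; have [D2 h2] := regc_bad_pcw w (hlam k) e0.
    by exists (D1 + D2); apply: pcwD => //; exact: pcwN.
  have [D hD] := choice pq.
  have pcoef p : pcw 0 1 (bad1 cs s ++ bad1 cs s0) (\sum_k `|B * D k * B'|)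
      (fun u => c p.1.1 (u, s) * q p s u * c' p.2 (u, s0)).
    apply: (pcw_sub (E := ([::] ++ (bad1 cs s ++ bad1 cs s0)) ++ [::]) (B := B * D p.1.2 * B')).
    - by move=> z; rewrite cats0.
    - exact: (le_sum_norm (fun k => B * D k * B')).
    - apply: pcwM; last exact: slice_pcw hc' e0.
      by apply: pcwM; [exact: slice_pcw hc hs|exact: hD].
  rewrite (pcV_vint01 (e := vec) pcoef); last first.
    move=> u hu _; rewrite hY ?hZ; [|exact: in_square (in01W hu) e0|exact: in_square (in01W hu) hs].
    rewrite [X in _ * X * _](_ : _ = lincomb bb (fun k => lam k (a (u, s)) - lam k (a (u, s0)))).
      by rewrite fcomb_triple.
    rewrite {1}(da (u, s)) {1}(da (u, s0)); exact: fcombB.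
  rewrite (rlin_fcomb _ _ hl) mulr_suml; apply: eq_bigr => p _.
  rewrite mulrAC -(Rint_scale _ (pcoef p)); congr (_ * _).
  apply: eq_Rintegral => u _; rewrite /W /q mulrAC; ring.
apply: (@cvg_trans _ ((fun s => \sum_p (\int[mu]_(u in `[0, 1]) (W p s u *
       ((lam p.1.2 (a (u, s)) - lam p.1.2 (a (u, s0))) / (s - s0)))) * l (vec p)) @ s0^')).
  by apply: near_eq_cvg; apply: filterS lhs => s ->.
have -> : vint01 (fun u => Y (u, s0) * F (u, s0) * Z (u, s0) -
    (Y1 u * b (u, s0) * Z (u, s0) + Y (u, s0) * b (u, s0) * Z1 u)) =
    fcomb vec (fun p => \int[mu]_(u in `[0, 1])
      (W p s0 u * lam p.1.2 (F (u, s0)) - W1 p s0 u * lam p.1.2 (b (u, s0)))).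
  (* [Y1] and the derivative read from the coefficients belong to the same row of [Y], so they agree
     off a finite set. *)
  have [EY hEY] : exists E : seq R, forall t, 0 < t < 1 -> t \notin E ->
      Y1 t = fcomb e (d ^~ (t, s0)).
    exact: prim01_derive_unique pY (slice_prim e0 hY hc hcd).
  have [EZ hEZ] : exists E : seq R, forall t, 0 < t < 1 -> t \notin E ->
      Z1 t = fcomb e' (d' ^~ (t, s0)).
    exact: prim01_derive_unique pZ (slice_prim e0 hZ hc' hcd').
  have pcoef : exists K, forall p, pcw 0 1 ((bad1 cs s0 ++ EY) ++ EZ) K
      (fun u => W p s0 u * lam p.1.2 (F (u, s0)) - W1 p s0 u * lam p.1.2 (b (u, s0))).
    have [BF hBF] := choice pF; have [Bb hBb] := choice pb.
    exists (\sum_k `|B * B' * BF k + (B * B' + B * B') * Bb k|) => p.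
    have [_ _ _ /nbhs_singleton h4 _] := hW p.
    apply: (pcw_sub (E := (([::] ++ [::]) ++ bad1 cs s0) ++ ((bad1 cs s0 ++ bad1 cs s0) ++ bad1 cs s0))
      (B := B * B' * BF p.1.2 + (B * B' + B * B') * Bb p.1.2)).
    - by move=> z; rewrite !mem_cat !in_nil /=; case: (z \in bad1 cs s0).
    - exact: (le_sum_norm (fun k => B * B' * BF k + (B * B' + B * B') * Bb k)).
    - apply: pcwD; last by apply: pcwN; apply: pcwM.
      apply: pcwM; last exact: hBF.
      by apply: pcwM; [exact: slice_pcw hc e0|exact: slice_pcw hc' e0].
  have [K hK] := pcoef; apply: (pcV_vint01 hK) => u hu.
  rewrite !mem_cat !negb_or => /andP[/andP[_ uY] uZ].
  rewrite hEY// hEZ// hY ?hZ; [|exact: in_square (in01W hu) e0|exact: in_square (in01W hu) e0].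
  rewrite (dF (u, s0)) (db (u, s0)) !fcomb_triple fcombDl fcombB.
  apply: eq_bigr => p _; congr (_%:C%C *: _); rewrite /W /W1.
  rewrite -(dF (u, s0)) -(db (u, s0)); ring.
rewrite (rlin_fcomb _ _ hl); apply: cvg_fsumR => p; apply: cvgMr_tmp.
have [BF hBF] := pF p.1.2.
exact: (@stokes_square _ _ _ _ Gc Pcov Psm _ w _ (hlam p.1.2) (fun y => lam p.1.2 (F y))
  (fun ch y => @curvature_pullback ch y _ (hlam p.1.2)) _ _ _ _ hs0 hl0 (hW p) side0 side1 _ hBF).
Unshelve. all: by end_near. Qed.

Let p s u := holP A (slice G s) 0 u.
Let q s u := holP A (slice G s) u 0.

Lemma pullv1_regV : regV cs `[0, 1] a.
Proof.
have [m [bb [lam [hlam da _ _]]]] := dual_connection.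
by apply: (regV_dual (b := bb) (l := lam)) => // k; exact: pull1_regc.
Qed.

Lemma pullv2_regV : regV cs T b.
Proof.
have [m [bb [lam [hlam _ db _]]]] := dual_connection.
by apply: (regV_dual (b := bb) (l := lam)) => // k; exact: pullv2_regc.
Qed.

Lemma pull2_regV (V : lmodType R[i]) (m : form2 M V) : regV cs T (fun y => pull2 m G y.1 y.2).
Proof.
have [n [e he]] := form2_span m; have [k [bb [lam [hl h]]]] := dual_system e.
apply: (regV_dual (b := bb) (l := lam)) => [j|[u s]]; first exact: pull2_regc.
have [cA hc] := chart_atP (G (u, s)); rewrite /pull2 /=.
have [x ->] := he _ _ ('D_((0, 1) : R * R) (cmap (chart_at (G (u, s))) \o G) (u, s))
    ('D_((1, 0) : R * R) (cmap (chart_at (G (u, s))) \o G) (u, s)) cA (cimg_chart hc).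
exact: dual_lincomb.
Qed.

Lemma slice_pcV s : 0 <= s <= 1 -> pcV (pull1 w (slice G s)).
Proof.
move=> hs; have Ts : `[0, 1]%classic s by rewrite /= in_itv.
rewrite (_ : pull1 w (slice G s) = fun u => a (u, s)); last first.
  by apply/funext => u; exact: pull1_slice.
exact: (regV_pcV (@subset_refl _ _) Ts pullv1_regV).
Qed.

Lemma pullv1_pcV s : 0 <= s <= 1 -> pcV (fun u => a (u, s)).
Proof.
move=> hs; have Ts : `[0, 1]%classic s by rewrite /= in_itv.
exact: (regV_pcV (@subset_refl _ _) Ts pullv1_regV).
Qed.

Lemma regV_monom (V : lmodType R[i]) k T' (g : R * R -> V) : regV cs T' g ->
  forall n, regV cs T' (fun y => monom k (g y) n).
Proof.
move=> hg n; rewrite /monom; case: (n == k); first exact: hg.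
exact: regV_cst.
Qed.

Lemma hd_pull2 u s : hd X (pull2 (conn_m2 A) G u s) =
  a (u, s) * b (u, s) - b (u, s) * a (u, s).
Proof.
have [cA hc] := chart_atP (G (u, s)).
rewrite /pull2 /= (conn_m2_bracket A cA (cimg_chart hc)).
by rewrite opprB.
Qed.

Hypothesis hA : fully_primitive A.

Lemma hol_spec s : 0 <= s <= 1 ->
  [/\ solves *%R (fun u => monom 1 (a (u, s))) (q s),
      solves (fun x y : H => y * x) (fun u => - monom 1 (a (u, s))) (p s),
      p s 0 = monom 0 1
    & forall u, 0 <= u <= 1 -> [/\ is_fps_inv *%R 1 (p s u) (q s u),
        grouplike_series (p s u) & grouplike_series (q s u)]].
Proof.
move=> hs; have := holP_pair hA (slice_pcV hs).
have e : rate A (slice G s) = fun u => monom 1 (a (u, s)).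
  by apply/funext => u; congr (monom 1 _); exact: pull1_slice.
by rewrite e.
Qed.

Lemma hol_q0 s : 0 <= s <= 1 -> q s 0 = monom 0 1.
Proof. by move=> /hol_spec[_ _ h _]. Qed.

Let hp s (hs : 0 <= s <= 1) := hol_spec hs.

(* Failed conversions would otherwise unfold holonomies down to limits of difference quotients. *)
Opaque pull1 pull2 pullv holP vint01.

Lemma hol_sqrep n : sqrep cs (fun y => p y.2 y.1 n) /\ sqrep cs (fun y => q y.2 y.1 n).
Proof.
have oppl : linear (-%R : H -> H) by move=> c x y; rewrite opprD scalerN.
split.
  apply: (@sqrep_solution R cs H H (fun x y => y * x) (fun y => - monom 1 (a y))
     (fun y => p y.2 y.1) (monom 0 1)) => [|y|k|s hs].
  - exact: flip_bilin.
  - by rewrite /monom [LHS](_ : _ = - (0 : H))// oppr0.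
  - exact: (regV_lin oppl (regV_monom 1 pullv1_regV k)).
  - by have [_ h1 h2 _] := hp hs; split.
apply: (@sqrep_solution R cs H H *%R (fun y => monom 1 (a y))
     (fun y => q y.2 y.1) (monom 0 1)) => [|y|k|s hs] //.
- exact: mulr_bilin.
- exact: (regV_monom 1 pullv1_regV k).
- by have [h1 _ h2 _] := hp hs; split.
Qed.

Lemma integrand_regV n : regV cs T (fun y => integrand A G y.2 y.1 n).
Proof.
have T01 : T `<=` `[0, 1] by move=> s [].
apply: (regV_cauchy (a := fun y => p y.2 y.1)
  (Y := fun y => monom 1 (pull2 (conn_m1 A) G y.1 y.2) + monom 2 (pull2 (conn_m2 A) G y.1 y.2))).
- exact: hact_bilin.
- by move=> k; apply: (regV_weak T01); apply: sqrep_regV; have [] := hol_sqrep k.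
- move=> k; apply: regVD; exact: (regV_monom _ (pull2_regV _)).
Qed.

Let Mi s := vint01_fps (integrand A G s).

(** The right side has the shape of the limit in [stokes_vector], with the derivatives of [p] and
    [q] replaced by the right sides of their equations. *)
Lemma hd_integrand s u : 0 <= s <= 1 -> 0 <= u <= 1 ->
  hd X \o integrand A G s u =
  cauchy *%R (cauchy *%R (p s u) (monom 1 (F (u, s)))) (q s u) -
  (cauchy *%R (cauchy *%R (cauchy (fun x y => y * x) (- monom 1 (a (u, s))) (p s u))
       (monom 1 (b (u, s)))) (q s u) +
   cauchy *%R (cauchy *%R (p s u) (monom 1 (b (u, s))))
      (cauchy *%R (monom 1 (a (u, s))) (q s u))).
Proof.
move=> hs hu; have [_ _ _ /(_ u hu)[pq gp _]] := hp hs.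
rewrite /integrand (hd_act_series _ gp pq) curvature_terms.
congr (cauchy _ (cauchy _ _ _) _).
rewrite commutator_monom.
by rewrite (series_raddf _ _ (@hd_lin _ X)) !(lin_monom _ _ (@hd_lin _ X)) hd_pull2.
Qed.

(** The derivative in u of [p s u] times [q s0 u], integrated over [0, 1]. The minus sign comes from
    the equation of [p], whose derivative is minus [p] times the connection. *)
Lemma hol_difference s s0 n : 0 <= s <= 1 -> 0 <= s0 <= 1 ->
  cauchy *%R (p s 1) (q s0 1) n - cauchy *%R (p s 0) (q s0 0) n =
  - vint01 (fun u => cauchy *%R (cauchy *%R (p s u) (monom 1 (a (u, s) - a (u, s0)))) (q s0 u) n).
Proof.
move=> hs hs0; have mb := mulr_bilin H.
have [_ hps _ _] := hp hs; have [hqs _ _ _] := hp hs0.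
have h := prim01_cauchy mb hps hqs n.
have pp k : pcV (fun u => p s u k) := pcV_prim (hps k).
have pq k : pcV (fun u => q s0 u k) := pcV_prim (hqs k).
have pa s1 : 0 <= s1 <= 1 -> pcV (fun u => a (u, s1)) := fun h1 => pullv1_pcV h1.
have oppl : linear (-%R : H -> H) by move=> c x y; rewrite opprD scalerN.
set g := (fun u => cauchy _ _ _ n).
have pg : pcV g.
  apply: (pcV_cauchy mb) => // k; apply: (pcV_cauchy mb) => // j; apply: pcV_monom.
  by apply: pcVD; [exact: pa|exact: (pcV_lin oppl (pa _ hs0))].
have h' : is_primitive01 (fun u => cauchy *%R (p s u) (q s0 u) n) (-%R \o g).
  apply: (prim01_eq (E := [::]) h) => // u hu _.
  rewrite [LHS](_ : _ = (- cauchy *%R (cauchy *%R (p s u) (monom 1 (a (u, s) - a (u, s0)))) (q s0 u)) n)//.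
  by rewrite monomB difference_terms.
by rewrite -(vint01_prim h' (pcV_lin oppl pg)) (vint01_lin oppl pg).
Qed.

Lemma hol_difference_limit s0 (l : H -> R) n : 0 < s0 < 1 -> s0 \notin levels cs -> rlin l ->
  l (cauchy *%R (p s 1) (q s0 1) n - cauchy *%R (p s 0) (q s0 0) n) / (s - s0)
    @[s --> s0^'] --> l (- (hd X \o Mi s0) n).
Proof.
move=> hs0 hl0 hl; have e0 := in01W hs0.
have T01 : T `<=` `[0, 1] by move=> s [].
have TT0 : T s0 by split=> //; rewrite /= in_itv.
have near01 : \forall s \near s0^', 0 <= s <= 1 by apply: nbhs_dnbhs; exact: near_open01.
have mb := mulr_bilin H.
have pint k : pcV (fun u => integrand A G s0 u k) := regV_pcV T01 TT0 (integrand_regV k).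
have -> : (hd X \o Mi s0) n = vint01 (fun u => (hd X \o integrand A G s0 u) n).
  by apply/esym; exact: (vint01_lin (@hd_lin _ X) (pint n)).
rewrite (rlinN _ hl).
apply: (@cvg_trans _ ((fun s => - (l (vint01 (fun u =>
    cauchy *%R (cauchy *%R (p s u) (monom 1 (a (u, s) - a (u, s0)))) (q s0 u) n)) / (s - s0))) @ s0^')).
  apply: near_eq_cvg; apply: filterS near01 => s hs.
  by rewrite hol_difference// (rlinN _ hl) mulNr.
(* In degree 0 both sides vanish, because the connection starts in degree 1. Above, each coefficient
   is a finite sum of products covered by [stokes_vector]. *)
apply: cvgN; case: n => [|m].
  have vz : vint01 (fun=> 0 : H) = 0 by rewrite (vint01_prim (prim01_cst 0) (pcV_cst 0)) subrr.
  have -> : vint01 (fun u => (hd X \o integrand A G s0 u) 0%N) = 0.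
    rewrite -[RHS]vz; apply: (vint01_eq (E := [::])); first exact: (pcV_lin (@hd_lin _ X) (pint 0%N)).
    move=> u hu _; rewrite hd_integrand ?in01W//.
    rewrite -[LHS]/(cauchy *%R (cauchy *%R (p s0 u) (monom 1 (F (u, s0)))) (q s0 u) 0%N - (_ 0%N + _ 0%N)).
    by rewrite !cauchy_mid0 addr0 subr0.
  rewrite (_ : (fun s => _) = fun=> 0); first by rewrite (rlin0 hl); exact: cvg_cst.
  apply/funext => s; rewrite (_ : (fun u => _) = fun=> 0) ?vz ?(rlin0 hl) ?mul0r//.
  by apply/funext => u; rewrite cauchy_mid0.
have [hqs hps _ _] := hp e0.
pose Yi (i : 'I_m.+1) y : H := p y.2 y.1 i.
pose Zi (i : 'I_m.+1) y : H := q y.2 y.1 (m - i)%N.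
pose Y1 (i : 'I_m.+1) u : H := cauchy (fun x y => y * x) (- monom 1 (a (u, s0))) (p s0 u) i.
pose Z1 (i : 'I_m.+1) u : H := cauchy *%R (monom 1 (a (u, s0))) (q s0 u) (m - i)%N.
have pa s1 : 0 <= s1 <= 1 -> pcV (fun u => a (u, s1)) := fun h1 => pullv1_pcV h1.
have oppl : linear (-%R : H -> H) by move=> c x y; rewrite opprD scalerN.
have pY i : pcV (fun u => Yi i (u, s0)) := pcV_prim (hps i).
have pZ i : pcV (fun u => Zi i (u, s0)) := pcV_prim (hqs _).
have pF : pcV (fun u => F (u, s0)).
  exact: (pcV_lin (@hd_lin _ X) (regV_pcV T01 TT0 (pull2_regV (conn_m1 A)))).
have pb : pcV (fun u => b (u, s0)) := regV_pcV T01 TT0 pullv2_regV.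
have pY1 i : pcV (Y1 i).
  apply: (pcV_cauchy (flip_bilin H)) => [k|k]; last exact: pcV_prim (hps k).
  exact: (pcV_lin oppl (pcV_monom 1 (pa _ e0) k)).
have pZ1 i : pcV (Z1 i).
  apply: (pcV_cauchy mb) => [k|k]; last exact: pcV_prim (hqs k).
  exact: (pcV_monom 1 (pa _ e0) k).
pose D i u := Yi i (u, s0) * F (u, s0) * Zi i (u, s0) -
    (Y1 i u * b (u, s0) * Zi i (u, s0) + Yi i (u, s0) * b (u, s0) * Z1 i u).
have pD i : pcV (D i).
  apply: pcVD; first by do 2 apply: (pcV_bilin mb) => //.
  by apply: (pcV_lin oppl); apply: pcVD; do 2 apply: (pcV_bilin mb) => //.
have -> : vint01 (fun u => (hd X \o integrand A G s0 u) m.+1) = \sum_i vint01 (D i).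
  rewrite -(vint01_sum _ pD).
  apply: (vint01_eq (E := [::])); first exact: (pcV_lin (@hd_lin _ X) (pint m.+1)).
  move=> u hu _; rewrite hd_integrand ?in01W//.
  rewrite -[LHS]/(cauchy *%R (cauchy *%R (p s0 u) (monom 1 (F (u, s0)))) (q s0 u) m.+1 - (_ m.+1 + _ m.+1)).
  by rewrite !cauchy_mid -big_split -sumrB.
have hY i : sqrep cs (Yi i) by have [] := hol_sqrep i.
have hZ i : sqrep cs (Zi i) by have [] := hol_sqrep (m - i)%N.
have key i := stokes_vector (hY i) (hZ i) hs0 hl0 (hps i) (hqs (m - i)%N) hl.
rewrite (rlin_sum _ _ _ hl).
apply: (@cvg_trans _ ((fun s => \sum_i l (vint01 (fun u =>
    Yi i (u, s) * (a (u, s) - a (u, s0)) * Zi i (u, s0))) / (s - s0)) @ s0^')); last first.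
  by apply: cvg_fsumR => i; exact: key.
apply: near_eq_cvg; apply: filterS near01 => s hs.
have [_ hps' _ _] := hp hs.
rewrite -mulr_suml -(rlin_sum _ _ _ hl); congr (l _ / _).
rewrite -vint01_sum; last first.
  move=> i; apply: (pcV_bilin mb) => //; apply: (pcV_bilin mb); first exact: pcV_prim (hps' i).
  by apply: pcVD; [exact: pa|exact: (pcV_lin oppl (pa _ e0))].
by congr (vint01 _); apply/funext => u; rewrite cauchy_mid.
Qed.

(* With K = P_s Q_{s0}, the difference P_s(1) - P_{s0}(1) is (K(1) - K(0)) P_{s0}(1). *)
Lemma hol_variation n :
  is_primitive01 (fun s => p s 1 n) (fun s => (- cauchy *%R (hd X \o Mi s) (p s 1)) n).
Proof.
have mb := mulr_bilin H.
have [J [e [c [hc1 hc2]]]] := sqrep_slice (in01_1 R) (hol_sqrep n).1.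
(* Stokes gives the derivative in s only through functionals, and off [levels cs]; continuity in s
   comes from [hol_sqrep]. *)
apply: (prim01_weak (E := levels cs) hc1 hc2) => l s0 hl hs0 hl0.
have e0 := in01W hs0; have [_ _ _ /(_ 1 (in01_1 R))[[_ qp] _ _]] := hp e0.
apply: quotient_derive.
pose K s i := cauchy *%R (p s 1) (q s0 1) i - cauchy *%R (p s 0) (q s0 0) i.
(* The factor [p s0 1], constant in s, is absorbed into the functional. *)
pose li (i : 'I_n.+1) x := l (x * p s0 1 (n - i)%N).
have hli i : rlin (li i).
  have [l1 l2] := hl; split=> [v v'|r v]; rewrite /li; first by rewrite mulrDl l1.
  by rewrite -scalerAl l2.
have near01 : \forall s \near s0^', 0 <= s <= 1 by apply: nbhs_dnbhs; exact: near_open01.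
apply: (@cvg_trans _ ((fun s => \sum_i li i (K s i) / (s - s0)) @ s0^')).
  apply: near_eq_cvg; apply: filterS near01 => s hs.
  rewrite -mulr_suml -(rlinB _ _ hl); congr (_ / _).
  rewrite /li -(rlin_sum _ _ _ hl); congr (l _).
  have [_ _ p0 _] := hp hs.
  have -> : p s 1 n = cauchy *%R (cauchy *%R (p s 1) (q s0 1)) (p s0 1) n.
    by rewrite acauchyA qp hcauchy1r.
  have -> : p s0 1 n = cauchy *%R (cauchy *%R (p s 0) (q s0 0)) (p s0 1) n.
    by rewrite p0 (hol_q0 e0) !hcauchy1l.
  by rewrite /Defs.cauchy -sumrB; apply: eq_bigr => i _; rewrite -mulrBl.
have -> : l ((- cauchy *%R (hd X \o Mi s0) (p s0 1)) n) = \sum_i li i (- (hd X \o Mi s0) i).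
  rewrite /li -(rlin_sum _ _ _ hl); congr (l _).
  rewrite [LHS](_ : _ = - cauchy *%R (hd X \o Mi s0) (p s0 1) n)// /Defs.cauchy -sumrN.
  by apply: eq_bigr => i _; rewrite mulNr.
by apply: cvg_fsumR => i; exact: hol_difference_limit.
Qed.

Lemma Mi0 s : Mi s 0%N = 0.
Proof.
rewrite /Mi /vint01_fps (_ : (fun u => integrand A G s u 0%N) = fun=> 0).
  by rewrite (vint01_prim (prim01_cst 0) (pcV_cst 0)) subrr.
apply/funext => u; rewrite /integrand /Defs.cauchy big_ord_recl big_ord0 addr0.
by rewrite [X in hact _ X](_ : _ = 0 + 0)// addr0 (lin0 ((@hact_bilin _ X).2 _)).
Qed.

Lemma Mi_pcV n : pcV (fun s => Mi s n).
Proof. exact: (regV_vint01 (integrand_regV n)). Qed.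

Lemma integrand_primitive s u n : primitive (integrand A G s u n).
Proof.
have [m1 m2] := pull2_primitive hA G u s.
apply: primitive_sum => i; apply: primitive_act; apply/primitiveP.
rewrite [X in primitive_defect X](_ : _ = monom 1 (pull2 (conn_m1 A) G u s) (n - i)%N +
  monom 2 (pull2 (conn_m2 A) G u s) (n - i)%N)// (linD (@primitive_defect_lin _ _)).
have p1 := primitive_monom 1 (n - i) m1; have p2 := primitive_monom 2 (n - i) m2.
by rewrite (primitiveP _).1// (primitiveP _).1// addr0.
Qed.

Lemma Mi_primitive s n : primitive (Mi s n).
Proof.
apply/primitiveP.
apply: (vint01_ker (f := fun u => integrand A G s u n) (@primitive_defect_lin _ I)) => u.
exact/primitiveP/integrand_primitive.
Qed.

Let Qs s := holQ A G s 0.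

Let Nl : linear (-%R : I -> I). Proof. by move=> c x y; rewrite opprD scalerN. Qed.

(** [e] is obtained from the right-handed equation, so it is group-like as well as inverse to
    [Qs 1]: it is the value of the exact holonomy in the top group. *)
Lemma holQ_pair : exists e : fps I,
  [/\ solves *%R (fun s => - Mi s) Qs, Qs 0 = monom 0 1, is_fps_inv *%R 1 e (Qs 1),
      grouplike_series e & grouplike_series (Qs 1)].
Proof.
have mb := mulr_bilin I; have h0 := in01_0 R; have h1 := in01_1 R.
have a0 s : (- Mi s) 0%N = 0 by rewrite [LHS](_ : _ = - Mi s 0%N)// Mi0 oppr0.
have ap n : pcV (fun s => (- Mi s) n) by exact: (pcV_lin Nl (Mi_pcV n)).
have aprim s n : primitive ((- Mi s) n) by apply: primitiveN; exact: Mi_primitive.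
have [e [q' [hq _ q0 _ hpq]]] := transport_pair h0 a0 ap aprim.
have [Q0 hQ] : Qs 0 = monom 0 1 /\ solves *%R (fun s => - Mi s) Qs.
  rewrite /Qs /holQ /holQ_sol; case: xgetP => [Q _ [Q0 hQ]|].
    by split=> //; apply: (prim01_fps_eq hQ) => // s hs; rewrite (cauchyNl _ _ mb).
  move=> /(_ q')[]; split=> //.
  by apply: (prim01_fps_eq hq) => // s hs; rewrite (cauchyNl _ _ mb).
have qQ := solves_unique mb a0 h0 hq hQ (etrans q0 (esym Q0)) h1.
have [k1 k2 k3] := hpq 1 h1.
by exists (e 1); rewrite -qQ.
Qed.

(** Both sides solve the equation driven by [dM] with value [p 0 1] at 0; for the right side this is
    [hol_variation]. *)
Lemma hd_holQ s : 0 <= s <= 1 -> cauchy *%R (hd X \o Qs s) (p 0 1) = p s 1.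
Proof.
have [e [hQ Q0 _ _ _]] := holQ_pair; have mb := mulr_bilin H.
pose dM s := - (hd X \o Mi s).
have h1 : solves *%R dM (fun s => cauchy *%R (hd X \o Qs s) (p 0 1)).
  apply: solves_mulr; apply: (solves_lin (@hd_lin _ X) _ hQ) => t y ht.
  rewrite (cauchyNl _ _ (mulr_bilin I)) /dM (cauchyNl _ _ mb).
  apply/funext => n; rewrite /= [LHS]raddfN; congr (- _).
  rewrite -[LHS]/(hd X (\sum_(i < n.+1) Mi t i * y (n - i)%N)) (lin_sum (@hd_lin _ X)).
  by apply: eq_bigr => i _; rewrite rmorphM.
have h2 : solves *%R dM (fun s => p s 1).
  by move=> n; apply: (prim01_eq (E := [::]) (hol_variation n)) => // t ht _; rewrite /dM (cauchyNl _ _ mb).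
have a0 t : dM t 0%N = 0.
  by rewrite [LHS](_ : _ = - hd X (Mi t 0%N))// Mi0 (lin0 (@hd_lin _ X)) oppr0.
apply: (solves_unique mb a0 (in01_0 R) h1 h2).
by rewrite Q0 (lin_monom _ _ (@hd_lin _ X)) rmorph1 hcauchy1l.
Qed.

Lemma fuzzyR_holQ : fuzzyR A G = cauchy (@ba_ext _ X) (Qs 1) (p 0 1).
Proof.
have [e [hQ Q0 _ _ _]] := holQ_pair; have bb := @ba_ext_bilin _ X.
have T01 : T `<=` `[0, 1] by move=> s [].
have oppl : linear (-%R : xA (BA X) -> xA (BA X)) by move=> c x y; rewrite opprD scalerN.
(* A primitive of the outer integrand [N1]. It vanishes at 0 because [ba_ext] kills 1, which
   accounts for the 1 subtracted from the holonomy; its sign matches the one in [fuzzyR]. *)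
pose N s := - cauchy (@ba_ext _ X) (Qs s) (p 0 1).
pose N1 s := cauchy (@ba_ext _ X) (Mi s) (p s 1).
have c0 s i : counit I (Mi s i) = 0 by apply: primitive_counit; exact: Mi_primitive.
have hN n : is_primitive01 (fun s => N s n) (fun s => N1 s n).
  have h := prim01_lin oppl (prim01_cauchy bb hQ (prim01_fps_cst (p 0 1)) n).
  apply: (prim01_eq (E := [::]) h) => // s hs _; rewrite /=.
  rewrite -[LHS]/((- (cauchy (@ba_ext _ X) (cauchy *%R (- Mi s) (Qs s)) (p 0 1) +
    cauchy (@ba_ext _ X) (Qs s) 0)) n); congr (_ n).
  rewrite (cauchyNl _ _ (mulr_bilin I)) (cauchyNl _ _ bb) opprD opprK.
  rewrite [cauchy _ _ 0](_ : _ = 0); last first.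
    by apply/funext => k; apply: big1 => i _; rewrite (lin0 (bb.2 _)).
  rewrite subr0 /N1 -(hd_holQ (in01W hs)).
  rewrite [cauchy *%R (hd X \o Qs s) _](_ : _ = cauchy (fun v x => hd X v * x) (Qs s) (p 0 1))//.
  (* [ba_ext_peiffer] applies because, by [c0], the coefficients of [Mi] lie in the kernel of the
     counit. *)
  by apply: cauchyA => // i j k; rewrite ba_ext_peiffer.
have pp n : pcV (fun s => p s 1 n) := pcV_prim (hol_variation n).
have pN1 n : pcV (fun s => N1 s n).
  by apply: (pcV_cauchy bb) => k; [exact: Mi_pcV|exact: pp].
apply/funext => n.
rewrite -[LHS]/(- vint01 (fun s => vint01 (fun u =>
  cauchy (@ba_pure _ X) (integrand A G s u) (p s 1) n))).
have -> : vint01 (fun s => vint01 (fun u =>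
    cauchy (@ba_pure _ X) (integrand A G s u) (p s 1) n)) = vint01 (fun s => N1 s n).
  (* On the rows in [levels cs] the inner integrand is not controlled, but finitely many rows do not
     affect the outer integral. *)
  apply/esym; apply: (vint01_eq (E := levels cs) (pN1 n)) => s hs hl.
  have TTs : T s by split=> //; rewrite /= in_itv; exact: in01W.
  have pint k : pcV (fun u => integrand A G s u k) := regV_pcV T01 TTs (integrand_regV k).
  rewrite (_ : (fun u => _) = fun u => \sum_(i < n.+1) ba_ext (integrand A G s u i) (p s 1 (n - i)%N)).
    rewrite vint01_sum; last by move=> i; exact: (pcV_lin (bb.1 _) (pint i)).
    by apply: eq_bigr => i _; exact: (esym (vint01_lin (bb.1 _) (pint i))).
  apply/funext => u; apply: eq_bigr => i _; apply: ba_pureE.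
  by apply: primitive_counit; exact: integrand_primitive.
rewrite (vint01_prim (hN n) (pN1 n)).
rewrite [N 0 n](_ : _ = 0); last first.
  rewrite /N Q0 [LHS](_ : _ = - cauchy (@ba_ext _ X) (monom 0 1) (p 0 1) n)//.
  by rewrite (cauchy_monoml _ _ _ _ bb) /= ba_ext1 oppr0.
by rewrite subr0 [N 1 n](_ : _ = - cauchy (@ba_ext _ X) (Qs 1) (p 0 1) n)// opprK.
Qed.

End Variation.

(** * Comparison of the two holonomies *)

Section Theorem72.
Variables (R : realType) (X : hopfXmod R[i]) (M : manifold R).
Variables (A : hopf2conn X M) (hA : fully_primitive A).

Definition mk_gl (B : hopfAlg R[i]) (x y : fps B) (gx : grouplike_series x)
    (h : is_fps_inv *%R 1 x y) : gl B :=
  Gl gx.1 (ex_intro _ y h) gx.2.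

Lemma exact_holonomy1 (g : path1 M) : exists x : gl (hH X), gl_val x = Pilot.Defs.finv (holP A g 1 0).
Proof.
have pg := path1_pcV (omega A) g.
have [_ _ _ /(_ 1 (in01_1 R))[pq gp _]] := holP_pair hA pg.
by exists (mk_gl gp pq); rewrite (finv_holP hA pg).
Qed.

Lemma exact_holonomy2 (G : path2 M) : exists x : gl (hH X) * gl (hI X),
  [/\ gl_val x.1 = Pilot.Defs.finv (holP A (slice G 0) 1 0),
      gl_val x.2 = Pilot.Defs.finv (holQ A G 1 0)
    & map2 (TA (BA X)) (map2 (Inc X) x) =
      (Pilot.Defs.finv (holP A (slice G 0) 1 0), fuzzyR A G)].
Proof.
have [P [cov _ _] Psm] := p2_pw G.
have Pcov y : square y -> exists2 E, E \in P & polygon E y.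
  by rewrite cov => -[E EP hE]; exists E.
have side0 := @p2_left _ _ G; have side1 := @p2_right _ _ G; have Gc := @p2_cont _ _ G.
have pg := slice_pcV A Gc Pcov Psm (in01_0 R).
have [_ _ _ /(_ 1 (in01_1 R))[pq gp _]] := holP_pair hA pg.
have [e [_ _ eq ge gq]] := holQ_pair Gc Pcov Psm hA.
exists (mk_gl gp pq, mk_gl ge eq); split.
- by rewrite (finv_holP hA pg).
- by apply/esym; exact: (hmul_inv_unique (is_fps_invC eq)).
- rewrite (@TA_inc _ _ (mk_gl gp pq) (mk_gl ge eq) _ eq gq) (finv_holP hA pg) (fuzzyR_holQ Gc Pcov Psm side0 side1 hA).
  congr (_, _); rewrite (cauchyDl _ _ _ (@ba_ext_bilin _ X)) (cauchyNl _ _ (@ba_ext_bilin _ X)).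
  rewrite [X in - X](_ : _ = 0) ?oppr0 ?addr0//.
  apply/funext => n; rewrite (cauchy_monoml _ _ _ _ (@ba_ext_bilin _ X)) /=.
  exact: ba_ext1.
Qed.

End Theorem72.

Theorem theorem72 (R : realType) (X : hopfXmod (R[i])%C) (M : manifold R)
    (A : hopf2conn X M) (hA : fully_primitive A) :
  exists F : paths_map M (ctimes (gl (hH X)) (gl (hI X))),
    exact_holonomy A F /\
    paths_comp (cells_comp (TA (BA X)) (Inc X)) F = fuzzy_holonomy A.
Proof.
(* The values of [F] carry proofs of group-likeness, so [F] is obtained by choice from the
   statements for single paths. *)
have [f1 h1] := choice (exact_holonomy1 hA); have [f2 h2] := choice (exact_holonomy2 hA).
exists (@PathsMap _ M (ctimes (gl (hH X)) (gl (hI X))) f1 f2); split.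
  by split=> [g|G]; [exact: h1|have [] := h2 G].
rewrite /paths_comp /fuzzy_holonomy; congr PathsMap; apply/funext => x /=.
  exact: h1.
by have [_ _] := h2 x.
Qed.
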